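(* Let $n\in\mathbb{N}$ and $p\in(1,\infty)$. Suppose that $f\in\bigcup_{\alpha\in(0,1)}W^{-\alpha,p}(\mathbb{R}^n)$ and $$\liminf_{\alpha\to0^+}\alpha\|f\|_{W^{-\alpha,p}}^p<\infty .$$ Then $f\in L^p(\mathbb{R}^n)$, the limit $\lim_{\alpha\to0^+}\alpha\|f\|_{W^{-\alpha,p}}^p$ exists, and $$\lim_{\alpha\to0^+}\alpha\|f\|_{W^{-\alpha,p}}^p=\frac{2}{p}\|f\|_{L^p}^p .$$
   Context: $\mathbb{N}$ is the set of positive integers; $\|\cdot\|$ is the Euclidean norm on $\mathbb{R}^n$; $L^p(\mathbb{R}^n)$ is the Lebesgue space with respect to Lebesgue measure, with norm $\|\cdot\|_{L^p}$; $\mathcal{S}'(\mathbb{R}^n)$ is the space of tempered distributions. For $\alpha\in(0,1)$ and $q\in(1,\infty)$, $W^{\alpha,q}(\mathbb{R}^n)$ is the fractional Sobolev space of all $g\in L^q(\mathbb{R}^n)$ with $\int_{\mathbb{R}^n}\int_{\mathbb{R}^n}\frac{|g(x)-g(y)|^q}{\|x-y\|^{n+\alpha q}}\,dx\,dy<\infty$. For $p\in(1,\infty)$ and $\alpha\in(0,1)$, the negative Sobolev space $W^{-\alpha,p}(\mathbb{R}^n)$ is the dual space of $W^{\alpha,q}(\mathbb{R}^n)$, where $\frac1p+\frac1q=1$; since Schwartz functions are dense in $W^{\alpha,q}(\mathbb{R}^n)$, its elements are regarded as tempered distributions. For $t>0$ the heat kernel is $\Phi_t(x)=(4\pi t)^{-n/2}\exp\left(-\frac{\|x\|^2}{4t}\right)$,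 $x\in\mathbb{R}^n$. For $\alpha\in(0,1)$, the space $W^{-\alpha,p}(\mathbb{R}^n)$ is equipped with the (equivalent) norm $$\|f\|_{W^{-\alpha,p}}=\left(\int_0^1\left(t^{\alpha/2}\|f\ast\Phi_t\|_{L^p}\right)^p\frac{dt}{t}\right)^{1/p},$$ where $\ast$ denotes convolution (of a tempered distribution with a Schwartz function). Convention: $\|f\|_{W^{-\alpha,p}}=+\infty$ if $f\notin W^{-\alpha,p}(\mathbb{R}^n)$. The assertion $f\in L^p(\mathbb{R}^n)$ means that the distribution $f$ is represented by an $L^p$ function. *)

(* Defs.v *)
From HB Require Import structures.
From mathcomp Require Import all_boot all_order all_algebra.
From mathcomp Require Import all_classical all_reals all_analysis.

Set Implicit Arguments.
Unset Strict Implicit.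
Unset Printing Implicit Defensive.

Import Order.TTheory GRing.Theory Num.Theory.
Import numFieldNormedType.Exports.

Local Open Scope classical_set_scope.
Local Open Scope ring_scope.

(* R^n is 'rV[R]_n. The norm and topology MathComp-Analysis puts on it are     *)
(* those of the sup norm, so the Euclidean norm below is a separate function.  *)
(* All functions and distributions are real-valued.                            *)

Definition measure_rV_display : measure_display -> measure_display.
Proof. exact. Qed.

(* The sigma-algebra generated by the coordinates, as for n.-tuple T. *)
Section measurable_rV.
Context {d} {T : measurableType d} (n : nat).

Let coord (i : 'I_n) (x : 'rV[T]_n) : T := x ord0 i.

Let rV_set0 : g_sigma_preimage coord set0.
Proof. exact: sigma_algebra0. Qed.

Let rV_setC A : g_sigma_preimage coord A -> g_sigma_preimage coord (~` A).
Proof. exact: sigma_algebraC. Qed.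

Let rV_bigcup (F : _^nat) : (forall i, g_sigma_preimage coord (F i)) ->
  g_sigma_preimage coord (\bigcup_i (F i)).
Proof. exact: sigma_algebra_bigcup. Qed.

HB.instance Definition _ := @isMeasurable.Build (measure_rV_display d)
  'rV[T]_n (g_sigma_preimage coord) rV_set0 rV_setC rV_bigcup.

End measurable_rV.

Lemma measurable_coord d (T : measurableType d) n (i : 'I_n) :
  measurable_fun [set: 'rV[T]_n] (fun x => x ord0 i).
Proof.
move=> _ Y mY; rewrite setTI; apply: sub_sigma_algebra => /=.
rewrite -bigcup_seq/=; exists i => /=; first by rewrite mem_index_enum.
by exists Y => //; rewrite setTI.
Qed.

Lemma measurable_fun_coordP d1 d2 (T1 : measurableType d1)
    (T2 : measurableType d2) n (f : T1 -> 'rV[T2]_n) :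
  (forall i, measurable_fun [set: T1] (fun x => f x ord0 i)) ->
  measurable_fun [set: T1] f.
Proof.
move=> mf; apply: (measurability (\big[setU/set0]_(i < n)
  preimage_set_system setT (fun x : 'rV[T2]_n => x ord0 i) measurable)) => //.
move=> _ [B + <-]; rewrite -bigcup_seq => -[i _ [A mA <-]].
rewrite setTI (_ : f @^-1` _ = [set: T1] `&` (fun x => f x ord0 i) @^-1` A).
  exact: (mf i measurableT A mA).
by rewrite !setTI.
Qed.

Section lebesgue_rV.
Context {R : realType}.

Definition cons_rV n (p : measurableTypeR R * 'rV[R]_n) : 'rV[R]_n.+1 :=
  row_mx (p.1%:M : 'rV[R]_1) p.2.

Lemma cons_rV0 n p : @cons_rV n p ord0 ord0 = p.1.
Proof. by rewrite /cons_rV mxE; case: split_ordP => // j _; rewrite mxE !ord1. Qed.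

Lemma cons_rVS n p i : @cons_rV n p ord0 (lift ord0 i) = p.2 ord0 i.
Proof.
rewrite /cons_rV mxE; case: split_ordP => [j|j ij].
  by rewrite (ord1 j) => /(congr1 val).
by congr (p.2 _ _); apply/val_inj; case: (congr1 val ij).
Qed.

Lemma measurable_cons_rV n : measurable_fun setT (@cons_rV n).
Proof.
apply: measurable_fun_coordP => i.
case: (unliftP ord0 i) => [j|] ->.
  under eq_fun do rewrite cons_rVS.
  by apply: (measurableT_comp (measurable_coord j)).
under eq_fun do rewrite cons_rV0.
exact: measurable_fst.
Qed.

Definition uncons_rV n (v : 'rV[R]_n.+1) : measurableTypeR R * 'rV[R]_n :=
  (v ord0 ord0, \row_i v ord0 (lift ord0 i)).

Lemma cons_rVK n : cancel (@cons_rV n) (@uncons_rV n).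
Proof.
move=> [a v]; rewrite /uncons_rV cons_rV0; congr pair.
by apply/rowP => i; rewrite mxE cons_rVS.
Qed.

Lemma uncons_rVK n : cancel (@uncons_rV n) (@cons_rV n).
Proof.
move=> v; apply/rowP => i.
by case: (unliftP ord0 i) => [j|] ->; rewrite ?cons_rVS ?cons_rV0 //= mxE.
Qed.

Lemma measurable_uncons_rV n : measurable_fun setT (@uncons_rV n).
Proof.
apply/measurable_fun_pairP; split; first exact: (measurable_coord ord0).
apply: measurable_fun_coordP => i.
under eq_fun do rewrite /= mxE.
exact: measurable_coord.
Qed.

Section cons_measure.
Variables (n : nat) (m : {sigma_finite_measure set 'rV[R]_n -> \bar R}).

Let M : {measure set _ -> \bar R} := (@lebesgue_measure R \x m)%E.

Let pushm := pushforward M (@cons_rV n).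

Let measurable_precons A : measurable A -> measurable (@cons_rV n @^-1` A).
Proof.
by move=> mA; rewrite -[X in measurable X]setTI; exact: measurable_cons_rV.
Qed.

Let pushm0 : pushm set0 = 0%E.
Proof. by rewrite /pushm /pushforward preimage_set0 measure0. Qed.

Let pushm_ge0 A : (0 <= pushm A)%E.
Proof. by rewrite /pushm /pushforward measure_ge0. Qed.

Let pushm_sigma_additive : semi_sigma_additive pushm.
Proof.
move=> F mF tF mUF; rewrite /pushm /pushforward preimage_bigcup.
apply: measure_semi_sigma_additive.
- by move=> k; exact: measurable_precons.
- apply/trivIsetP => /= i j _ _ ij; rewrite -preimage_setI.
  by move/trivIsetP : tF => /(_ _ _ _ _ ij) ->//; rewrite preimage_set0.
- by rewrite -preimage_bigcup; exact: measurable_precons.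
Qed.

HB.instance Definition _ := isMeasure.Build _ _ _ pushm
  pushm0 pushm_ge0 pushm_sigma_additive.

Let pushm_sigma_finite : sigma_finite setT pushm.
Proof.
have /sigma_finiteP[F [FT ndF Foo]] := sigma_finiteT (@lebesgue_measure R).
have /sigma_finiteP[G [GT ndG Goo]] := sigma_finiteT m.
exists (fun k => @uncons_rV n @^-1` (F k `*` G k)).
  rewrite -preimage_bigcup (_ : \bigcup_k _ = setT) ?preimage_setT//.
  rewrite -setXTT FT GT predeqE => -[x y]; split.
    by move=> [k _ []/= ? ?]; split; exists k.
  move=> [/= [k _ Fkx] [l _ Gly]]; exists (maxn k l) => //; split.
  - by move: x Fkx; exact/subsetPset/ndF/leq_maxl.
  - by move: y Gly; exact/subsetPset/ndG/leq_maxr.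
move=> k; have [mF Fk] := Foo k; have [mG Gk] := Goo k; split.
  rewrite -[X in measurable X]setTI; apply: measurable_uncons_rV => //.
  exact: measurableX.
rewrite /pushm /pushforward -comp_preimage (_ : _ \o _ = id); last first.
  by apply/funext => x; exact: cons_rVK.
by rewrite preimage_id /M /= product_measure1E// lte_mul_pinfty// ge0_fin_numE.
Qed.

HB.instance Definition _ := Measure_isSigmaFinite.Build _ _ _ pushm
  pushm_sigma_finite.

Lemma cons_measure_subproof :
  exists m' : {sigma_finite_measure set 'rV[R]_n.+1 -> \bar R},
    m' = pushforward (lebesgue_measure \x m)%E (@cons_rV n)
      :> (set _ -> \bar R).
Proof. by exists pushm. Qed.

End cons_measure.

Fixpoint lebesgue_rV n : set 'rV[R]_n -> \bar R :=
  match n with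
  | 0 => \d_(0 : 'rV[R]_0)
  | n.+1 => pushforward (lebesgue_measure \x @lebesgue_rV n)%E (@cons_rV n)
  end.

Lemma lebesgue_rV_subproof n :
  exists m : {sigma_finite_measure set 'rV[R]_n -> \bar R},
    m = @lebesgue_rV n :> (set _ -> \bar R).
Proof.
elim: n => [|n [m mE]]; first by exists (\d_(0 : 'rV[R]_0)).
by have [m' m'E] := cons_measure_subproof m; exists m'; rewrite m'E /= -mE.
Qed.

Section lebesgue_rV_measure.
Variable n : nat.

Let lebesgue_rV0 : @lebesgue_rV n set0 = 0%E.
Proof. by have [m <-] := lebesgue_rV_subproof n; exact: measure0. Qed.

Let lebesgue_rV_ge0 A : (0 <= @lebesgue_rV n A)%E.
Proof. by have [m <-] := lebesgue_rV_subproof n; exact: measure_ge0. Qed.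

Let lebesgue_rV_sigma_additive : semi_sigma_additive (@lebesgue_rV n).
Proof.
have [m <-] := lebesgue_rV_subproof n; exact: measure_semi_sigma_additive.
Qed.

HB.instance Definition _ := isMeasure.Build _ _ _ (@lebesgue_rV n)
  lebesgue_rV0 lebesgue_rV_ge0 lebesgue_rV_sigma_additive.

Let lebesgue_rV_sigma_finite : sigma_finite setT (@lebesgue_rV n).
Proof. by have [m <-] := lebesgue_rV_subproof n; exact: sigma_finiteT. Qed.

HB.instance Definition _ := Measure_isSigmaFinite.Build _ _ _ (@lebesgue_rV n)
  lebesgue_rV_sigma_finite.

End lebesgue_rV_measure.

Lemma lebesgue_rV_box n (A : 'I_n -> set (measurableTypeR R)) :
  (forall i, measurable (A i)) ->
  lebesgue_rV [set x : 'rV[R]_n | forall i, A i (x ord0 i)] =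
  (\prod_(i < n) lebesgue_measure (A i))%E.
Proof.
elim: n A => [|n IHn] A mA.
  by rewrite big_ord0 /= diracE mem_set// => -[].
rewrite big_ord_recl -IHn; last by move=> i; exact: mA.
rewrite -product_measure1E//.
- rewrite /= /pushforward; congr (_ _); apply/seteqP; split=> -[a v] /=.
    by move=> H; split=> [|i]; [have := H ord0|have := H (lift ord0 i)];
      rewrite ?cons_rV0 ?cons_rVS.
  by move=> [H0 H] i; case: (unliftP ord0 i) => [j|] ->;
    rewrite ?cons_rV0 ?cons_rVS.
- rewrite (_ : [set _ | _] = \bigcap_(i in [set: 'I_n])
      (fun x : 'rV[R]_n => x ord0 i) @^-1` A (lift ord0 i)); last first.
    by apply/seteqP; split=> x /= H i; [move=> _; exact: H|exact: (H i)].
  apply: fin_bigcap_measurable => // i _.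
  rewrite -[X in measurable X]setTI; apply: measurable_coord => //.
  exact: mA.
Qed.

End lebesgue_rV.

Section schwartz.
Context {R : realType} {n : nat}.
Implicit Types (phi : 'rV[R]_n -> R) (x : 'rV[R]_n).

Definition enorm x : R := Num.sqrt (\sum_(i < n) x ord0 i ^+ 2).

(* The iterated partial derivative along the list of coordinates s. *)
Fixpoint partials (s : seq 'I_n) phi : 'rV[R]_n -> R :=
  if s is i :: s' then 'D_(delta_mx ord0 i) (partials s' phi) else phi.

Definition smooth phi : Prop := forall s : seq 'I_n,
  continuous (partials s phi) /\
  forall i x, derivable (partials s phi) x (delta_mx ord0 i).

Definition schwartz_norm (k : nat) phi : \bar R :=
  ereal_sup [set r | exists s x, (size s <= k)%N /\
    r = ((1 + enorm x) ^+ k * `|partials s phi x|)%:E].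

Definition schwartz : set ('rV[R]_n -> R) :=
  [set phi | smooth phi /\ forall k, (schwartz_norm k phi < +oo)%E].

Definition linear_on (S : set ('rV[R]_n -> R)) (L : ('rV[R]_n -> R) -> R) :=
  forall (a : R) (g h : 'rV[R]_n -> R), S g -> S h ->
    L (fun x => a * g x + h x) = a * L g + L h.

End schwartz.

(* Only the values on Schwartz functions are meaningful. Continuity is stated  *)
(* with respect to the increasing family of norms schwartz_norm k, which       *)
(* generates the topology of the Schwartz space.                               *)
Record tempered_distribution (R : realType) (n : nat) := TemperedDistribution {
  td_eval :> ('rV[R]_n -> R) -> R ;
  td_linear : linear_on schwartz td_eval ;
  td_continuous : exists (C : R) (k : nat), forall phi, schwartz phi ->
    (`|td_eval phi|%:E <= C%:E * schwartz_norm k phi)%E }.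

Section sobolev.
Context {R : realType} {n : nat}.
Implicit Types (alpha p q t : R) (f : tempered_distribution R n).
Local Notation mu := (@lebesgue_rV R n).

Definition Lp p : set ('rV[R]_n -> R) := [set g | g \in Lfun mu p%:E].

Definition gagliardo alpha q (g : 'rV[R]_n -> R) : \bar R :=
  (\int[mu]_y \int[mu]_x
    (`|g x - g y| `^ q / enorm (x - y) `^ (n%:R + alpha * q))%:E)%E.

Definition sobolev alpha q : set ('rV[R]_n -> R) :=
  [set g | Lp q g /\ (gagliardo alpha q g < +oo)%E].

Definition sobolev_norm alpha q (g : 'rV[R]_n -> R) : \bar R :=
  (('N[mu]_q%:E[EFin \o g] `^ q + gagliardo alpha q g) `^ q^-1)%E.

Definition conjugate_exponent p : R := (1 - p^-1)^-1.

(* f is the restriction to Schwartz functions of a bounded linear functional   *)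
(* on W^{alpha,q}; boundedness makes L blind to changes on null sets.          *)
Definition neg_sobolev alpha p f : Prop :=
  let q := conjugate_exponent p in
  exists L : ('rV[R]_n -> R) -> R,
    [/\ linear_on (sobolev alpha q) L,
        exists C : R, forall g, sobolev alpha q g ->
          (`|L g|%:E <= C%:E * sobolev_norm alpha q g)%E
      & forall phi, schwartz phi -> L phi = f phi].

Definition heat_kernel t (x : 'rV[R]_n) : R :=
  (4 * pi * t) `^ (- (n%:R / 2)) * expR (- (enorm x ^+ 2 / (4 * t))).

Definition convolution f (phi : 'rV[R]_n -> R) (x : 'rV[R]_n) : R :=
  f (fun y => phi (x - y)).

Definition neg_sobolev_norm alpha p f : \bar R :=
  if `[< neg_sobolev alpha p f >] then
    ((\int[lebesgue_measure]_(t in `]0%R, 1%R[)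
       (((t `^ (alpha / 2))%:E *
         'N[mu]_p%:E[EFin \o convolution f (heat_kernel t)]) `^ p
        * (t^-1)%:E)) `^ p^-1)%E
  else +oo%E.

Definition represents (g : 'rV[R]_n -> R) f : Prop :=
  forall phi, schwartz phi -> (f phi)%:E = (\int[mu]_x (g x * phi x)%:E)%E.

End sobolev.

(* Main.v *)
Require Import Defs.
From HB Require Import structures.
From mathcomp Require Import all_boot all_order all_algebra.
From mathcomp Require Import all_classical all_reals all_analysis.
From mathcomp Require Import measurable_realfun ring lra.
Import Order.TTheory GRing.Theory Num.Theory.
Import numFieldNormedType.Exports.
Local Open Scope classical_set_scope.
Local Open Scope ring_scope.
Set Implicit Arguments.
Unset Strict Implicit.
Unset Printing Implicit Defensive.

(* Put F t := ||f * Phi_t||_p^p, so that ||f||_{W^{-alpha,p}}^p is the integral *)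
(* of t^{alpha p / 2 - 1} F t over ]0, 1[. The weight alpha t^{alpha p / 2 - 1} *)
(* has mass 2/p on every ]0, eta[ up to an error tending to 0 with alpha, so a  *)
(* finite liminf bounds F along some t_k -> 0; let M be the least bound         *)
(* attained in this way. As f * Phi_t -> f in the sense of distributions, weak  *)
(* compactness gives g with ||g||_p^p <= M representing f, and then Young's     *)
(* inequality F t <= ||g||_p^p and the minimality of M force F t -> M =         *)
(* ||g||_p^p as t -> 0, whence the limit (2/p) M.                               *)
(* Weak compactness is obtained from uniform convexity: vectors of almost       *)
(* minimal norm in a decreasing sequence of convex sets form a Cauchy sequence. *)

(** * Uniform convexity and weak limits in L^p *)

(** Write F t for [heat_energy p f t]. The quantity alpha ||f||^p is the integral of F against alpha
    t^{alpha p/2 - 1} dt on ]0, 1[, a measure of mass 2/p that concentrates at 0 as alpha -> 0. The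
    theorem thus reduces to showing that F tends to ||g||_p^p at 0 for some g representing f. Bounds
    on F pass to the integral by [neg_sobolev_norm_pow_ge] and [neg_sobolev_norm_pow_le].

    If F stayed above a large constant near 0, the liminf would be large too; so F is bounded along
    some times tending to 0 ([heat_energy_frequently_bounded]). Let M be the infimum of such bounds,
    that is, the liminf of F at 0. Along suitable times the functions f * Phi_t have p-th power
    integral at most M + 1/(k+1), and they converge to f as distributions with error O(sqrt t)
    ([td_heat_limit]), so [td_weak_limit] yields g representing f with ||g||_p^p <= M. Now f * Phi_t
    = g * Phi_t, and Young's inequality ([pow_integral_convolution_le]) gives F <= ||g||_p^p. Hence
    ||g||_p^p is itself one of the bounds, so it equals M, and F exceeds every d < M near 0. This is
    [heat_energy_representative]; [neg_sobolev_norm_limit] then squeezes.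

    Two ingredients take most of the work. Weak compactness comes from the pointwise inequality
    [uniform_convexity_powR], through [Lp_minimizing_limit]. Distributional convergence rests on
    [td_conv], which moves a tempered distribution under a convolution integral. *)

Lemma norm_powR_continuous (R : realType) (p : R) : 0 < p ->
  continuous (fun x : R => `|x| `^ p).
Proof.
move=> p0 x; have [->|x0] := eqVneq x 0.
  apply/cvgrPdist_lt => e e0; near=> y.
  rewrite normr0 powR0 ?gt_eqF// sub0r normrN ger0_norm ?powR_ge0//.
  have -> : e = (e `^ p^-1) `^ p by rewrite -powRrM mulVf ?gt_eqF// powRr1// ltW.
  rewrite gt0_ltr_powR ?nnegrE ?powR_ge0//.
  near: y; apply: (@nbhs0_lt _ R); exact: powR_gt0.
apply: (@continuous_comp R R R Num.norm (@powR R ^~ p) x); first exact: norm_continuous.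
apply/differentiable_continuous/derivable1_diffP/derivable_powR.
by rewrite in_itv/= andbT normr_gt0.
Unshelve. all: by end_near. Qed.

(** Apply 1 + u < exp u twice. With u = (p - 1) ln x it gives x^p > x + (p - 1) x ln x; with u = -
    ln x it gives x ln x > x - 1. *)
Lemma bernoulli_powR_lt (R : realType) (p x : R) : 1 < p -> 0 <= x -> x != 1 ->
  1 + p * (x - 1) < x `^ p.
Proof.
move=> p1; rewrite le_eqVlt => /predU1P[<- _|x0 x1].
  by rewrite powR0; [lra|rewrite gt_eqF//; lra].
have lnx0 : ln x != 0 by rewrite ln_eq0.
have -> : x `^ p = x * expR ((p - 1) * ln x).
  by rewrite -{2}(lnK x0) -expRD /powR gt_eqF//; congr expR; ring.
have := @expR_gt1Dx _ ((p - 1) * ln x).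
rewrite mulf_neq0 ?lnx0 ?subr_eq0 ?(gt_eqF p1)// => /(_ isT) h1.
have := @expR_gt1Dx _ (- ln x); rewrite oppr_eq0 => /(_ lnx0).
rewrite expRN lnK// => h2.
have {}h2 : x * (1 - ln x) < 1.
  by rewrite -[ltRHS](@mulfV _ x) ?gt_eqF// ltr_pM2l.
have {}h1 : x * (1 + (p - 1) * ln x) < x * expR ((p - 1) * ln x).
  by rewrite ltr_pM2l.
nra.
Qed.

(** After division by the midpoint m, Bernoulli's inequality applies at 1/m and b/m. These average
    to 1, so the linear terms cancel in the sum. *)
Lemma powR_midpoint_lt (R : realType) (p b : R) : 1 < p -> 0 <= b -> b != 1 ->
  ((1 + b) / 2) `^ p < (1 + b `^ p) / 2.
Proof.
move=> p1 b0 b1; set m := (1 + b) / 2.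
have m0 : 0 < m by rewrite /m; lra.
have mp0 : 0 < m `^ p by exact: powR_gt0.
have h1 : 1 + p * (m^-1 - 1) < m^-1 `^ p.
  apply: bernoulli_powR_lt => //; first by rewrite invr_ge0 ltW.
  by rewrite invr_eq1; apply: contra b1 => /eqP; rewrite /m => ?; apply/eqP; lra.
have h2 : 1 + p * (b / m - 1) < (b / m) `^ p.
  apply: bernoulli_powR_lt => //; first by rewrite divr_ge0// ltW.
  apply: contra b1 => /eqP bm.
  have : b = m by rewrite -[LHS](divfK (lt0r_neq0 m0)) bm mul1r.
  by rewrite /m => ?; apply/eqP; lra.
have e1 : m^-1 `^ p = (m `^ p)^-1.
  by rewrite -powR_inv1 ?ltW// -powRrM mulN1r powRN.
have e2 : (b / m) `^ p = b `^ p / m `^ p by rewrite powRM ?invr_ge0 ?(ltW m0)// e1.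
rewrite e1 in h1; rewrite e2 in h2.
have h3 : 2 < (1 + b `^ p) / m `^ p.
  rewrite mulrDl mul1r.
  have -> : 2 = (1 + p * (m^-1 - 1)) + (1 + p * (b / m - 1)) :> R.
    have : m^-1 + b / m = 2 by rewrite /m; field; rewrite lt0r_neq0//; lra.
    move=> h; transitivity (2 + p * (m^-1 + b / m - 2)); first by rewrite h; ring.
    ring.
  exact: ltrD.
rewrite ltr_pdivlMr// in h3; lra.
Qed.

Lemma norm_powR_midpoint_lt (R : realType) (p b : R) : 1 < p -> `|b| <= 1 ->
  b != 1 -> `|(1 + b) / 2| `^ p < (1 + `|b| `^ p) / 2.
Proof.
move=> p1 b1 bn1; have [b0|b0] := leP 0 b.
  by rewrite (ger0_norm b0) ger0_norm ?powR_midpoint_lt//; lra.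
have h : `|(1 + b) / 2| < (1 + `|b|) / 2.
  by move: b1; rewrite (ltr0_norm b0) => b1; rewrite ger0_norm; lra.
(* The value b = -1 is separate because [powR_midpoint_lt] is strict only for [|b| != 1]. *)
have [bb|bb] := eqVneq `|b| 1.
  have -> : b = -1 by move: bb; rewrite (ltr0_norm b0); lra.
  rewrite addrN mul0r normr0 normrN1 powR1 powR0 ?gt_eqF//; lra.
apply: le_lt_trans (powR_midpoint_lt p1 (normr_ge0 _) bb).
by rewrite ge0_ler_powR ?nnegrE//; lra.
Qed.

(** Pointwise uniform convexity of the p-th power. By symmetry and homogeneity a = 1 and |b| <= 1.
    If b is near 1, the term in e dominates; otherwise b lies in a compact interval on which the
    midpoint deficit D has a positive minimum, and a large C absorbs everything. *)
Lemma uniform_convexity_powR (R : realType) (p e : R) : 1 < p -> 0 < e ->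
  exists2 C : R, 0 <= C & forall a b : R,
    `|a - b| `^ p <= e * (`|a| `^ p + `|b| `^ p) +
      C * ((`|a| `^ p + `|b| `^ p) / 2 - `|(a + b) / 2| `^ p).
Proof.
move=> p1 e0; have p0 : 0 < p by lra.
pose D (b : R) := (1 + `|b| `^ p) / 2 - `|(1 + b) / 2| `^ p.
suff [C C0 HC] : exists2 C : R, 0 <= C & forall b : R, `|b| <= 1 ->
    `|1 - b| `^ p <= e * (1 + `|b| `^ p) + C * D b.
  exists C => // a b.
  wlog ba : a b / `|b| <= `|a|.
    move=> wl; have [|/ltW] := leP `|b| `|a|; first exact: wl.
    by move=> /wl; rewrite distrC (addrC (`|b| `^ p)) (addrC b).
  have [a0|a0] := eqVneq a 0.
    have b0 : b = 0.
      by apply/eqP; rewrite -normr_le0 (le_trans ba)// a0 normr0.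
    rewrite a0 b0 subr0 addr0 mul0r normr0 powR0 ?gt_eqF//; lra.
  have na : 0 < `|a| by rewrite normr_gt0.
  have /HC : `|b / a| <= 1 by rewrite normf_div ler_pdivrMr// mul1r.
  have ap : 0 < `|a| `^ p by exact: powR_gt0.
  rewrite -(ler_pM2l ap) /D.
  have sc u : `|a| `^ p * `|u| `^ p = `|a * u| `^ p by rewrite normrM powRM.
  have e1 : `|a - b| `^ p = `|a| `^ p * `|1 - b / a| `^ p.
    by rewrite sc; congr (`|_| `^ _); field.
  have e2 : `|b| `^ p = `|a| `^ p * `|b / a| `^ p.
    by rewrite sc; congr (`|_| `^ _); field.
  have e3 : `|(a + b) / 2| `^ p = `|a| `^ p * `|(1 + b / a) / 2| `^ p.
    by rewrite sc; congr (`|_| `^ _); field.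
  rewrite e1 e2 e3 => h; apply: (le_trans h); rewrite le_eqVlt; apply/orP; left.
  by apply/eqP; ring.
(* If 1 - b < d then |1 - b|^p <= e; the cap at 1 keeps the interval [-1, 1 - d] nonempty. *)
pose d := Num.min 1 (e `^ p^-1).
have d0 : 0 < d by rewrite lt_min ltr01 powR_gt0.
have d1 : d <= 1 by rewrite ge_min lexx.
have [c cI Dc] : exists2 c, c \in `[(-1), (1 - d)] &
    forall t, t \in `[(-1), (1 - d)] -> D c <= D t.
  apply: EVT_min; first lra.
  apply: continuous_subspaceT => x.
  apply: cvgB; last first.
    apply: (@continuous_comp _ _ _ (fun b : R => (1 + b) / 2)
      (fun x => `|x| `^ p)); last exact: norm_powR_continuous.
    by apply: cvgMl; apply: cvgD; [exact: cvg_cst|exact: cvg_id].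
  by apply: cvgMl; apply: cvgD; [exact: cvg_cst|exact: norm_powR_continuous].
have Dpos b : `|b| <= 1 -> 0 <= D b.
  move=> b1; rewrite subr_ge0; have [->|bn1] := eqVneq b 1.
    rewrite divff// normr1 powR1; lra.
  exact/ltW/norm_powR_midpoint_lt.
have Dc0 : 0 < D c.
  move: cI; rewrite in_itv/= => /andP[c1 c2].
  rewrite subr_gt0; apply: norm_powR_midpoint_lt => //.
    by rewrite ler_norml; lra.
  by rewrite lt_eqF//; lra.
(* Since |1 - b| <= 2, dividing 2^p by the minimum D c makes C * D b at least |1 - b|^p on the
   compact interval. *)
exists (2 `^ p / D c) => [|b b1]; first by rewrite divr_ge0 ?powR_ge0// ltW.
have [db|db] := leP d (1 - b).
  have bp : 0 <= e * (1 + `|b| `^ p).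
    by rewrite mulr_ge0 ?addr_ge0 ?powR_ge0// ltW.
  rewrite -[leLHS]add0r lerD//.
  apply: (@le_trans _ _ (2 `^ p)).
    rewrite ge0_ler_powR ?nnegrE// ?(ltW p0)//.
    by rewrite (le_trans (ler_normB _ _))// normr1; lra.
  rewrite -mulrA ler_peMr ?powR_ge0// mulrC ler_pdivlMr// mul1r Dc//.
  by rewrite in_itv/=; move: b1; rewrite ler_norml; lra.
rewrite -[leLHS]addr0 lerD//; last first.
  by rewrite mulr_ge0 ?Dpos// divr_ge0 ?powR_ge0// ltW.
apply: (@le_trans _ _ e); last by rewrite ler_peMr ?lerDl ?powR_ge0// ltW.
have -> : e = (e `^ p^-1) `^ p by rewrite -powRrM mulVf ?gt_eqF// powRr1// ltW.
rewrite ge0_ler_powR ?nnegrE ?powR_ge0// ?(ltW p0)//.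
move: b1; rewrite ler_norml => /andP[_ b1].
rewrite ger0_norm; last by rewrite subr_ge0.
by rewrite (le_trans (ltW db))// ge_min lexx orbT.
Qed.

(** The number b k is the sum of all steps from k on, so the intervals [u k - b k, u k + b k] are
    nested; the supremum of their left ends lies in all of them. *)
Lemma geometric_cauchy_limit (R : realType) (u : R^nat) (s : R) : 0 <= s ->
  (forall k, `|u k.+1 - u k| <= s * 2^-1 ^+ k) ->
  exists l, forall k, `|l - u k| <= 2 * s * 2^-1 ^+ k.
Proof.
move=> s0 Hu; pose b k : R := 2 * s * 2^-1 ^+ k.
have b0 k : 0 <= b k by rewrite /b !mulr_ge0// exprn_ge0.
have bS k : b k - b k.+1 = s * 2^-1 ^+ k by rewrite /b exprS; field.
have vw j k : u j - b j <= u k + b k.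
  have iw i m : u (m + i)%N + b (m + i)%N <= u m + b m.
    elim: i => [|i ih]; first by rewrite addn0.
    rewrite addnS; apply: (le_trans _ ih).
    by have := Hu (m + i)%N; rewrite -bS ler_norml; lra.
  have ij i m : u m - b m <= u (m + i)%N - b (m + i)%N.
    elim: i => [|i ih]; first by rewrite addn0.
    rewrite addnS; apply: (le_trans ih).
    by have := Hu (m + i)%N; rewrite -bS ler_norml; lra.
  have [jk|/ltnW kj] := leqP j k.
    have := ij (k - j)%N j; rewrite subnKC// => /le_trans; apply.
    by have := b0 k; lra.
  have := iw (j - k)%N k; rewrite subnKC//; have := b0 j; lra.
pose A := [set u k - b k | k in [set: nat]].
exists (sup A) => k; rewrite ler_distl; apply/andP; split.
  apply: ub_le_sup; last by exists k.
  by exists (u 0%N + b 0%N) => _ [j _ <-].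
apply: ge_sup; first by exists (u 0%N - b 0%N); exists 0%N.
by move=> _ [j _ <-].
Qed.

(** * Completeness of L^p and almost minimal sequences *)

Definition pow_integral d (T : measurableType d) (R : realType)
    (mu : {measure set T -> \bar R}) (p : R) (h : T -> R) : \bar R :=
  (\int[mu]_x (`|h x| `^ p)%:E)%E.

Lemma measurable_norm_powR d (T : measurableType d) (R : realType) (p : R)
  (h : T -> R) : measurable_fun setT h ->
  measurable_fun setT (fun x => `|h x| `^ p).
Proof.
move=> mh; apply: (measurableT_comp (measurable_powR p)).
exact: measurableT_comp.
Qed.

Lemma pow_integral_ge0 d (T : measurableType d) (R : realType)
    (mu : {measure set T -> \bar R}) (p : R) h : (0 <= pow_integral mu p h)%E.
Proof. by apply: integral_ge0 => x _; rewrite lee_fin powR_ge0. Qed.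

(** The Riesz-Fischer argument with a rate. The sum S of the (2^k |u_{k+1} - u_k|)^p has integral at
    most 2, because the rate 4^-k leaves (2^-k)^p <= 2^-k. Where S is finite, the steps are at most
    S^{1/p} 2^-k, and the resulting tail bound is integrated. *)
Lemma Lp_fast_cauchy_limit d (T : measurableType d) (R : realType)
    (mu : {measure set T -> \bar R}) (p : R) (u : nat -> T -> R) : 1 < p ->
  (forall k, measurable_fun setT (u k)) ->
  (forall k, (pow_integral mu p (fun x => u k.+1 x - u k x)%R
    <= ((4^-1 ^+ k) `^ p)%:E)%E) ->
  exists g : T -> R, [/\ measurable_fun setT g,
    {ae mu, forall x, u ^~ x @ \oo --> g x} &
    exists2 K : R, 0 <= K & forall k,
      (pow_integral mu p (fun x => g x - u k x)%R
        <= (K * (2^-1 ^+ k) `^ p)%:E)%E].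
Proof.
move=> p1 mu_ Hu; have p0 : 0 < p by lra.
pose w k x := (2 ^+ k * `|u k.+1 x - u k x|) `^ p.
have w0 k x : 0 <= w k x by exact: powR_ge0.
have mD k : measurable_fun setT (fun x => u k.+1 x - u k x).
  exact: measurable_funB.
have mw k : measurable_fun setT (w k).
  apply: (measurableT_comp (measurable_powR p)).
  by apply: measurable_funM => //; exact: measurableT_comp.
pose S x := (\sum_(0 <= k <oo) (w k x)%:E)%E.
have mS : measurable_fun setT S.
  apply: ge0_emeasurable_sum => [k x _ _|k _]; first by rewrite lee_fin.
  exact/measurable_EFinP.
have S0 x : (0 <= S x)%E by apply: nneseries_ge0 => k _ _; rewrite lee_fin.
have iS : (\int[mu]_x S x <= 2%:E)%E.
  rewrite integral_nneseries//; first last.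
  - by move=> k x _; rewrite lee_fin.
  - by move=> k; exact/measurable_EFinP.
  have hk k : (\int[mu]_x (w k x)%:E <= (1 * 2^-1 ^+ k)%:E)%E.
    have -> : (\int[mu]_x (w k x)%:E = ((2 ^+ k) `^ p)%:E *
        pow_integral mu p (fun x => u k.+1 x - u k x)%R)%E.
      rewrite /pow_integral -ge0_integralZl_EFin ?powR_ge0//.
      - by apply: eq_integral => x _; rewrite -EFinM /w powRM.
      - exact/measurable_EFinP/measurable_norm_powR.
    apply: (@le_trans _ _ (((2 ^+ k) `^ p)%:E * ((4^-1 ^+ k) `^ p)%:E)%E).
      by rewrite lee_wpmul2l// lee_fin powR_ge0.
    rewrite -EFinM lee_fin -powRM ?exprn_ge0// -exprMn.
    have -> : 2 * 4^-1 = 2^-1 :> R by field.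
    rewrite mul1r ge1r_powR ?(ltW p1)// exprn_gt0//=.
    by apply: exprn_ile1 => //; lra.
  apply: (@le_trans _ _ (\sum_(0 <= k <oo) (1 * 2^-1 ^+ k)%:E)%E).
    apply: lee_nneseries => [k _ _|k _]; last exact: hk.
    by apply: integral_ge0 => x _; rewrite lee_fin.
  apply: lime_le.
    by apply: is_cvg_nneseries => k _ _; rewrite lee_fin mul1r exprn_ge0.
  apply: nearW => k; rewrite sumEFin lee_fin.
  have h : 1 / (1 - 2^-1) = 2 :> R by field.
  rewrite -[leRHS]h; apply: (@geometric_le_lim _ k (1:R) (2^-1)) => //.
  by rewrite ger0_norm//; lra.
pose s x := fine (S x) `^ p^-1.
have du x k : (S x < +oo)%E -> `|u k.+1 x - u k x| <= s x * 2^-1 ^+ k.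
  move=> Sx; have wS : w k x <= fine (S x).
    rewrite -lee_fin fineK ?ge0_fin_numE//.
    apply: le_trans (@nneseries_lim_ge _ _ xpredT 0%N k.+1 _).
      rewrite big_nat_recr//= leeDr// sume_ge0// => i _.
      by rewrite lee_fin.
    by move=> n _ _; rewrite lee_fin.
  rewrite exprVn ler_pdivlMr ?exprn_gt0// mulrC.
  have -> : 2 ^+ k * `|u k.+1 x - u k x| = w k x `^ p^-1.
    by rewrite /w -powRrM mulfV ?gt_eqF// powRr1// mulr_ge0.
  by rewrite ge0_ler_powR ?nnegrE ?invr_ge0 ?(ltW p0)// fine_ge0.
(* On the null set where S is infinite g is set to 0, which makes g an everywhere limit of u_k times
   an indicator and hence measurable. *)
have /choice[g Hg] : forall x, exists l,
    if (S x < +oo)%E then forall k, `|l - u k x| <= 2 * s x * 2^-1 ^+ k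
    else l = 0.
  move=> x; have [Sx|_] := boolP (S x < +oo)%E; last by exists 0.
  apply: geometric_cauchy_limit; first exact: powR_ge0.
  by move=> k; exact: du.
have cvg_g x : (S x < +oo)%E -> u ^~ x @ \oo --> g x.
  move=> Sx; have := Hg x; rewrite Sx => {}Hg.
  have z0 : (fun k => 2 * s x * 2^-1 ^+ k) @ \oo --> (0 : R).
    by apply: (@cvg_geometric _ (2 * s x) (2^-1)); rewrite ger0_norm; lra.
  apply/cvgrPdist_le => e e0; near=> k.
  apply: (le_trans (Hg k)).
  rewrite -[leLHS]ger0_norm; last first.
    by rewrite !mulr_ge0 ?exprn_ge0// powR_ge0.
  near: k; move/cvgrPdist_le : z0 => /(_ e e0); apply: filterS => k.
  by rewrite sub0r normrN.
pose A := [set x | (S x < +oo)%E].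
have mA : measurable A by rewrite -[A]setTI; exact: emeasurable_fun_infty_o.
have mg : measurable_fun setT g.
  apply: (@measurable_fun_cvg _ _ _ _ (fun k x => u k x * \1_A x)).
    by move=> k; apply: measurable_funM => //; exact: measurable_indic.
  move=> x _; rewrite indicE; case: (boolP (S x < +oo)%E) => Sx.
    rewrite mem_set//; under eq_fun do rewrite mulr1.
    exact: cvg_g.
  rewrite memNset/=; last exact/negP.
  under eq_fun do rewrite mulr0.
  have := Hg x; rewrite (negbTE Sx) => ->; exact: cvg_cst.
have aeS : {ae mu, forall x, (S x < +oo)%E}.
  have : mu.-integrable setT S.
    apply/integrableP; split => //.
    under eq_integral do rewrite gee0_abs//.
    exact: (le_lt_trans iS (ltry _)).
  move/(integrable_ae measurableT); apply: filterS => x /(_ I).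
  by rewrite ge0_fin_numE.
exists g; split => //; first exact: filterS aeS.
exists (2 `^ p * 2); first by rewrite mulr_ge0 ?powR_ge0.
move=> k; apply: (@le_trans _ _ (((2 * 2^-1 ^+ k) `^ p)%:E * \int[mu]_x S x)%E).
  rewrite -ge0_integralZl_EFin ?powR_ge0//.
  apply: ae_ge0_le_integral => //.
  - apply/measurable_EFinP/measurable_norm_powR; exact: measurable_funB.
  - by move=> x _; rewrite mule_ge0// lee_fin powR_ge0.
  - exact: measurable_funeM.
  apply: filterS aeS => x Sx _; have := Hg x; rewrite Sx => /(_ k) h.
  rewrite -[S x]fineK ?ge0_fin_numE// -EFinM lee_fin.
  apply: (@le_trans _ _ ((2 * s x * 2^-1 ^+ k) `^ p)).
    rewrite ge0_ler_powR ?nnegrE ?(ltW p0)// !mulr_ge0 ?exprn_ge0//.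
    exact: powR_ge0.
  rewrite mulrAC powRM ?powR_ge0 ?mulr_ge0 ?exprn_ge0//.
  by rewrite /s -powRrM mulVf ?gt_eqF// powRr1 ?fine_ge0.
apply: (@le_trans _ _ (((2 * 2^-1 ^+ k) `^ p)%:E * 2%:E)%E).
  by rewrite lee_wpmul2l// lee_fin powR_ge0.
by rewrite -EFinM lee_fin powRM ?exprn_ge0// mulrAC.
Unshelve. all: by end_near. Qed.

(** The pointwise inequality integrated; the midpoint term stands on the left so that nothing is
    subtracted in [\bar R]. *)
Lemma pow_integral_midpoint d (T : measurableType d) (R : realType)
    (mu : {measure set T -> \bar R}) (p e C : R) (a b : T -> R) :
  0 < e -> 0 <= C ->
  (forall a b : R, `|a - b| `^ p <= e * (`|a| `^ p + `|b| `^ p) +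
      C * ((`|a| `^ p + `|b| `^ p) / 2 - `|(a + b) / 2| `^ p)) ->
  measurable_fun setT a -> measurable_fun setT b ->
  (pow_integral mu p (fun x => a x - b x)%R +
   C%:E * pow_integral mu p (fun x => (a x + b x) / 2)%R <=
   (e + C / 2)%:E * (pow_integral mu p a + pow_integral mu p b))%E.
Proof.
move=> e0 C0 H ma mb.
have mab : measurable_fun setT (fun x => a x - b x) by exact: measurable_funB.
have mmid : measurable_fun setT (fun x => (a x + b x) / 2).
  by apply: measurable_funM => //; exact: measurable_funD.
have m1 (h : T -> R) : measurable_fun setT h ->
    measurable_fun setT (fun x => (`|h x| `^ p)%:E).
  by move=> mh; apply/measurable_EFinP/measurable_norm_powR.
have eC : 0 <= e + C / 2 by rewrite addr_ge0 ?divr_ge0// ltW.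
rewrite /pow_integral -ge0_integralZl_EFin//; last exact: m1.
rewrite -ge0_integralD//; last 3 first.
- exact: m1.
- by move=> x _; rewrite mule_ge0// lee_fin powR_ge0.
- by apply: measurable_funeM; exact: m1.
rewrite -ge0_integralD//; [|exact: m1|exact: m1].
rewrite -ge0_integralZl_EFin//; last first.
  by apply: emeasurable_funD; exact: m1.
  by move=> x _; rewrite adde_ge0// lee_fin powR_ge0.
apply: ge0_le_integral => //.
- by move=> x _; rewrite adde_ge0// mule_ge0.
- by apply: emeasurable_funD; [exact: m1|apply: measurable_funeM; exact: m1].
- by apply: measurable_funeM; apply: emeasurable_funD; exact: m1.
move=> x _; rewrite -EFinM -!EFinD -EFinM lee_fin.
have := H (a x) (b x); lra.
Qed.

Lemma pow_integral_fatou d (T : measurableType d) (R : realType)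
    (mu : {measure set T -> \bar R}) (p M : R) (u : nat -> T -> R) (g : T -> R) :
  0 < p -> (forall k, measurable_fun setT (u k)) -> measurable_fun setT g ->
  {ae mu, forall x, u ^~ x @ \oo --> g x} ->
  (forall k, (pow_integral mu p (u k) <= (M + k.+1%:R^-1)%:E)%E) ->
  (pow_integral mu p g <= M%:E)%E.
Proof.
move=> p0 mu_ mg ug Hu.
have m1 (h : T -> R) : measurable_fun setT h ->
    measurable_fun setT (fun x => (`|h x| `^ p)%:E).
  by move=> mh; apply/measurable_EFinP/measurable_norm_powR.
pose f n x := (`|u n x| `^ p)%:E.
have f0 n x : (0 <= f n x)%E by rewrite lee_fin powR_ge0.
have fg x : u ^~ x @ \oo --> g x -> f ^~ x @ \oo --> (`|g x| `^ p)%:E.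
  move=> ux; apply: cvg_EFin; first exact: nearW.
  exact: (cvg_comp _ _ ux (@norm_powR_continuous R p p0 (g x))).
apply: (@le_trans _ _ (limn_einf (fun n => pow_integral mu p (u n)))).
  apply: le_trans (fatou mu measurableT (fun n => m1 _ (mu_ n)) _) => //.
  apply: ae_ge0_le_integral => //.
  - exact: m1.
  - move=> x _; rewrite limn_einf_lim; apply: lime_ge; first exact: is_cvg_einfs.
    by apply: nearW => n; apply: le_ereal_inf_tmp => _ [k _ <-]; exact: f0.
  (* Measurability of the lower limit is read off from that of the upper limit of the opposites. *)
  - rewrite [X in measurable_fun _ X](_ : _ =
        -%E \o (fun x => limn_esup (fun n => - f n x)%E)).
      apply: measurableT_comp => //; apply: measurable_fun_limn_esup => n.
      by apply: measurableT_comp => //; exact: m1.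
    apply/funext => x; rewrite /= -limn_einfN; congr limn_einf.
    by apply/funext => n; rewrite /= opprK.
  apply: filterS ug => x /fg ux _.
  rewrite is_cvg_limn_einfE; last by apply/cvg_ex; eexists; exact: ux.
  by rewrite (cvg_lim _ ux).
rewrite limn_einf_lim; apply: lime_le; first exact: is_cvg_einfs.
apply: nearW => n; apply/lee_addgt0Pr => e e0.
apply: (@le_trans _ _ (pow_integral mu p (u (maxn n (Num.truncn e^-1))))).
  by apply: ereal_inf_lbound; exists (maxn n (Num.truncn e^-1)) => //=; exact: leq_maxl.
apply: (le_trans (Hu _)); rewrite -EFinD lee_fin lerD2l.
rewrite -[leRHS]invrK lef_pV2 ?posrE ?invr_gt0 ?ltr0n//.
apply: (le_trans (ltW (truncnS_gt _))).
by rewrite ler_nat ltnS leq_maxr.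
Qed.

(** The infimum D m of [pow_integral] over C m increases with m and stays below M, hence converges.
    Choose h m almost minimal in C m. For l >= m the midpoint of h l and h m is in C m, so its
    integral is at least D m, while both endpoints have integral close to D m; uniform convexity
    then forces h l and h m together. The limit of a fast subsequence is approximated from within
    every C m. *)
Lemma Lp_minimizing_limit d (T : measurableType d) (R : realType)
    (mu : {measure set T -> \bar R}) (p M : R) (C : nat -> set (T -> R)) :
  1 < p ->
  (forall m h, C m h -> measurable_fun setT h) ->
  (forall m, C m.+1 `<=` C m) ->
  (forall m a b, C m a -> C m b -> C m (fun x => (a x + b x) / 2)) ->
  (forall m, exists2 h, C m h & (pow_integral mu p h <= (M + m.+1%:R^-1)%:E)%E) ->
  exists g, [/\ measurable_fun setT g, (pow_integral mu p g <= M%:E)%E &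
    forall m e, 0 < e ->
      exists2 h, C m h & (pow_integral mu p (fun x => g x - h x)%R <= e%:E)%E].
Proof.
move=> p1 Cm Cd Cmid Cne; have p0 : 0 < p by lra.
have Csub m l : (m <= l)%N -> C l `<=` C m.
  elim: l => [|l ih]; first by rewrite leqn0 => /eqP ->.
  rewrite leq_eqVlt => /predU1P[->//|]; rewrite ltnS => /ih.
  exact: subset_trans (Cd l).
pose D m := ereal_inf (pow_integral mu p @` C m).
have D0 m : (0 <= D m)%E.
  by apply: le_ereal_inf_tmp => _ [h _ <-]; exact: pow_integral_ge0.
have Dh m h : C m h -> (D m <= pow_integral mu p h)%E.
  by move=> Ch; apply: ereal_inf_lbound; exists h.
have Dml m l : (m <= l)%N -> (D m <= D l)%E.
  by move=> ml; apply: le_ereal_inf; exact/image_subset/Csub.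
have DM m : (D m <= M%:E)%E.
  apply/lee_addgt0Pr => e e0.
  apply: (le_trans (Dml m _ (leq_maxl m (Num.truncn e^-1)))).
  have [h Ch hM] := Cne (maxn m (Num.truncn e^-1)).
  apply: (le_trans (Dh _ _ Ch)); apply: (le_trans hM).
  rewrite -EFinD lee_fin lerD2l.
  rewrite -[leRHS]invrK lef_pV2 ?posrE ?invr_gt0 ?ltr0n//.
  apply: (le_trans (ltW (truncnS_gt _))).
  by rewrite ler_nat ltnS leq_maxr.
have Dfin m : D m \is a fin_num.
  by rewrite ge0_fin_numE// (le_lt_trans (DM m))// ltry.
pose r m := fine (D m).
have Dr m : D m = (r m)%:E by rewrite fineK.
have r0 m : 0 <= r m by rewrite -lee_fin -Dr.
have rM m : r m <= M by rewrite -lee_fin -Dr.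
have M0 : 0 <= M by exact: le_trans (rM 0%N).
have rml m l : (m <= l)%N -> r m <= r l.
  by move=> ml; rewrite -lee_fin -!Dr Dml.
have /choice[h Hh] : forall m, exists h, C m h /\
    (pow_integral mu p h <= (r m + m.+1%:R^-1)%:E)%E.
  move=> m; have e0 : 0 < m.+1%:R^-1 :> R by rewrite invr_gt0 ltr0n.
  have [_ [h Ch <-] hl] := lb_ereal_inf_adherent e0 (Dfin m).
  by exists h; split => //; rewrite EFinD -Dr ltW.
have hC m : C m (h m) by have [] := Hh m.
have hr m : (pow_integral mu p (h m) <= (r m + m.+1%:R^-1)%:E)%E by have [] := Hh m.
have rS : has_sup [set r m | m in [set: nat]].
  by split; [exists (r 0%N); exists 0%N|exists M => _ [m _ <-]].
have cauchy (eta : R) : 0 < eta -> exists N, forall m l, (N <= m)%N -> (m <= l)%N ->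
    (pow_integral mu p (fun x => h l x - h m x)%R <= eta%:E)%E.
  move=> eta0.
  (* Two almost minimal integrals sum to at most 2M + 2, so the e-term costs eta/2. The constant z
     below keeps the K-term, at most (K/2) 3z, under eta/2 as well. *)
  pose e : R := eta / (2 * (2 * M + 2)).
  have e0 : 0 < e by rewrite divr_gt0//; lra.
  have [K K0 HK] := uniform_convexity_powR p1 e0.
  pose z : R := eta / (2 * (K + 1)) / 2.
  have z0 : 0 < z by rewrite !divr_gt0//; lra.
  have [_ [N _ <-] rN] := sup_adherent z0 rS.
  set S := sup _ in rN.
  exists (maxn N (Num.truncn z^-1)) => m l; rewrite geq_max => /andP[Nm zm] ml.
  have rmS i : r i <= S by apply: ub_le_sup; [case: rS|exists i].
  have mz : m.+1%:R^-1 <= z.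
    rewrite -[leRHS]invrK lef_pV2 ?posrE ?invr_gt0 ?ltr0n//.
    by apply: (le_trans (ltW (truncnS_gt _))); rewrite ler_nat.
  have lm : l.+1%:R^-1 <= m.+1%:R^-1 :> R.
    by rewrite lef_pV2 ?posrE ?ltr0n// ler_nat.
  have m1 : m.+1%:R^-1 <= 1 :> R by rewrite invf_le1 ?ltr0n// ler1n.
  have := pow_integral_midpoint mu e0 K0 HK (Cm _ _ (hC l)) (Cm _ _ (hC m)).
  set I1 := pow_integral _ _ _; set I2 := pow_integral _ _ (fun x => _ / _).
  have I2r : ((r m)%:E <= I2)%E.
    rewrite -Dr; apply: Dh; apply: Cmid => //.
    exact: Csub ml _ (hC l).
  move=> hI; have {hI} : (I1 + (K * r m)%:E <=
      ((e + K / 2) * ((r l + l.+1%:R^-1) + (r m + m.+1%:R^-1)))%:E)%E.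
    apply: (@le_trans _ _ (I1 + K%:E * I2)%E).
      by rewrite leeD2l// EFinM lee_wpmul2l// lee_fin.
    apply: (le_trans hI); rewrite [leRHS]EFinM lee_wpmul2l ?lee_fin//.
      by move: e0 K0; lra.
    by rewrite EFinD leeD.
  rewrite -leeBrDr// => /le_trans; apply.
  rewrite -EFinB lee_fin.
  have h1 : r l <= r m + z by have := rml _ _ Nm; have := rmS l; lra.
  move: (l.+1%:R^-1) (m.+1%:R^-1) lm m1 mz => vl vm lm m1 mz.
  have h2 : (e + K / 2) * (r l + vl + (r m + vm)) - K * r m <=
      e * (2 * M + 2) + K / 2 * (3 * z).
    rewrite mulrDl -addrA lerD//.
      by rewrite ler_pM2l//; have := rM l; have := rM m; lra.
    have -> : K * r m = K / 2 * (2 * r m) by field.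
    rewrite -mulrBr ler_wpM2l ?divr_ge0//; lra.
  apply: (le_trans h2).
  have -> : e * (2 * M + 2) = eta / 2 by rewrite /e; field; rewrite lt0r_neq0//; lra.
  have zK : z * (4 * (K + 1)) = eta.
    by rewrite /z; field; rewrite lt0r_neq0//; lra.
  nra.
have /choice[N0 HN] : forall k, exists N, forall m l, (N <= m)%N -> (m <= l)%N ->
    (pow_integral mu p (fun x => h l x - h m x)%R <= ((4^-1 ^+ k) `^ p)%:E)%E.
  by move=> k; apply: cauchy; rewrite powR_gt0// exprn_gt0.
(* Summing makes the indices nondecreasing while dominating both N0 k and k. *)
pose phi k := (\sum_(i < k.+1) N0 i + k)%N.
have phiN k : (N0 k <= phi k)%N.
  by rewrite /phi big_ord_recr/= -addnA addnCA leq_addr.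
have phik k : (k <= phi k)%N by exact: leq_addl.
have phiS k : (phi k <= phi k.+1)%N.
  by rewrite /phi [X in (_ <= X + _)%N]big_ord_recr/= leq_add// leq_addr.
have [g [mg ug [K K0 HK]]] : exists g : T -> R, [/\ measurable_fun setT g,
    {ae mu, forall x, (fun k => h (phi k) x) @ \oo --> g x} &
    exists2 K : R, 0 <= K & forall k,
      (pow_integral mu p (fun x => g x - h (phi k) x)%R
        <= (K * (2^-1 ^+ k) `^ p)%:E)%E].
  apply: (@Lp_fast_cauchy_limit _ _ _ mu p (fun k => h (phi k))) => // k.
    exact: Cm (hC _).
  exact: HN.
exists g; split => //.
  apply: (pow_integral_fatou p0 _ mg ug) => k; first exact: Cm (hC _).
  apply: (le_trans (hr _)); rewrite lee_fin lerD//.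
  by rewrite lef_pV2 ?posrE ?ltr0n// ler_nat ltnS.
move=> m e e0.
have z0 : (fun k => K * (2^-1 ^+ k) `^ p) @ \oo --> (0 : R).
  rewrite -[X in _ --> X](mulr0 K); apply: cvgMr.
  have := @norm_powR_continuous R p p0 0.
  rewrite /continuous_at normr0 powR0 ?gt_eqF// => c0.
  have := @cvg_geometric R 1 (2^-1); rewrite ger0_norm// => /(_ ltac:(lra)) g0.
  have := cvg_comp _ _ g0 c0; apply: cvg_trans; apply: near_eq_cvg.
  by apply: nearW => k /=; rewrite mul1r ger0_norm// exprn_ge0.
move/cvgrPdist_le : z0 => /(_ e e0)[k0 _ Hk].
pose k := maxn k0 m.
exists (h (phi k)).
  apply: Csub (hC _); apply: leq_trans (phik _); exact: leq_maxr.
apply: (le_trans (HK _)); rewrite lee_fin.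
have := Hk k (leq_maxl _ _); rewrite sub0r normrN ger0_norm//.
by rewrite mulr_ge0// powR_ge0.
Qed.

(** * Lebesgue measure on R^n and the heat kernel *)

Lemma ge0_integral_lebesgue_rVS (R : realType) (n : nat)
    (f : 'rV[R]_n.+1 -> \bar R) :
  measurable_fun setT f -> (forall x, (0 <= f x)%E) ->
  (\int[@lebesgue_rV R n.+1]_x f x =
   \int[@lebesgue_measure R]_a \int[@lebesgue_rV R n]_v f (cons_rV (a, v)))%E.
Proof.
move=> mf f0.
transitivity (\int[pushforward (@lebesgue_measure R \x @lebesgue_rV R n)%E
    (@cons_rV R n)]_x f x)%E; first exact: eq_measure_integral.
rewrite ge0_integral_pushforward//; last exact: measurable_cons_rV.
rewrite preimage_setT fubini_tonelli1//; last by move=> x; exact: f0.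
apply: measurableT_comp => //; exact: measurable_cons_rV.
Qed.

Lemma integral_lebesgue_rV0 (R : realType) (f : 'rV[R]_0 -> \bar R) :
  measurable_fun setT f -> (\int[@lebesgue_rV R 0]_x f x = f 0%R)%E.
Proof.
move=> mf; pose z : 'rV[R]_0 := 0%R.
transitivity (\int[\d_z]_x f x)%E; first exact: eq_measure_integral.
by rewrite integral_dirac// diracT mul1e.
Qed.

Lemma integral_lebesgue_rV_prod (R : realType) (n : nat)
    (h : 'I_n -> measurableTypeR R -> R) (c : 'I_n -> R) :
  (forall i, measurable_fun setT (h i)) -> (forall i a, 0 <= h i a) ->
  (forall i, (\int[@lebesgue_measure R]_a (h i a)%:E = (c i)%:E)%E) ->
  (\int[@lebesgue_rV R n]_x (\prod_(i < n) h i (x ord0 i))%:E =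
   (\prod_(i < n) c i)%:E)%E.
Proof.
elim: n h c => [|n IH] h c mh h0 hc.
  rewrite integral_lebesgue_rV0 ?big_ord0//.
  apply/measurable_EFinP; rewrite [X in measurable_fun _ X](_ : _ = cst 1)//.
  by apply/funext => x; rewrite big_ord0.
have mprod m (k : 'I_m -> measurableTypeR R -> R) :
    (forall i, measurable_fun setT (k i)) ->
    measurable_fun setT (fun x : 'rV[R]_m => \prod_(i < m) k i (x ord0 i)).
  move=> mk; apply: measurable_prod => i _.
  exact: (measurableT_comp (mk i) (measurable_coord i)).
rewrite ge0_integral_lebesgue_rVS; last 2 first.
- by apply/measurable_EFinP; apply: mprod => i; exact: mh.
- by move=> x; rewrite lee_fin prodr_ge0.
rewrite big_ord_recl EFinM -(hc ord0) -ge0_integralZr//; last 3 first.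
- exact/measurable_EFinP.
- by move=> a _; rewrite lee_fin.
- rewrite lee_fin prodr_ge0// => i _; rewrite -lee_fin -hc integral_ge0//.
  by move=> a _; rewrite lee_fin.
apply: eq_integral => a _.
rewrite -(IH (fun i => h (lift ord0 i)) (fun i => c (lift ord0 i)))//.
rewrite -ge0_integralZl_EFin//.
- by apply: eq_integral => v _; rewrite big_ord_recl cons_rV0 EFinM;
    under eq_bigr do rewrite cons_rVS.
- by move=> v _; rewrite lee_fin prodr_ge0.
- by apply/measurable_EFinP; apply: (mprod _ (fun i => h (lift ord0 i))) => i; exact: mh.
Qed.

(** * Invariance of Lebesgue measure under reflections *)

Lemma lebesgue_measure_reflect (R : realType) (y : R) (A : set (measurableTypeR R)) :
  measurable A -> pushforward (@lebesgue_measure R)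
    ((fun x => y - x) : measurableTypeR R -> measurableTypeR R) A =
    lebesgue_measure A.
Proof.
have mr : measurable_fun setT
    ((fun x => y - x) : measurableTypeR R -> measurableTypeR R).
  exact: measurable_funB.
move=> mA; apply/esym.
apply: (@lebesgue_measure_unique R
  (measure_function_pushforward__canonical__measure_function_Measure
    (@lebesgue_measure R) mr)) => // _ [[a b]] _ <-.
(* Reflection exchanges the open and the closed end, which leaves the length unchanged; half-open
   intervals determine the measure. *)
have e : (fun x : R => y - x) @^-1` `]a, b]%classic = `[y - b, y - a[%classic.
  apply/seteqP; split => x /=; rewrite !in_itv/= => /andP[? ?]; apply/andP; lra.
rewrite /pushforward [X in _ = lebesgue_measure X]e.
rewrite !lebesgue_measure_itv/= !lte_fin ltrD2l ltrN2 -!EFinD.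
by have -> : y - a - (y - b) = b - a by ring.
Qed.

Lemma ge0_integral_reflect (R : realType) (y : R)
    (f : measurableTypeR R -> \bar R) :
  measurable_fun setT f -> (forall x, (0 <= f x)%E) ->
  (\int[@lebesgue_measure R]_x f (y - x)%R = \int[@lebesgue_measure R]_x f x)%E.
Proof.
have mr : measurable_fun setT
    ((fun x => y - x) : measurableTypeR R -> measurableTypeR R).
  exact: measurable_funB.
pose nu := measure_function_pushforward__canonical__measure_function_Measure
  (@lebesgue_measure R) mr.
move=> mf f0; transitivity (\int[nu]_x f x)%E.
  by rewrite (ge0_integral_pushforward mr)//= preimage_setT.
apply: eq_measure_integral => A mA _; move: A mA.
exact: (@lebesgue_measure_reflect R y).
Qed.

(** Induction on the dimension: Tonelli splits off the first coordinate, which is reflected by the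
    one-dimensional case. *)
Lemma ge0_integral_rV_reflect (R : realType) (n : nat) (y : 'rV[R]_n)
    (f : 'rV[R]_n -> \bar R) :
  measurable_fun setT f -> (forall x, (0 <= f x)%E) ->
  (\int[@lebesgue_rV R n]_x f (y - x)%R = \int[@lebesgue_rV R n]_x f x)%E.
Proof.
have msub m (z : 'rV[R]_m) : measurable_fun setT (fun x : 'rV[R]_m => z - x).
  apply: measurable_fun_coordP => i; under eq_fun do rewrite !mxE.
  by apply: measurable_funB => //; exact: measurable_coord.
elim: n y f => [|n IH] y f mf f0.
  rewrite (integral_lebesgue_rV0 (f := fun x => f (y - x)%R)); last first.
    by apply: measurableT_comp => //; exact: msub.
  by rewrite integral_lebesgue_rV0// (thinmx0 y) subr0.
have mfc : measurable_fun setT (fun z : measurableTypeR R * 'rV[R]_n => f (cons_rV z)).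
  by apply: measurableT_comp => //; exact: measurable_cons_rV.
rewrite !ge0_integral_lebesgue_rVS//; last first.
  by apply: measurableT_comp => //; exact: msub.
pose y' : 'rV[R]_n := \row_i y ord0 (lift ord0 i).
transitivity (\int[@lebesgue_measure R]_a
    \int[@lebesgue_rV R n]_v f (cons_rV ((y ord0 ord0 - a)%R, v)))%E; last first.
  apply: (@ge0_integral_reflect R (y ord0 ord0)
    (fun a => \int[@lebesgue_rV R n]_v f (cons_rV (a, v)))%E).
    by apply: (@measurable_fun_fubini_tonelli_F _ _ _ _ R (@lebesgue_rV R n) _ mfc).
  by move=> a; exact: integral_ge0.
apply: eq_integral => a _.
rewrite -[RHS](IH y' (fun v => f (cons_rV ((y ord0 ord0 - a)%R, v))))//.
  apply: eq_integral => v _; congr f.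
  apply/rowP => i; rewrite mxE [X in _ + X]mxE.
  case: (unliftP ord0 i) => [j|] ->; last by rewrite !cons_rV0.
  by rewrite !cons_rVS !mxE.
exact: (measurableT_comp mfc (measurable_pair1 _)).
Qed.

Lemma integral_rV_reflect (R : realType) (n : nat) (y : 'rV[R]_n)
    (f : 'rV[R]_n -> R) : measurable_fun setT f ->
  (\int[@lebesgue_rV R n]_x (f (y - x)%R)%:E =
   \int[@lebesgue_rV R n]_x (f x)%:E)%E.
Proof.
move=> mf; rewrite [LHS]integralE [RHS]integralE; congr (_ - _)%E.
  have mp : measurable_fun setT ((fun x => (f x)%:E)^\+)%E.
    exact/measurable_funepos/measurable_EFinP.
  rewrite -[RHS](ge0_integral_rV_reflect y mp)//.
  by apply: eq_integral => x _; rewrite unlock.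
have mp : measurable_fun setT ((fun x => (f x)%:E)^\-)%E.
  exact/measurable_funeneg/measurable_EFinP.
rewrite -[RHS](ge0_integral_rV_reflect y mp)//.
by apply: eq_integral => x _; rewrite unlock.
Qed.

(** * An integrable majorant and the mass of the heat kernel *)

Lemma integral_oneDsqrV (R : realType) :
  (\int[@lebesgue_measure R]_x ((1 + x ^+ 2)^-1)%:E = pi%:E)%E.
Proof.
rewrite ge0_symfun_integralT//; last 3 first.
- by move=> x; rewrite invr_ge0 addr_ge0// sqr_ge0.
- exact: continuous_oneDsqrV.
- by move=> x /=; rewrite sqrrN.
rewrite -set_itvcy integral0y_oneDsqr -EFinM; congr EFin; by field.
Qed.

(** This product is the common majorant for Schwartz functions; being a product of one-variable
    functions, it is integrated coordinate by coordinate. *)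
Lemma integrable_prod_oneDsqrV (R : realType) (n : nat) :
  (@lebesgue_rV R n).-integrable setT
    (fun x => (\prod_(i < n) (1 + x ord0 i ^+ 2)^-1)%:E).
Proof.
have m1 : measurable_fun setT
    ((fun x : R => (1 + x ^+ 2)^-1) : measurableTypeR R -> R).
  by apply: continuous_measurable_fun; exact: continuous_oneDsqrV.
apply/integrableP; split.
  apply/measurable_EFinP; apply: measurable_prod => i _.
  exact: (measurableT_comp m1 (measurable_coord i)).
have p0 (a : R) : 0 <= (1 + a ^+ 2)^-1 by rewrite invr_ge0 addr_ge0// sqr_ge0.
under eq_integral do rewrite gee0_abs ?lee_fin ?prodr_ge0//.
rewrite (@integral_lebesgue_rV_prod _ _ (fun _ a => (1 + a ^+ 2)^-1) (fun=> pi))//.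
  exact: ltry.
by move=> _; exact: integral_oneDsqrV.
Qed.

(** The heat kernel is a product of normal densities of variance 2t, so its total mass 1 is
    inherited from them. *)
Lemma heat_kernelE (R : realType) (n : nat) (t : R) (x y : 'rV[R]_n) : 0 < t ->
  heat_kernel t (x - y) =
    \prod_(i < n) normal_pdf (y ord0 i) (Num.sqrt (2 * t)) (x ord0 i).
Proof.
move=> t0; have s0 : Num.sqrt (2 * t) != 0 by rewrite gt_eqF// sqrtr_gt0 mulr_gt0.
under eq_bigr do rewrite normal_pdfE//.
rewrite big_split/= prodr_const card_ord /normal_peak /normal_fun.
rewrite sqr_sqrtr ?mulr_ge0 ?(ltW t0)//; congr (_ * _).
  have -> : 2 * t * pi *+ 2 = 4 * pi * t by rewrite mulr2n; ring.
  have p0 : 0 <= 4 * pi * t by rewrite !mulr_ge0 ?pi_ge0// ltW.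
  have -> : - (n%:R / 2) = - 2^-1 * n%:R :> R by field.
  by rewrite powRrM powRN powR12_sqrt// powR_mulrn ?invr_ge0 ?sqrtr_ge0.
rewrite -expR_sum; congr expR.
rewrite /enorm sqr_sqrtr ?sumr_ge0// => [|i _]; last exact: sqr_ge0.
rewrite mulr_suml -sumrN; apply: eq_bigr => i _; rewrite !mxE.
by rewrite mulNr; congr (- (_ * _^-1)); rewrite mulr2n; ring.
Qed.

Lemma integral_heat_kernel (R : realType) (n : nat) (t : R) (y : 'rV[R]_n) :
  0 < t -> (\int[@lebesgue_rV R n]_x (heat_kernel t (x - y)%R)%:E = 1)%E.
Proof.
move=> t0; under eq_integral do rewrite heat_kernelE//.
rewrite (@integral_lebesgue_rV_prod _ _
  (fun i => normal_pdf (y ord0 i) (Num.sqrt (2 * t))) (fun=> 1)).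
- by rewrite big1.
- by move=> i; exact: measurable_normal_pdf.
- by move=> i a; exact: normal_pdf_ge0.
- by move=> i; rewrite integral_normal_pdf.
Qed.

Lemma heat_kernel_ge0 (R : realType) (n : nat) (t : R) (x : 'rV[R]_n) :
  0 <= heat_kernel t x.
Proof. by rewrite mulr_ge0 ?powR_ge0 ?expR_ge0. Qed.

Lemma heat_kernel_sym (R : realType) (n : nat) (t : R) (x y : 'rV[R]_n) :
  heat_kernel t (x - y) = heat_kernel t (y - x).
Proof.
rewrite /heat_kernel (_ : enorm (x - y) = enorm (y - x))//.
rewrite /enorm; congr Num.sqrt; apply: eq_bigr => i _.
by rewrite !mxE -sqrrN opprB.
Qed.

Lemma measurable_enorm (R : realType) (n : nat) :
  measurable_fun setT (@enorm R n).
Proof.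
have ms : measurable_fun setT (Num.sqrt : measurableTypeR R -> measurableTypeR R).
  by apply: continuous_measurable_fun; exact: sqrt_continuous.
apply: (measurableT_comp ms).
by apply: measurable_sum => i; apply: measurable_funX; exact: measurable_coord.
Qed.

Lemma measurable_heat_kernel (R : realType) (n : nat) (t : R) :
  measurable_fun setT (@heat_kernel R n t).
Proof.
apply: measurable_funM => //; apply: measurableT_comp => //.
apply: measurableT_comp => //; apply: measurable_funM => //.
by apply: measurable_funX; exact: measurable_enorm.
Qed.

(** * Schwartz functions and tempered distributions *)

Definition rV_basis (R : realType) (n : nat) (i : 'I_n) : 'rV[R]_n := delta_mx ord0 i.

Definition is_partial (R : realType) (n : nat) (i : 'I_n) (phi dphi : 'rV[R]_n -> R) :=
  forall x, is_derive x (rV_basis R i) phi (dphi x).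

(** The two difference quotients are the same function, so one-variable calculus applies along
    coordinate lines. *)
Lemma is_partial_line (R : realType) (n : nat) (i : 'I_n) (phi dphi : 'rV[R]_n -> R)
    (x : 'rV[R]_n) (h : R) : is_partial i phi dphi ->
  is_derive h 1 (fun a : R => phi (a *: rV_basis R i + x)) (dphi (h *: rV_basis R i + x)).
Proof.
move=> /(_ (h *: rV_basis R i + x))[dx <-].
have e : (fun k : R => k^-1 *: (((fun a : R => phi (a *: rV_basis R i + x)) \o shift h)
      (k *: (1 : R)) - phi (h *: rV_basis R i + x))) =
    (fun k : R => k^-1 *: ((phi \o shift (h *: rV_basis R i + x))
      (k *: rV_basis R i) - phi (h *: rV_basis R i + x))).
  apply/funext => k /=; congr (_ *: (phi _ - _)).
  by rewrite addrA -scalerDl; congr (_ *: _ + _); congr (_ + _); exact: mulr1.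
split; first by rewrite /derivable e.
by rewrite /derive e.
Qed.

Lemma is_partialP (R : realType) (n : nat) (i : 'I_n) (phi dphi : 'rV[R]_n -> R) :
  (forall x, is_derive (0 : R) 1 (fun a : R => phi (a *: rV_basis R i + x)) (dphi x)) ->
  is_partial i phi dphi.
Proof.
move=> H x; have [dx <-] := H x; have e : (fun k : R => k^-1 *:
      (((fun a : R => phi (a *: rV_basis R i + x)) \o shift 0)
      (k *: (1 : R)) - phi (0 *: rV_basis R i + x))) =
    (fun k : R => k^-1 *: ((phi \o shift x) (k *: rV_basis R i) - phi x)).
  apply/funext => k /=; rewrite scale0r add0r addr0; congr (_ *: (phi _ - _)).
  by congr (_ *: _ + _); exact: mulr1.
split; first by rewrite /derivable -e.
by rewrite /derive -e.
Qed.

Lemma partial_mvt (R : realType) (n : nat) (i : 'I_n) (phi dphi : 'rV[R]_n -> R)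
    (x : 'rV[R]_n) (h : R) : is_partial i phi dphi ->
  exists2 c : R, Num.min 0 h <= c <= Num.max 0 h &
    phi (h *: rV_basis R i + x) - phi x = dphi (c *: rV_basis R i + x) * h.
Proof.
move=> dp; pose g (a : R) := phi (a *: rV_basis R i + x).
have dg (a : R) : is_derive a 1 g (dphi (a *: rV_basis R i + x)) by exact: is_partial_line.
have cg : continuous g.
  move=> a; apply/differentiable_continuous/derivable1_diffP.
  by have [] := dg a.
have g0 : g 0 = phi x by rewrite /g scale0r add0r.
have [h0|h0] := leP 0 h.
  have [c cI gc] := @MVT_segment _ g _ 0 h h0 (fun a _ => dg a)
    (continuous_subspaceT cg).
  by exists c; [rewrite in_itv/= in cI|rewrite -g0 [LHS]gc subr0].
have [c cI gc] := @MVT_segment _ g _ h 0 (ltW h0) (fun a _ => dg a)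
    (continuous_subspaceT cg).
exists c; first by rewrite in_itv/= in cI.
by rewrite -g0 -opprB [X in - X]gc sub0r mulrN opprK.
Qed.

(** Change u into v one coordinate at a time and apply the mean value theorem to each move. All
    intermediate points remain in the box spanned by u and v, so a bound local to that box suffices;
    weighted estimates depend on this. *)
Lemma lipschitz_box (R : realType) (n : nat) (phi : 'rV[R]_n -> R)
    (dphi : 'I_n -> 'rV[R]_n -> R) (B : R) (u v : 'rV[R]_n) :
  (forall i, is_partial i phi (dphi i)) ->
  (forall i (w : 'rV[R]_n), (forall j, Num.min (u ord0 j) (v ord0 j) <= w ord0 j
      <= Num.max (u ord0 j) (v ord0 j)) -> `|dphi i w| <= B) ->
  `|phi u - phi v| <= B * \sum_(i < n) `|u ord0 i - v ord0 i|.
Proof.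
move=> dp.
(* Here m bounds the indices of the coordinates in which u and v may differ; the induction step
   repairs coordinate m. *)
suff H m : (m <= n)%N -> forall u v : 'rV[R]_n,
    (forall j : 'I_n, (m <= j)%N -> u ord0 j = v ord0 j) ->
    (forall i (w : 'rV[R]_n), (forall j, Num.min (u ord0 j) (v ord0 j) <= w ord0 j
      <= Num.max (u ord0 j) (v ord0 j)) -> `|dphi i w| <= B) ->
    `|phi u - phi v| <= B * \sum_(i < n) `|u ord0 i - v ord0 i|.
  by apply: (H n) => // j; rewrite leqNgt ltn_ord.
elim: m => [_|m IH mn] {}u {}v uv HB.
  have -> : u = v by apply/rowP => j; exact: uv.
  by rewrite subrr normr0 big1 ?mulr0// => i _; rewrite subrr normr0.
pose i0 : 'I_n := Ordinal mn.
pose h := v ord0 i0 - u ord0 i0.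
pose w := h *: rV_basis R i0 + u.
have wE j : w ord0 j = if j == i0 then v ord0 j else u ord0 j.
  rewrite !mxE eqxx/=; case: eqP => [->|_]; first by rewrite mulr1 /h subrK.
  by rewrite mulr0 add0r.
have hw : `|phi u - phi w| <= B * `|u ord0 i0 - v ord0 i0|.
  have [c cI] := partial_mvt u h (dp i0).
  rewrite distrC => ->; rewrite normrM distrC -/h ler_wpM2r//.
  apply: HB => j; rewrite !mxE eqxx/=; case: eqP => [->|_]; last first.
    by rewrite mulr0 add0r ge_min le_max lexx.
  rewrite mulr1; move: cI; rewrite /h minEle maxEle [in X in _ -> X]minEle [in X in _ -> X]maxEle.
  by rewrite subr_ge0; case: (u ord0 i0 <= v ord0 i0); lra.
have hv : `|phi w - phi v| <= B * \sum_(i < n) `|w ord0 i - v ord0 i|.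
  apply: IH => [|j|i z Hz]; first exact: ltnW.
    rewrite wE; case: eqP => // ji; rewrite leq_eqVlt => /predU1P[mj|/uv//].
    by case: ji; apply: val_inj.
  apply: HB => j; have := Hz j; rewrite wE; case: ifPn => // _.
  by rewrite minxx maxxx => /le_anti <-; rewrite ge_min le_max !lexx !orbT.
rewrite -(subrK (phi w) (phi u)) -addrA (le_trans (ler_normD _ _))//.
apply: (le_trans (lerD hw hv)).
rewrite -mulrDr le_eqVlt; apply/orP; left; apply/eqP; congr (_ * _).
rewrite (bigD1 i0)//= [RHS](bigD1 i0)//= wE eqxx subrr normr0 add0r; congr (_ + _).
by apply: eq_bigr => i /negbTE ii0; rewrite wE ii0.
Qed.

(** * The Euclidean norm, Schwartz seminorms and translations *)

Section enorm_theory.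
Context {R : realType} {n : nat}.
Implicit Types (x y : 'rV[R]_n) (phi g h : 'rV[R]_n -> R) (s : seq 'I_n).

Lemma enorm_ge0 x : 0 <= enorm x.
Proof. exact: sqrtr_ge0. Qed.

Lemma sqr_enorm x : enorm x ^+ 2 = \sum_(i < n) x ord0 i ^+ 2.
Proof. by rewrite sqr_sqrtr// sumr_ge0// => i _; exact: sqr_ge0. Qed.

Lemma le_enorm x y : (forall i, `|x ord0 i| <= `|y ord0 i|) -> enorm x <= enorm y.
Proof.
move=> xy; rewrite ler_sqrt ?sumr_ge0// => [|i _]; last exact: sqr_ge0.
apply: ler_sum => i _; rewrite -(ger0_norm (sqr_ge0 (x _ _))) -(ger0_norm (sqr_ge0 (y _ _))).
by rewrite !normrX ler_pXn2r ?nnegrE.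
Qed.

Lemma coord_le_enorm x i : `|x ord0 i| <= enorm x.
Proof.
rewrite -sqrtr_sqr ler_sqrt ?sumr_ge0// => [|j _]; last exact: sqr_ge0.
by rewrite (bigD1 i)//= lerDl sumr_ge0// => j _; exact: sqr_ge0.
Qed.

Lemma enorm0_eq0 x : enorm x = 0 -> x = 0.
Proof.
move=> x0; apply/rowP => i; rewrite mxE; apply/eqP.
by rewrite -normr_le0 -x0 coord_le_enorm.
Qed.

Lemma cauchy_schwarz_rV x y :
  \sum_(i < n) x ord0 i * y ord0 i <= enorm x * enorm y.
Proof.
have [x0|x0] := eqVneq (enorm x) 0.
  rewrite x0 mul0r big1// => i _; by rewrite (enorm0_eq0 x0) mxE mul0r.
have [y0|y0] := eqVneq (enorm y) 0.
  rewrite y0 mulr0 big1// => i _; by rewrite (enorm0_eq0 y0) mxE mulr0.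
have xp : 0 < enorm x by rewrite lt_def x0 enorm_ge0.
have yp : 0 < enorm y by rewrite lt_def y0 enorm_ge0.
have : 0 <= \sum_(i < n) (x ord0 i * enorm y - y ord0 i * enorm x) ^+ 2.
  by apply: sumr_ge0 => i _; exact: sqr_ge0.
have -> : \sum_(i < n) (x ord0 i * enorm y - y ord0 i * enorm x) ^+ 2 =
    2 * (enorm x * enorm y) *
      (enorm x * enorm y - \sum_(i < n) x ord0 i * y ord0 i).
  transitivity (\sum_(i < n) (x ord0 i ^+ 2 * enorm y ^+ 2 +
    y ord0 i ^+ 2 * enorm x ^+ 2 -
    x ord0 i * y ord0 i * (2 * (enorm x * enorm y)))).
    by apply: eq_bigr => i _; ring.
  rewrite sumrB big_split/= -!mulr_suml -!sqr_enorm; ring.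
by rewrite pmulr_rge0 ?mulr_gt0// subr_ge0.
Qed.

Lemma enormD x y : enorm (x + y) <= enorm x + enorm y.
Proof.
rewrite -(@ler_pXn2r _ 2)// ?nnegrE ?addr_ge0 ?enorm_ge0// sqrrD !sqr_enorm.
have -> : \sum_(i < n) (x + y) ord0 i ^+ 2 = \sum_(i < n) x ord0 i ^+ 2 +
    (\sum_(i < n) x ord0 i * y ord0 i) *+ 2 + \sum_(i < n) y ord0 i ^+ 2.
  rewrite -sumrMnl -!big_split/=; apply: eq_bigr => i _.
  by rewrite mxE; ring.
by rewrite lerD2r lerD2l ler_wMn2r// cauchy_schwarz_rV.
Qed.

Lemma one_enormD x y : 1 + enorm (x + y) <= (1 + enorm x) * (1 + enorm y).
Proof.
have := enormD x y; have := mulr_ge0 (enorm_ge0 x) (enorm_ge0 y).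
rewrite mulrDl mul1r mulrDr mulr1; lra.
Qed.

Lemma one_enorm_ge1 x : 1 <= 1 + enorm x.
Proof. by rewrite lerDl enorm_ge0. Qed.

Lemma one_enorm_pow_ge0 k x : 0 <= (1 + enorm x) ^+ k.
Proof. by rewrite exprn_ge0// addr_ge0// enorm_ge0. Qed.

(** Submultiplicativity of the weight: a translation by x costs a factor (1 + |x|)^k in a Schwartz
    seminorm. *)
Lemma one_enorm_powD k x y :
  (1 + enorm (x + y)) ^+ k <= (1 + enorm x) ^+ k * (1 + enorm y) ^+ k.
Proof.
rewrite -exprMn lerXn2r ?nnegrE ?mulr_ge0 ?addr_ge0 ?enorm_ge0//.
exact: one_enormD.
Qed.

(** The bound of [schwartz_norm k phi] by C, unfolded into real inequalities without a supremum in
    [\bar R]. *)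
Definition seminorm_le (k : nat) (C : R) (phi : 'rV[R]_n -> R) := forall s x,
  (size s <= k)%N -> (1 + enorm x) ^+ k * `|partials s phi x| <= C.

Lemma seminorm_le_ge0 k C phi : seminorm_le k C phi -> 0 <= C.
Proof.
move=> /(_ [::] 0 isT); apply: le_trans.
by rewrite mulr_ge0// one_enorm_pow_ge0.
Qed.

Lemma schwartz_norm_le k C phi : seminorm_le k C phi ->
  (schwartz_norm k phi <= C%:E)%E.
Proof.
by move=> H; apply: ge_ereal_sup => _ [s [x [sk ->]]]; rewrite lee_fin H.
Qed.

Lemma schwartzP phi :
  schwartz phi <-> smooth phi /\ forall k, exists C, seminorm_le k C phi.
Proof.
split=> -[sm H]; split => // k; last first.
  have [C /schwartz_norm_le HC] := H k; exact: le_lt_trans HC (ltry _).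
have Hk := H k; exists (fine (schwartz_norm k phi)) => s x sk.
have ub : (((1 + enorm x) ^+ k * `|partials s phi x|)%:E <= schwartz_norm k phi)%E.
  by apply: ereal_sup_ubound; exists s, x.
rewrite -lee_fin fineK// ge0_fin_numE//; apply: le_trans ub.
by rewrite lee_fin mulr_ge0// one_enorm_pow_ge0.
Qed.

Lemma smooth_partial phi s i : smooth phi ->
  is_partial i (partials s phi) (partials (i :: s) phi).
Proof.
by move=> /(_ s)[_ /(_ i) d] x; apply: DeriveDef => //; exact: d.
Qed.

(** Smoothness is shown by exhibiting all iterated derivatives at once; induction on s identifies
    them with [partials]. *)
Lemma smoothI (P : seq 'I_n -> 'rV[R]_n -> R) :
  (forall s, continuous (P s)) ->
  (forall s i, is_partial i (P s) (P (i :: s))) ->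
  smooth (P [::]) /\ forall s, partials s (P [::]) = P s.
Proof.
move=> cP dP; have E s : partials s (P [::]) = P s.
  elim: s => //= i s ->; apply/funext => x.
  by have [_ ->] := dP s i x.
split=> // s; rewrite E; split => // i x.
by have [] := dP s i x.
Qed.

Lemma is_partial_lin i a g dg h dh : is_partial i g dg -> is_partial i h dh ->
  is_partial i (fun x => a * g x + h x) (fun x => a * dg x + dh x).
Proof.
move=> Hg Hh x.
exact: (@is_deriveD _ _ _ (fun x => a *: g x) h x _ _ _
  (@is_deriveZ _ _ _ g a x _ _ (Hg x)) (Hh x)).
Qed.

Lemma smooth_lin a g h : smooth g -> smooth h ->
  smooth (fun x => a * g x + h x) /\ forall s,
    partials s (fun x => a * g x + h x) =
    fun x => a * partials s g x + partials s h x.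
Proof.
move=> sg sh.
apply: (@smoothI (fun s x => a * partials s g x + partials s h x)) => s.
  move=> x; apply: (@continuousD _ R^o _ (fun x => a * partials s g x)).
    by apply: continuousM; [exact: cst_continuous|exact: (sg s).1].
  exact: (sh s).1.
by move=> i; apply: is_partial_lin; exact: smooth_partial.
Qed.

Lemma seminorm_le_lin k a g h B C : smooth g -> smooth h ->
  seminorm_le k B g -> seminorm_le k C h ->
  seminorm_le k (`|a| * B + C) (fun x => a * g x + h x).
Proof.
move=> sg sh Hg Hh s x sk; have [_ ->] := smooth_lin a sg sh.
apply: (@le_trans _ _ ((1 + enorm x) ^+ k *
    (`|a| * `|partials s g x| + `|partials s h x|))).
  by rewrite ler_wpM2l ?one_enorm_pow_ge0// (le_trans (ler_normD _ _))// normrM.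
rewrite mulrDr lerD//; last exact: Hh.
by rewrite mulrCA ler_wpM2l// Hg.
Qed.

Lemma schwartz_lin a g h : schwartz g -> schwartz h ->
  schwartz (fun x => a * g x + h x).
Proof.
move=> /schwartzP[sg Hg] /schwartzP[sh Hh]; apply/schwartzP.
split; first by have [] := smooth_lin a sg sh.
move=> k; have [B HB] := Hg k; have [C HC] := Hh k.
by exists (`|a| * B + C); exact: seminorm_le_lin.
Qed.

Lemma schwartz0 : schwartz (fun _ : 'rV[R]_n => 0).
Proof.
have [s0 p0] := @smoothI (fun _ _ => 0) (fun _ => @cst_continuous _ _ 0)
  (fun _ _ x => is_derive_cst 0 x _).
apply/schwartzP; split => // k; exists 0 => s x _.
by rewrite p0 normr0 mulr0.
Qed.

Definition translate (x : 'rV[R]_n) (phi : 'rV[R]_n -> R) : 'rV[R]_n -> R :=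
  fun y => phi (y - x).

Lemma continuous_translate x phi : continuous phi -> continuous (translate x phi).
Proof.
move=> cphi y; apply: (@continuous_comp _ _ _ (fun y => y - x) phi); last exact: cphi.
apply: (@continuousB R 'rV[R]_n 'rV[R]_n id (cst x)); last exact: cst_continuous.
by move=> A.
Qed.

Lemma is_partial_translate i x phi dphi : is_partial i phi dphi ->
  is_partial i (translate x phi) (translate x dphi).
Proof.
move=> H; apply: is_partialP => y; rewrite /translate.
have := is_partial_line (y - x) 0 H; rewrite scale0r add0r.
by under eq_fun do rewrite addrA.
Qed.

Lemma smooth_translate x phi : smooth phi -> smooth (translate x phi) /\
  forall s, partials s (translate x phi) = translate x (partials s phi).
Proof.
move=> sm; apply: (@smoothI (fun s => translate x (partials s phi))) => s.
  by apply: continuous_translate; exact: (sm s).1.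
by move=> i; apply: is_partial_translate; exact: smooth_partial.
Qed.

Lemma seminorm_le_translate k B x phi : smooth phi -> seminorm_le k B phi ->
  seminorm_le k ((1 + enorm x) ^+ k * B) (translate x phi).
Proof.
move=> sm H s y sk; have [_ ->] := smooth_translate x sm.
apply: (@le_trans _ _ ((1 + enorm x) ^+ k *
    ((1 + enorm (y - x)) ^+ k * `|partials s phi (y - x)|))).
  rewrite mulrA ler_wpM2r//; apply: le_trans (one_enorm_powD _ _ _).
  by rewrite (addrC x) subrK.
by rewrite ler_wpM2l ?one_enorm_pow_ge0// H.
Qed.

Lemma schwartz_translate x phi : schwartz phi -> schwartz (translate x phi).
Proof.
move=> /schwartzP[sm H]; apply/schwartzP; split.
  by have [] := smooth_translate x sm.
by move=> k; have [B HB] := H k; eexists; exact: seminorm_le_translate HB.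
Qed.

(** The mean value theorem is used on the box between y - x and y - x'. As x' is coordinatewise
    smaller than x, each w in the box satisfies |y - w| <= |x|, so the weight at y is at most (1 +
    |x|)^k times the weight at w. The order k + 1 pays for the extra derivative. *)
Lemma partials_translate_lip k B phi s (x x' y : 'rV[R]_n) : smooth phi ->
  seminorm_le k.+1 B phi -> (size s <= k)%N ->
  (forall i, `|x' ord0 i| <= `|x ord0 i|) ->
  (1 + enorm y) ^+ k * `|partials s phi (y - x) - partials s phi (y - x')| <=
  B * ((1 + enorm x) ^+ k * \sum_(i < n) `|x ord0 i - x' ord0 i|).
Proof.
move=> sm HB sk xx'; have B0 := seminorm_le_ge0 HB.
set W := (1 + enorm y) ^+ k.
have Wp : 0 < W by rewrite exprn_gt0// ltr_pwDl// enorm_ge0.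
rewrite mulrC -ler_pdivlMr//.
have -> : B * ((1 + enorm x) ^+ k * \sum_(i < n) `|x ord0 i - x' ord0 i|) / W =
    (B * (1 + enorm x) ^+ k / W) *
      \sum_(i < n) `|(y - x) ord0 i - (y - x') ord0 i|.
  rewrite [X in _ = _ * X](_ : _ = \sum_(i < n) `|x ord0 i - x' ord0 i|); last first.
    apply: eq_bigr => i _; rewrite !mxE -normrN; congr (`|_|); ring.
  by rewrite mulrA mulrAC.
apply: (lipschitz_box (dphi := fun i => partials (i :: s) phi)) => [i|i w Hw].
  exact: smooth_partial.
rewrite ler_pdivlMr// mulrC.
have yw : forall j, `|(y - w) ord0 j| <= `|x ord0 j|.
  move=> j; have := Hw j; have := xx' j; rewrite !mxE !ler_norml.
  rewrite minEle maxEle; case: ifPn => _; have := ler_norm (x ord0 j);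
  have := ler_norm (- x ord0 j); rewrite normrN; lra.
apply: (@le_trans _ _ (((1 + enorm w) ^+ k * (1 + enorm (y - w)) ^+ k) *
    `|partials (i :: s) phi w|)).
  rewrite ler_wpM2r//; apply: le_trans (one_enorm_powD _ _ _).
  by rewrite (addrC w) subrK.
rewrite mulrAC ler_pM ?mulr_ge0 ?one_enorm_pow_ge0//.
  apply: le_trans (HB (i :: s) w sk); rewrite ler_wpM2r//.
  by rewrite ler_weXn2l// one_enorm_ge1.
rewrite lerXn2r ?nnegrE ?addr_ge0 ?enorm_ge0// lerD2l.
exact: le_enorm.
Qed.

Lemma seminorm_le_translateB k B phi (x x' : 'rV[R]_n) : smooth phi ->
  seminorm_le k.+1 B phi -> (forall i, `|x' ord0 i| <= `|x ord0 i|) ->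
  seminorm_le k (B * ((1 + enorm x) ^+ k * \sum_(i < n) `|x ord0 i - x' ord0 i|))
    (fun y => -1 * translate x' phi y + translate x phi y).
Proof.
move=> sm HB xx' s y sk.
have [sx px] := smooth_translate x sm; have [sx' px'] := smooth_translate x' sm.
have [_ ->] := smooth_lin (-1) sx' sx.
rewrite px px' mulN1r (addrC (- _)); exact: partials_translate_lip.
Qed.

End enorm_theory.

(** * Bounds and finite sums for tempered distributions; comparison of integrals *)

Lemma td_boundP (R : realType) (n : nat) (f : tempered_distribution R n) :
  exists (C : R) (k : nat), 0 <= C /\ forall phi B, schwartz phi ->
    seminorm_le k B phi -> `|f phi| <= C * B.
Proof.
have [C [k H]] := td_continuous f; exists `|C|, k; split => // phi B sphi HB.
have B0 := seminorm_le_ge0 HB.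
rewrite -lee_fin; apply: (le_trans (H _ sphi)).
have n0 : (0 <= schwartz_norm k phi)%E.
  apply: ereal_sup_ge; exists ((1 + enorm (0 : 'rV[R]_n)) ^+ k * `|phi 0|)%:E.
    by exists [::], 0.
  by rewrite lee_fin mulr_ge0// one_enorm_pow_ge0.
apply: (@le_trans _ _ (`|C|%:E * schwartz_norm k phi)%E).
  by rewrite lee_wpmul2r// lee_fin ler_norm.
by rewrite EFinM lee_wpmul2l// schwartz_norm_le.
Qed.

Lemma td_eval0 (R : realType) (n : nat) (f : tempered_distribution R n) :
  f (fun=> 0) = 0.
Proof.
have := td_linear f (-1) (@schwartz0 R n) (@schwartz0 R n).
by rewrite mulr0 addr0; lra.
Qed.

Lemma td_sum (R : realType) (n : nat) (f : tempered_distribution R n)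
    (I : Type) (r : seq I) (c : I -> R) (psi : I -> 'rV[R]_n -> R) :
  (forall i, schwartz (psi i)) ->
  schwartz (fun y => \sum_(i <- r) c i * psi i y) /\
  f (fun y => \sum_(i <- r) c i * psi i y) = \sum_(i <- r) c i * f (psi i).
Proof.
move=> spsi; elim: r => [|i r [sr fr]].
  under eq_fun do rewrite big_nil; rewrite big_nil; split.
    exact: schwartz0.
  exact: td_eval0.
under eq_fun do rewrite big_cons; rewrite big_cons -fr; split.
  exact: schwartz_lin.
exact: td_linear.
Qed.

Lemma td_sub (R : realType) (n : nat) (f : tempered_distribution R n) g h :
  schwartz g -> schwartz h -> f (fun y => -1 * g y + h y) = f h - f g.
Proof. by move=> sg sh; rewrite td_linear// mulN1r addrC. Qed.

Lemma le_integrable_EFin d (T : measurableType d) (R : realType)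
    (mu : {measure set T -> \bar R}) (f g : T -> R) :
  measurable_fun setT f -> mu.-integrable setT (EFin \o g) ->
  (forall x, `|f x| <= g x) -> mu.-integrable setT (EFin \o f).
Proof.
move=> mf ig fg; apply: (le_integrable measurableT _ _ ig).
  exact/measurable_EFinP.
move=> x _ /=; rewrite lee_fin (le_trans (fg x))//.
exact: ler_norm.
Qed.

Lemma le_norm_Rintegral d (T : measurableType d) (R : realType)
    (mu : {measure set T -> \bar R}) (f g : T -> R) :
  measurable_fun setT f -> mu.-integrable setT (EFin \o g) ->
  (forall x, `|f x| <= g x) -> `|\int[mu]_x f x| <= \int[mu]_x g x.
Proof.
move=> mf ig fg; have itf := le_integrable_EFin mf ig fg.
apply: (le_trans (le_normr_Rintegral measurableT itf)).
apply: le_Rintegral => //.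
exact: integrable_norm.
Qed.

Lemma EFin_Rintegral d (T : measurableType d) (R : realType)
    (mu : {measure set T -> \bar R}) (f : T -> R) :
  mu.-integrable setT (EFin \o f) ->
  ((\int[mu]_x f x)%:E = \int[mu]_x (f x)%:E)%E.
Proof. by move=> itf; rewrite fineK// integrable_fin_num. Qed.

(** When the first factor depends on x only through finitely many cells, the integral is a finite
    linear combination, which a distribution can be applied to termwise. *)
Lemma Rintegral_finite_range d (T : measurableType d) (R : realType)
    (mu : {measure set T -> \bar R}) (I : finType) (q : T -> I) (w : T -> R) (H : I -> R) :
  (forall u, measurable (q @^-1` [set u])) ->
  mu.-integrable setT (EFin \o w) ->
  mu.-integrable setT (EFin \o (fun x => H (q x) * w x)) /\
  \int[mu]_x (H (q x) * w x) =
    \sum_(u : I) (\int[mu]_x (\1_(q @^-1` [set u]) x * w x)) * H u.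
Proof.
move=> mq iw.
have E x : H (q x) * w x = \sum_(u : I) H u * (\1_(q @^-1` [set u]) x * w x).
  rewrite (bigD1 (q x))//= big1 ?addr0 => [|u uq].
    by rewrite indicE mem_set// mul1r.
  rewrite indicE memNset ?mul0r ?mulr0// => /= qxu.
  by rewrite qxu eqxx in uq.
have mw : measurable_fun setT w.
  by apply/measurable_EFinP; exact: measurable_int iw.
have i1 u : mu.-integrable setT (EFin \o (fun x => \1_(q @^-1` [set u]) x * w x)).
  apply: (@le_integrable_EFin _ _ _ _ _ (fun x => `|w x|)).
  - by apply: measurable_funM => //; exact: measurable_indic.
  - exact: integrable_norm.
  - move=> x; rewrite normrM ler_piMl// indicE; case: (_ \in _) => /=.
      by rewrite normr1.
    by rewrite normr0.
have i2 u : mu.-integrable setT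
    (fun x => (H u * (\1_(q @^-1` [set u]) x * w x))%:E).
  exact: (integrableZl measurableT (H u) (i1 u)).
have e1 : (EFin \o (fun x => H (q x) * w x)) =
    (fun x => \sum_(u : I) (H u * (\1_(q @^-1` [set u]) x * w x))%:E)%E.
  by apply/funext => x /=; rewrite E sumEFin.
split.
  by rewrite e1; apply: integrable_sum => // u _; exact: i2.
rewrite /Rintegral [X in fine X](_ : _ = (\int[mu]_x
    (\sum_(u : I) (H u * (\1_(q @^-1` [set u]) x * w x))%:E))%E); last first.
  by apply: eq_integral => x _; rewrite E sumEFin.
rewrite integral_sum//.
transitivity (fine (\sum_(u : I) (H u * \int[mu]_x (\1_(q @^-1` [set u]) x * w x))%:E)%E).
  congr fine; apply: eq_bigr => u _; rewrite EFinM EFin_Rintegral//.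
  exact: (integralZl measurableT (i1 u) (H u)).
by rewrite sumEFin/=; apply: eq_bigr => u _; rewrite mulrC.
Qed.

(* Coordinates are rounded toward 0 to a finite grid. Not increasing absolute   *)
(* values lets the weights (1 + enorm x)^k dominate at the rounded points.      *)
Definition trunc_grid (R : realType) (N : nat) (b : R) : nat :=
  minn (Num.truncn (N.+1%:R * b)) (N.+1 * N.+1).

Lemma trunc_grid_le (R : realType) (N : nat) (b : R) : 0 <= b ->
  (0 : R) <= (trunc_grid N b)%:R / N.+1%:R <= b.
Proof.
move=> b0; rewrite divr_ge0//= ler_pdivrMr ?ltr0n// mulrC.
apply: (@le_trans _ _ (Num.truncn (N.+1%:R * b))%:R).
  by rewrite ler_nat geq_minl.
by rewrite truncn_le mulr_ge0.
Qed.

Lemma trunc_grid_ge (R : realType) (N : nat) (b : R) : 0 <= b <= N.+1%:R ->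
  b - (trunc_grid N b)%:R / N.+1%:R <= N.+1%:R^-1.
Proof.
move=> /andP[b0 bN]; rewrite /trunc_grid (minn_idPl _); last first.
  rewrite -(ler_nat R) natrM; apply: (@le_trans _ _ (N.+1%:R * b)).
    by rewrite truncn_le mulr_ge0.
  by rewrite ler_wpM2l.
have h := ltW (truncnS_gt (N.+1%:R * b)).
rewrite lerBlDl -[X in _ + X]mul1r -mulrDl ler_pdivlMr ?ltr0n// mulrC.
by rewrite (le_trans h)// -natr1.
Qed.

Lemma trunc_grid0 (R : realType) (N : nat) : trunc_grid N (0 : R) = 0%N.
Proof. by rewrite /trunc_grid mulr0 truncn0 min0n. Qed.

Lemma nondecreasing_trunc_grid (R : realType) (N : nat) :
  {homo (fun b : R => (trunc_grid N b)%:R : R) : a b / a <= b}.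
Proof.
move=> a b ab; rewrite ler_nat leq_min geq_minr andbT.
apply: (leq_trans (geq_minl _ _)); apply: le_truncn.
by rewrite ler_wpM2l.
Qed.

Definition round_coord (R : realType) (N : nat) (a : R) : R :=
  (trunc_grid N (Num.max a 0))%:R / N.+1%:R -
  (trunc_grid N (Num.max (- a) 0))%:R / N.+1%:R.

Lemma round_coord_le (R : realType) (N : nat) (a : R) : `|round_coord N a| <= `|a|.
Proof.
rewrite /round_coord; have [a0|a0] := leP 0 a.
  rewrite (max_idPr _) ?oppr_le0// trunc_grid0 mul0r subr0.
  by rewrite (ger0_norm a0); have /andP[h1 h2] := trunc_grid_le N a0; rewrite ger0_norm.
have na0 : 0 <= - a by rewrite oppr_ge0 ltW.
rewrite (max_idPl na0) trunc_grid0 mul0r sub0r normrN.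
by rewrite (ltr0_norm a0); have /andP[h1 h2] := trunc_grid_le N na0; rewrite ger0_norm.
Qed.

Lemma round_coord_dist (R : realType) (N : nat) (a : R) : `|a| <= N.+1%:R ->
  `|a - round_coord N a| <= N.+1%:R^-1.
Proof.
rewrite /round_coord; have [a0|a0] := leP 0 a.
  rewrite (max_idPr _) ?oppr_le0// trunc_grid0 mul0r subr0.
  rewrite (ger0_norm a0) => aN; rewrite ger0_norm.
    by apply: trunc_grid_ge; rewrite a0.
  by rewrite subr_ge0; have /andP[] := trunc_grid_le N a0.
have na0 : 0 <= - a by rewrite oppr_ge0 ltW.
rewrite (max_idPl na0) trunc_grid0 mul0r sub0r.
rewrite (ltr0_norm a0) => aN; rewrite -normrN opprD ger0_norm opprK.
  by apply: trunc_grid_ge; rewrite na0.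
by rewrite subr_ge0; have /andP[] := trunc_grid_le N na0.
Qed.

Definition round_rV (R : realType) (n N : nat) (x : 'rV[R]_n) : 'rV[R]_n :=
  \row_i round_coord N (x ord0 i).

Lemma round_rV_le (R : realType) (n N : nat) (x : 'rV[R]_n) i :
  `|round_rV N x ord0 i| <= `|x ord0 i|.
Proof. by rewrite mxE round_coord_le. Qed.

Lemma round_rV_cvg (R : realType) (n : nat) (x : 'rV[R]_n) :
  \sum_(i < n) `|x ord0 i - round_rV N x ord0 i| @[N --> \oo] --> (0 : R).
Proof.
have -> : nbhs (0 : R) = nbhs (\sum_(i < n) (0 : R)) by rewrite big1.
apply: cvg_big => [|i _]; first exact: add_continuous.
apply/cvgrPdist_le => e e0.
near=> N; rewrite sub0r normrN normr_id mxE.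
apply: (@le_trans _ _ N.+1%:R^-1).
  apply: round_coord_dist; near: N.
  exists (Num.truncn `|x ord0 i|) => // N /= hN.
  by apply: (le_trans (ltW (truncnS_gt _))); rewrite ler_nat.
near: N; exists (Num.truncn e^-1) => // N /= hN.
rewrite -[leRHS]invrK lef_pV2 ?posrE ?invr_gt0 ?ltr0n//.
by apply: (le_trans (ltW (truncnS_gt _))); rewrite ler_nat.
Unshelve. all: by end_near. Qed.

(** The cells are indexed by the truncated positive and negative parts of all coordinates. The cap
    in [trunc_grid] makes them finitely many, and monotonicity of the truncation makes them
    measurable. *)
Lemma round_rV_finite (R : realType) (n N : nat) :
  exists (I : finType) (q : 'rV[R]_n -> I) (F : I -> 'rV[R]_n),
    (forall u, measurable (q @^-1` [set u])) /\ forall x, round_rV N x = F (q x).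
Proof.
pose K := (N.+1 * N.+1)%N.
pose q (x : 'rV[R]_n) : {ffun 'I_n -> 'I_K.+1 * 'I_K.+1} :=
  [ffun i => (inord (trunc_grid N (Num.max (x ord0 i) 0)),
              inord (trunc_grid N (Num.max (- x ord0 i) 0)))].
pose F (u : {ffun 'I_n -> 'I_K.+1 * 'I_K.+1}) : 'rV[R]_n :=
  \row_i ((u i).1%:R / N.+1%:R - (u i).2%:R / N.+1%:R).
have tK (b : R) : (trunc_grid N b < K.+1)%N by rewrite ltnS geq_minr.
exists _, q, F; split => [u|x]; last first.
  by apply/rowP => i; rewrite !mxE !ffunE/= !inordK.
have mt : measurable_fun setT (fun b : measurableTypeR R => (trunc_grid N b)%:R : R).
  by apply: nondecreasing_measurable => // a b; exact: nondecreasing_trunc_grid.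
have m1 i : measurable_fun setT
    (fun x : 'rV[R]_n => (trunc_grid N (Num.max (x ord0 i) 0))%:R : R).
  apply: (measurableT_comp mt); apply: measurable_maxr => //.
  exact: measurable_coord.
have m2 i : measurable_fun setT
    (fun x : 'rV[R]_n => (trunc_grid N (Num.max (- x ord0 i) 0))%:R : R).
  apply: (measurableT_comp mt); apply: measurable_maxr => //.
  by apply: measurableT_comp => //; exact: measurable_coord.
rewrite (_ : _ @^-1` _ = \bigcap_(i in [set: 'I_n])
  ((fun x : 'rV[R]_n => (trunc_grid N (Num.max (x ord0 i) 0))%:R : R) @^-1` [set (u i).1%:R] `&`
   (fun x : 'rV[R]_n => (trunc_grid N (Num.max (- x ord0 i) 0))%:R : R) @^-1` [set (u i).2%:R])).
  apply: fin_bigcap_measurable => // i _; apply: measurableI.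
    by rewrite -[X in measurable X]setTI; exact: m1.
  by rewrite -[X in measurable X]setTI; exact: m2.
apply/seteqP; split => x /=.
  by move=> <- i _; rewrite ffunE/= !inordK.
move=> H; apply/ffunP => i; rewrite ffunE; have [/= h1 h2] := H i I.
rewrite [RHS]surjective_pairing; congr pair; apply/val_inj; rewrite /= inordK//.
  by apply/eqP; rewrite -(eqr_nat R); exact/eqP.
by apply/eqP; rewrite -(eqr_nat R); exact/eqP.
Qed.

Lemma measurable_comp_round_rV (R : realType) (n N : nat) (G : 'rV[R]_n -> R) :
  measurable_fun setT (fun x => G (round_rV N x)).
Proof.
have [I [q [F [mq rF]]]] := @round_rV_finite R n N.
rewrite (_ : (fun x => _) =
    (fun x => \sum_(u : I) G (F u) * \1_(q @^-1` [set u]) x)).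
  by apply: measurable_sum => u; apply: measurable_funM.
apply/funext => x; rewrite rF (bigD1 (q x))//= big1 ?addr0 => [|u uq].
  by rewrite indicE mem_set// mulr1.
rewrite indicE memNset ?mulr0// => /= qxu.
by rewrite qxu eqxx in uq.
Qed.

(** G is the pointwise limit of its compositions with [round_rV], which take finitely many values on
    measurable cells. The hypothesis compares x only with coordinatewise smaller points because
    rounding produces only those. *)
Lemma measurable_dominated_lipschitz (R : realType) (n : nat)
    (G K : 'rV[R]_n -> R) :
  (forall x x' : 'rV[R]_n, (forall i, `|x' ord0 i| <= `|x ord0 i|) ->
    `|G x - G x'| <= K x * \sum_(i < n) `|x ord0 i - x' ord0 i|) ->
  measurable_fun setT G.
Proof.
move=> H; apply: (@measurable_fun_cvg _ _ _ _ (fun N x => G (round_rV N x))).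
  by move=> N; exact: measurable_comp_round_rV.
move=> x _; apply/cvgrPdist_le => e e0.
have : (K x * \sum_(i < n) `|x ord0 i - round_rV N x ord0 i|) @[N --> \oo] --> (0 : R).
  by rewrite -[X in _ --> X](mulr0 (K x)); apply: cvgMr; exact: round_rV_cvg.
move/cvgrPdist_le => /(_ e e0); apply: filterS => N hN.
apply: (le_trans (H x _ (round_rV_le N x))).
by apply: le_trans hN; rewrite sub0r normrN ler_norm.
Qed.

(** * Boundedness, measurability and integrability of Schwartz functions *)

Lemma seminorm_le_bound (R : realType) (n k : nat) (B : R) (phi : 'rV[R]_n -> R) s x :
  seminorm_le k B phi -> (size s <= k)%N -> `|partials s phi x| <= B.
Proof.
move=> H sk; apply: le_trans (H s x sk).
by rewrite ler_peMl// exprn_ege1// one_enorm_ge1.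
Qed.

Lemma partials_lip (R : realType) (n k : nat) (B : R) (phi : 'rV[R]_n -> R) s u v :
  smooth phi -> seminorm_le k.+1 B phi -> (size s <= k)%N ->
  `|partials s phi u - partials s phi v| <= B * \sum_(i < n) `|u ord0 i - v ord0 i|.
Proof.
move=> sm H sk; apply: (lipschitz_box (dphi := fun i => partials (i :: s) phi)).
  by move=> i; exact: smooth_partial.
by move=> i w _; apply: seminorm_le_bound H _.
Qed.

Lemma measurable_partials (R : realType) (n : nat) (phi : 'rV[R]_n -> R) s :
  schwartz phi -> measurable_fun setT (partials s phi).
Proof.
move=> /schwartzP[sm H]; have [B HB] := H (size s).+1.
apply: (@measurable_dominated_lipschitz _ _ _ (fun=> B)) => x x' _.
exact: partials_lip HB _.
Qed.

Lemma schwartz_measurable (R : realType) (n : nat) (phi : 'rV[R]_n -> R) :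
  schwartz phi -> measurable_fun setT phi.
Proof. exact: (@measurable_partials R n phi [::]). Qed.

Lemma schwartz_weight_integrable (R : realType) (n k : nat) (w : 'rV[R]_n -> R) :
  schwartz w -> (@lebesgue_rV R n).-integrable setT
    (EFin \o (fun x => (1 + enorm x) ^+ k * `|w x|)).
Proof.
(* The 2n extra powers of 1 + |x| dominate the product of the 1 + x_i^2. *)
move=> sw; have /schwartzP[_ /(_ (k + 2 * n)%N)[C HC]] := sw.
have C0 := seminorm_le_ge0 HC.
apply: (@le_integrable_EFin _ _ R (@lebesgue_rV R n) _
    (fun x => C * \prod_(i < n) (1 + x ord0 i ^+ 2)^-1)).
- apply: measurable_funM.
    by apply: measurable_funX; apply: measurable_funD => //; exact: measurable_enorm.
  by apply: measurableT_comp => //; exact: schwartz_measurable.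
- exact: (integrableZl measurableT C (integrable_prod_oneDsqrV R n)).
move=> x; rewrite ger0_norm; last by rewrite mulr_ge0// one_enorm_pow_ge0.
have p0 i : 0 < 1 + x ord0 i ^+ 2 by rewrite ltr_pwDl// sqr_ge0.
rewrite prodfV ler_pdivlMr ?prodr_gt0//.
apply: (@le_trans _ _ ((1 + enorm x) ^+ k * `|w x| * (1 + enorm x) ^+ (2 * n))).
  rewrite ler_wpM2l ?mulr_ge0 ?one_enorm_pow_ge0// exprM.
  rewrite -[X in _ ^+ X](card_ord n) -prodr_const ler_prod// => i _.
  rewrite ltW//=; have := coord_le_enorm x i; have := enorm_ge0 x.
  rewrite -(ger0_norm (sqr_ge0 (x ord0 i))) normrX.
  have := normr_ge0 (x ord0 i); nra.
by rewrite mulrAC -exprD; exact: (HC [::]).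
Qed.

Lemma schwartz_integrable (R : realType) (n : nat) (w : 'rV[R]_n -> R) :
  schwartz w -> (@lebesgue_rV R n).-integrable setT (EFin \o (fun x => `|w x|)).
Proof.
move=> /(@schwartz_weight_integrable R n 0); apply: eq_integrable => // x _.
by rewrite /= expr0 mul1r.
Qed.

(** * Convolution of Schwartz functions and exchange with a distribution *)

Definition conv (R : realType) (n : nat) (psi w : 'rV[R]_n -> R) (y : 'rV[R]_n) : R :=
  \int[@lebesgue_rV R n]_x (psi (y - x) * w x).

Lemma measurable_subl_rV (R : realType) (n : nat) (y : 'rV[R]_n) :
  measurable_fun setT (fun x : 'rV[R]_n => y - x).
Proof.
apply: measurable_fun_coordP => i; under eq_fun do rewrite !mxE.
by apply: measurable_funB => //; exact: measurable_coord.
Qed.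

(* Differentiability from a uniform quadratic error, which passes through       *)
(* integrals and so replaces differentiation under the integral sign.           *)
Lemma is_partial_quadratic (R : realType) (n : nat) (i : 'I_n)
    (phi dphi : 'rV[R]_n -> R) (K : R) : 0 <= K ->
  (forall x h, `|phi (h *: rV_basis R i + x) - phi x - h * dphi x| <= K * h ^+ 2) ->
  is_partial i phi dphi.
Proof.
move=> K0 H x.
have c : (fun h : R => h^-1 *: ((phi \o shift x) (h *: rV_basis R i) - phi x)) @ 0^'
    --> dphi x.
  apply/cvgrPdist_le => e e0; near=> h.
  have h0 : h != 0 by near: h; exact: nbhs_dnbhs_neq.
  rewrite /= -[dphi x](mulKf h0) -normrN opprB.
  rewrite [h^-1 *: _]/(h^-1 * _) -mulrBr normrM normfV.
  rewrite ler_pdivrMl ?normr_gt0//; apply: (le_trans (H x h)).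
  rewrite -(ger0_norm (sqr_ge0 h)) normrX expr2 mulrCA ler_wpM2l//.
  have hK : `|h| <= e / (K + 1).
    near: h; apply: dnbhs0_le; rewrite divr_gt0//; exact: ltr_wpDl.
  apply: (@le_trans _ _ ((K + 1) * `|h|)); first by rewrite ler_wpM2r// lerDl.
  by rewrite mulrC -ler_pdivlMr// ltr_wpDl.
split; first by apply/cvg_ex; exists (dphi x).
exact: cvg_lim c.
Unshelve. all: by end_near. Qed.

Lemma conv_mul_integrable (R : realType) (n : nat) (chi w : 'rV[R]_n -> R) (B : R)
  (y : 'rV[R]_n) : measurable_fun setT chi -> (forall x, `|chi x| <= B) -> schwartz w ->
  (@lebesgue_rV R n).-integrable setT (EFin \o (fun x => chi (y - x) * w x)).
Proof.
move=> mchi HB sw; apply: (@le_integrable_EFin _ _ R (@lebesgue_rV R n) _ (fun x => B * `|w x|)).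
- apply: measurable_funM; last exact: schwartz_measurable.
  by apply: measurableT_comp => //; exact: measurable_subl_rV.
- exact: (integrableZl measurableT B (schwartz_integrable sw)).
by move=> x; rewrite normrM ler_wpM2r.
Qed.

Lemma measurable_translate_mul (R : realType) (n : nat) (chi w : 'rV[R]_n -> R)
    (y : 'rV[R]_n) : measurable_fun setT chi -> schwartz w ->
  measurable_fun setT (fun x : 'rV[R]_n => chi (y - x) * w x).
Proof.
move=> mchi sw; apply: measurable_funM; last exact: schwartz_measurable.
by apply: measurableT_comp => //; exact: measurable_subl_rV.
Qed.

Lemma conv_dist_le (R : realType) (n : nat) (chi w : 'rV[R]_n -> R) (B D : R) u v :
  measurable_fun setT chi -> (forall x, `|chi x| <= B) -> schwartz w ->
  (forall x, `|chi (u - x) - chi (v - x)| <= D) ->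
  `|conv chi w u - conv chi w v| <= D * \int[@lebesgue_rV R n]_x `|w x|.
Proof.
move=> mchi HB sw HD; have iw := schwartz_integrable sw.
rewrite /conv -RintegralB//; try exact: conv_mul_integrable HB sw.
rewrite -RintegralZl//; apply: le_norm_Rintegral.
- by apply: measurable_funB; exact: measurable_translate_mul.
- exact: (integrableZl measurableT D iw).
by move=> x; rewrite -mulrBl normrM ler_wpM2r.
Qed.

(** Two uses of the mean value theorem bound the first-order Taylor remainder of chi by B h^2 at
    every point. Integrated against |w| this is the uniform quadratic error required by
    [is_partial_quadratic]. *)
Lemma conv_is_partial (R : realType) (n : nat) (i : 'I_n)
    (chi dchi ddchi w : 'rV[R]_n -> R) (B : R) :
  measurable_fun setT chi -> measurable_fun setT dchi ->
  (forall x, `|chi x| <= B) -> (forall x, `|dchi x| <= B) ->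
  (forall x, `|ddchi x| <= B) -> schwartz w ->
  is_partial i chi dchi -> is_partial i dchi ddchi ->
  is_partial i (conv chi w) (conv dchi w).
Proof.
move=> mc md Bc Bd Bdd sw dc ddc; have iw := schwartz_integrable sw.
have B0 : 0 <= B by exact: le_trans (Bc 0).
have taylor x h : `|chi (h *: rV_basis R i + x) - chi x - h * dchi x| <= B * h ^+ 2.
  have [c ch ->] := partial_mvt x h dc; rewrite (mulrC h) -mulrBl.
  have [c' ch' ->] := partial_mvt x c ddc.
  have cl : `|c| <= `|h|.
    move: ch; rewrite minEle maxEle; case: ifPn => h0; last rewrite -ltNge in h0.
      by move=> ?; rewrite !ger0_norm//; lra.
    by move=> ?; rewrite (ltr0_norm h0) ler0_norm; lra.
  rewrite !normrM -mulrA -(ger0_norm (sqr_ge0 h)) normrX expr2.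
  by rewrite ler_pM ?mulr_ge0// ler_wpM2r.
apply: (@is_partial_quadratic _ _ _ _ _ (B * \int[@lebesgue_rV R n]_x `|w x|)).
  by rewrite mulr_ge0// Rintegral_ge0.
move=> y h; rewrite /conv.
have i1 z := conv_mul_integrable z mc Bc sw.
have i2 z := conv_mul_integrable z md Bd sw.
rewrite -RintegralB// -RintegralZl//.
rewrite -RintegralB//; last 2 first.
- exact: (integrableB measurableT (i1 _) (i1 _)).
- exact: (integrableZl measurableT h (i2 y)).
rewrite mulrAC -RintegralZl//; apply: le_norm_Rintegral.
- apply: measurable_funB; first by apply: measurable_funB; exact: measurable_translate_mul.
  by apply: measurable_funM => //; exact: measurable_translate_mul.
- exact: (integrableZl measurableT _ iw).
move=> x; rewrite -mulrBl mulrA -mulrBl normrM ler_wpM2r//.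
by rewrite -(addrA (h *: _)) taylor.
Qed.

Lemma lipschitz_continuous_rV (R : realType) (n : nat) (phi : 'rV[R]_n -> R) (B : R) :
  (forall u v, `|phi u - phi v| <= B * \sum_(i < n) `|u ord0 i - v ord0 i|) ->
  continuous phi.
Proof.
move=> H u; have FF : ProperFilter (nbhs (u : 'rV[R]_n)) := nbhs_pfilter _.
apply/(@cvgrPdist_le _ R^o _ _ (FF : Filter _)) => e e0.
have h : (fun v : 'rV[R]_n => B * \sum_(i < n) `|u ord0 i - v ord0 i|) @ u
    --> (0 : R).
  rewrite -[X in _ --> X](mulr0 B); apply: cvgMr.
  have -> : nbhs (0 : R) = nbhs (\sum_(i < n) `|u ord0 i - u ord0 i|).
    by rewrite big1// => i _; rewrite subrr normr0.
  apply: cvg_big => [|i _]; first exact: add_continuous.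
  apply: cvg_norm; apply: cvgB; first exact: cvg_cst.
  exact: coord_continuous.
have := (@cvgrPdist_le _ R^o _ _ (FF : Filter _) _ _).1 h e e0.
apply: (@filterS _ _ (FF : Filter _)) => v hv; apply: (le_trans (H u v)).
by apply: le_trans hv; rewrite sub0r normrN ler_norm.
Qed.

Lemma smooth_conv (R : realType) (n : nat) (psi w : 'rV[R]_n -> R) :
  schwartz psi -> schwartz w ->
  smooth (conv psi w) /\ forall s, partials s (conv psi w) = conv (partials s psi) w.
Proof.
move=> spsi sw; have /schwartzP[sm H] := spsi.
apply: (@smoothI _ _ (fun s => conv (partials s psi) w)) => s.
  have [B HB] := H (size s).+1.
  apply: (@lipschitz_continuous_rV _ _ _ (B * \int[@lebesgue_rV R n]_x `|w x|)) => u v.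
  rewrite mulrAC; apply: (@conv_dist_le _ _ _ _ B) => //.
  - exact: measurable_partials.
  - by move=> x; apply: seminorm_le_bound HB _.
  move=> x; apply: (le_trans (partials_lip _ _ sm HB _)) => //.
  rewrite le_eqVlt; apply/orP; left; apply/eqP; congr (_ * _).
  by apply: eq_bigr => i _; rewrite !mxE; congr (`|_|); ring.
(* [conv_is_partial] requires bounds on two derivatives beyond [partials s psi]. *)
move=> i; have [B HB] := H (size s).+2.
apply: (@conv_is_partial _ _ _ _ _ (partials (i :: i :: s) psi) _ B) => //;
  try exact: measurable_partials; try exact: smooth_partial;
  by move=> x; apply: (seminorm_le_bound _ HB); rewrite /= ?ltnS ?leqW.
Qed.

Lemma schwartz_conv (R : realType) (n : nat) (psi w : 'rV[R]_n -> R) :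
  schwartz psi -> schwartz w -> schwartz (conv psi w).
Proof.
move=> spsi sw; have /schwartzP[sm H] := spsi.
apply/schwartzP; have [sc pc] := smooth_conv spsi sw; split => // k.
have [B HB] := H k; have B0 := seminorm_le_ge0 HB.
exists (B * \int[@lebesgue_rV R n]_x ((1 + enorm x) ^+ k * `|w x|)) => s y sk.
have iw := schwartz_weight_integrable k sw.
have bc x : `|partials s psi x| <= B by exact: seminorm_le_bound HB _.
have mc := measurable_partials s spsi.
rewrite pc /conv -RintegralZl// -[X in X * _]ger0_norm ?one_enorm_pow_ge0//.
rewrite -normrM -RintegralZl//; last exact: conv_mul_integrable bc sw.
apply: le_norm_Rintegral.
- by apply: measurable_funM => //; exact: measurable_translate_mul.
- exact: (integrableZl measurableT _ iw).
move=> x; rewrite !normrM (ger0_norm (one_enorm_pow_ge0 _ _)) !mulrA ler_wpM2r//.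
rewrite (mulrC B); apply: (@le_trans _ _ ((1 + enorm x) ^+ k *
    ((1 + enorm (y - x)) ^+ k * `|partials s psi (y - x)|))).
  rewrite mulrA ler_wpM2r//; apply: le_trans (one_enorm_powD _ _ _).
  by rewrite (addrC x) subrK.
by rewrite ler_wpM2l ?one_enorm_pow_ge0// HB.
Qed.

Lemma partials_sum (R : realType) (n : nat) (I : Type) (r : seq I) (c : I -> R)
    (psi : I -> 'rV[R]_n -> R) s : (forall i, smooth (psi i)) ->
  smooth (fun y => \sum_(i <- r) c i * psi i y) /\
  partials s (fun y => \sum_(i <- r) c i * psi i y) =
    fun y => \sum_(i <- r) c i * partials s (psi i) y.
Proof.
move=> spsi; elim: r => [|i r [sr fr]].
  have [s0 p0] := @smoothI R n (fun _ _ => 0) (fun _ => @cst_continuous _ _ 0)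
    (fun _ _ x => is_derive_cst 0 x _).
  under eq_fun do rewrite big_nil; split; first exact: s0.
  by rewrite p0; apply/funext => y; rewrite big_nil.
under eq_fun do rewrite big_cons.
have [sm ->] := smooth_lin (c i) (spsi i) sr; split => //.
by apply/funext => y; rewrite big_cons fr.
Qed.

(** Rounding does not increase coordinates, so each difference is at most 2 |x|; this costs one more
    power of the weight and gives a majorant independent of N. *)
Lemma round_weight_integrable (R : realType) (n k N : nat) (w : 'rV[R]_n -> R) :
  schwartz w -> (@lebesgue_rV R n).-integrable setT
   (EFin \o (fun x => (1 + enorm x) ^+ k *
      (\sum_(i < n) `|x ord0 i - round_rV N x ord0 i|) * `|w x|)) /\
  forall x, (1 + enorm x) ^+ k *
      (\sum_(i < n) `|x ord0 i - round_rV N x ord0 i|) * `|w x| <=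
    2 * n%:R * ((1 + enorm x) ^+ k.+1 * `|w x|).
Proof.
move=> sw.
have le x : (1 + enorm x) ^+ k *
      (\sum_(i < n) `|x ord0 i - round_rV N x ord0 i|) * `|w x| <=
    2 * n%:R * ((1 + enorm x) ^+ k.+1 * `|w x|).
  rewrite exprSr -!mulrA [leRHS]mulrA [leRHS]mulrCA ler_wpM2l ?one_enorm_pow_ge0//.
  rewrite mulrA ler_wpM2r//.
  apply: (@le_trans _ _ (\sum_(i < n) 2 * (1 + enorm x))).
    apply: ler_sum => i _; have := round_rV_le N x i; have := coord_le_enorm x i.
    by have := ler_normB (x ord0 i) (round_rV N x ord0 i); lra.
  by rewrite sumr_const card_ord -[leLHS]mulr_natl mulrA (mulrC n%:R).
split => //; apply: (@le_integrable_EFin _ _ R (@lebesgue_rV R n) _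
    (fun x => 2 * n%:R * ((1 + enorm x) ^+ k.+1 * `|w x|))).
- apply: measurable_funM; last first.
    by apply: measurableT_comp => //; exact: schwartz_measurable.
  apply: measurable_funM.
    by apply: measurable_funX; apply: measurable_funD => //; exact: measurable_enorm.
  apply: measurable_sum => i; apply: measurableT_comp => //.
  apply: measurable_funB; first exact: measurable_coord.
  exact: (@measurable_comp_round_rV R n N (fun z => z ord0 i)).
- exact: (integrableZl measurableT _ (schwartz_weight_integrable k.+1 sw)).
by move=> x; rewrite ger0_norm// !mulr_ge0 ?one_enorm_pow_ge0// sumr_ge0.
Qed.

Lemma round_weight_cvg (R : realType) (n k : nat) (w : 'rV[R]_n -> R) : schwartz w ->
  \int[@lebesgue_rV R n]_x ((1 + enorm x) ^+ k *
      (\sum_(i < n) `|x ord0 i - round_rV N x ord0 i|) * `|w x|) @[N --> \oo]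
    --> (0 : R).
Proof.
move=> sw.
have H N := round_weight_integrable k N sw.
apply: fine_cvg.
have -> : 0%:E = (\int[@lebesgue_rV R n]_(x in setT) cst 0 x)%E by rewrite integral0.
apply: (@dominated_cvg _ _ R (@lebesgue_rV R n) setT measurableT
  (fun N x => ((1 + enorm x) ^+ k *
      (\sum_(i < n) `|x ord0 i - round_rV N x ord0 i|) * `|w x|)%:E)
  (cst 0%E) (fun x => (2 * n%:R * ((1 + enorm x) ^+ k.+1 * `|w x|))%:E)).
- by move=> N; have [i _] := H N; exact: measurable_int i.
- move=> x _; apply: cvg_EFin; first exact: nearW.
  rewrite [X in _ --> X](_ : _ = (1 + enorm x) ^+ k * 0 * `|w x|); last first.
    by rewrite mulr0 mul0r.
  by apply: cvgMl; apply: cvgMr; exact: round_rV_cvg.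
- by [].
- exact: (integrableZl measurableT _ (schwartz_weight_integrable k.+1 sw)).
move=> N x _; have [_ h] := H N; rewrite /= lee_fin ger0_norm//.
by rewrite !mulr_ge0 ?one_enorm_pow_ge0// sumr_ge0.
Qed.

(** Continuity of f in a single seminorm turns the estimates on translates into a Lipschitz bound
    and a growth bound, both with polynomial weight. *)
Lemma td_translate_lip (R : realType) (n : nat) (f : tempered_distribution R n)
    (psi : 'rV[R]_n -> R) : schwartz psi -> exists (C : R) (k : nat), 0 <= C /\
  (forall x x' : 'rV[R]_n, (forall i, `|x' ord0 i| <= `|x ord0 i|) ->
    `|f (translate x psi) - f (translate x' psi)| <=
    C * ((1 + enorm x) ^+ k * \sum_(i < n) `|x ord0 i - x' ord0 i|)) /\
  (forall x, `|f (translate x psi)| <= C * (1 + enorm x) ^+ k).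
Proof.
move=> spsi; have /schwartzP[sm H] := spsi.
have [C [k [C0 HC]]] := td_boundP f.
have [B HB] := H k.+1; have B0 := seminorm_le_ge0 HB.
have [B' HB'] := H k; have B0' := seminorm_le_ge0 HB'.
exists (C * (B + B')), k; split; first by rewrite mulr_ge0// addr_ge0.
split=> [x x' xx'|x].
  rewrite -td_sub; [|exact: schwartz_translate..].
  apply: (le_trans (HC _ _ _ (seminorm_le_translateB sm HB xx'))).
    by apply: schwartz_lin; exact: schwartz_translate.
  rewrite mulrA ler_wpM2r ?mulr_ge0 ?one_enorm_pow_ge0 ?sumr_ge0//.
  by rewrite ler_wpM2l// lerDl.
apply: (le_trans (HC _ _ (schwartz_translate x spsi) (seminorm_le_translate x sm HB'))).
rewrite (mulrC _ B') mulrA ler_wpM2r ?one_enorm_pow_ge0//.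
by rewrite ler_wpM2l// lerDr.
Qed.

Lemma measurable_td_translate (R : realType) (n : nat) (f : tempered_distribution R n)
    (psi : 'rV[R]_n -> R) : schwartz psi ->
  measurable_fun setT (fun x => f (translate x psi)).
Proof.
move=> /(td_translate_lip f)[C [k [C0 [H _]]]].
apply: (@measurable_dominated_lipschitz _ _ _ (fun x => C * (1 + enorm x) ^+ k)).
by move=> x x' /H; rewrite mulrA.
Qed.

Lemma td_translate_mul_integrable (R : realType) (n : nat)
    (f : tempered_distribution R n) (psi w : 'rV[R]_n -> R) :
  schwartz psi -> schwartz w ->
  (@lebesgue_rV R n).-integrable setT (EFin \o (fun x => f (translate x psi) * w x)).
Proof.
move=> spsi sw; have [C [k [C0 [_ H]]]] := td_translate_lip f spsi.
apply: (@le_integrable_EFin _ _ R (@lebesgue_rV R n) _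
    (fun x => C * ((1 + enorm x) ^+ k * `|w x|))).
- apply: measurable_funM; last exact: schwartz_measurable.
  exact: measurable_td_translate.
- exact: (integrableZl measurableT _ (schwartz_weight_integrable k sw)).
by move=> x; rewrite normrM mulrA ler_wpM2r.
Qed.

(* Both sides are approximated by the finite sums obtained by rounding x in     *)
(* translate x psi: conv psi w is then near a finite linear combination of      *)
(* translates in a Schwartz norm, on which f acts termwise.                     *)
Lemma td_conv (R : realType) (n : nat) (f : tempered_distribution R n)
    (psi w : 'rV[R]_n -> R) : schwartz psi -> schwartz w ->
  f (conv psi w) = \int[@lebesgue_rV R n]_x (f (translate x psi) * w x).
Proof.
move=> spsi sw; have /schwartzP[sm H] := spsi.
have [C [k [C0 HC]]] := td_boundP f.
have [C' [k' [C0' [HC' _]]]] := td_translate_lip f spsi.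
have [B HB] := H k.+1; have B0 := seminorm_le_ge0 HB.
have iw : (@lebesgue_rV R n).-integrable setT (EFin \o w).
  apply: le_integrable_EFin (schwartz_integrable sw) _ => //.
  exact: schwartz_measurable.
pose J k N := \int[@lebesgue_rV R n]_x ((1 + enorm x) ^+ k *
      (\sum_(i < n) `|x ord0 i - round_rV N x ord0 i|) * `|w x|).
suff key N : `|f (conv psi w) - \int[@lebesgue_rV R n]_x (f (translate x psi) * w x)|
    <= C * B * J k N + C' * J k' N.
  apply/eqP; rewrite -subr_eq0 -normr_le0; apply/ler_addgt0Pr => e e0.
  have : (C * B * J k N + C' * J k' N) @[N --> \oo] --> (0 : R).
    rewrite [X in _ --> X](_ : _ = C * B * 0 + C' * 0); last first.
      by rewrite !mulr0 addr0.
    by apply: cvgD; apply: cvgMr; exact: round_weight_cvg.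
  move/cvgrPdist_le => /(_ e e0)[N _ HN].
  apply: (le_trans (key N)); rewrite add0r.
  apply: le_trans (HN N (leqnn _)).
  by rewrite sub0r normrN ler_norm.
have [I [q [F [mq rF]]]] := @round_rV_finite R n N.
pose c u := \int[@lebesgue_rV R n]_x (\1_(q @^-1` [set u]) x * w x).
have fin (G : 'rV[R]_n -> R) := Rintegral_finite_range (fun u => G (F u)) mq iw.
pose cN y := \sum_(u : I) c u * translate (F u) psi y.
have [scN fcN] := td_sum f (index_enum I) c (fun u => schwartz_translate (F u) spsi).
have scv := schwartz_conv spsi sw.
have [smv pv] := smooth_conv spsi sw.
have h1 : `|f (conv psi w) - f cN| <= C * B * J k N.
  rewrite -td_sub// -mulrA; apply: HC; first exact: schwartz_lin.
  move=> s y sk.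
  have [smN pN] := partials_sum (index_enum I) c s
    (fun u => (smooth_translate (F u) sm).1).
  have [_ ->] := smooth_lin (-1) smN smv.
  rewrite pv pN mulN1r (addrC (- _)) /conv.
  under eq_bigr do rewrite (smooth_translate _ sm).2 /translate.
  (* The finite sum becomes the convolution integral with x replaced by its rounding, so both sides
     can be compared under one integral. *)
  have [iN <-] := fin (fun z => partials s psi (y - z)).
  have mps := measurable_partials s spsi.
  have bps x : `|partials s psi x| <= B by apply: (seminorm_le_bound _ HB); exact: leqW.
  have i0 := conv_mul_integrable y mps bps sw.
  have [iJ _] := round_weight_integrable k N sw.
  rewrite -RintegralB// -[X in X * _]ger0_norm ?one_enorm_pow_ge0// -normrM.
  rewrite -!RintegralZl//; last exact: (integrableB measurableT i0 iN).
  apply: le_norm_Rintegral.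
  - apply: measurable_funM => //; apply: measurable_funB.
      exact: measurable_translate_mul.
    by apply/measurable_EFinP; exact: measurable_int iN.
  - exact: (integrableZl measurableT _ iJ).
  move=> x; rewrite -mulrBl !normrM (ger0_norm (one_enorm_pow_ge0 _ _)) !mulrA.
  rewrite ler_wpM2r// -rF -mulrA.
  apply: partials_translate_lip => // i; exact: round_rV_le.
have h2 : `|f cN - \int[@lebesgue_rV R n]_x (f (translate x psi) * w x)| <= C' * J k' N.
  rewrite fcN; have [iN <-] := fin (fun z => f (translate z psi)).
  have it := td_translate_mul_integrable f spsi sw.
  have [iJ _] := round_weight_integrable k' N sw.
  rewrite -RintegralB// -RintegralZl//; apply: le_norm_Rintegral.
  - by apply/measurable_EFinP; exact: measurable_int (integrableB measurableT iN it).
  - exact: (integrableZl measurableT _ iJ).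
  move=> x; rewrite -mulrBl normrM mulrA ler_wpM2r// -rF distrC.
  by apply: HC' => i; exact: round_rV_le.
rewrite -(subrK (f cN) (f (conv psi w))) -addrA (le_trans (ler_normD _ _))//.
exact: lerD.
Qed.

(** * Distributional convergence of the heat regularization *)

Definition gauss_poly (R : realType) (q p : {poly R}) (a : R) : R :=
  p.[a] * expR q.[a].

Lemma is_derive_gauss_poly (R : realType) (q p : {poly R}) (a : R) :
  is_derive a 1 (gauss_poly q p) (gauss_poly q (p^`() + p * q^`()) a).
Proof.
have e := is_derive1_comp (is_derive_expR q.[a]) (is_derive_poly q a).
have := is_deriveM (is_derive_poly p a) e.
rewrite (_ : _ *: _ + _ *: _ = gauss_poly q (p^`() + p * q^`()) a)//.
by rewrite /gauss_poly /GRing.scale/= hornerD hornerM; ring.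
Qed.

Lemma continuous_gauss_poly (R : realType) (q p : {poly R}) :
  continuous (gauss_poly q p).
Proof.
move=> a; apply/differentiable_continuous/derivable1_diffP.
by have [] := is_derive_gauss_poly q p a.
Qed.

(* A class of functions containing the Gaussians and closed under partial       *)
(* derivatives.                                                                 *)
Definition prod_gauss (R : realType) (n : nat) (q : {poly R}) (P : 'I_n -> {poly R})
    (x : 'rV[R]_n) : R := \prod_(i < n) gauss_poly q (P i) (x ord0 i).

Lemma continuous_prod_gauss (R : realType) (n : nat) (q : {poly R})
    (P : 'I_n -> {poly R}) : continuous (prod_gauss q P).
Proof.
move=> x; have FF : ProperFilter (nbhs (x : 'rV[R]_n)) := nbhs_pfilter _.
apply: (@cvg_big R^o _ _ _ _ mul_continuous) => i _.
apply: (@continuous_comp _ _ _ (fun x : 'rV[R]_n => x ord0 i) (gauss_poly q (P i))).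
  exact: coord_continuous.
exact: continuous_gauss_poly.
Qed.

Lemma is_partial_prod_gauss (R : realType) (n : nat) (q : {poly R})
    (P : 'I_n -> {poly R}) (i : 'I_n) :
  is_partial i (prod_gauss q P) (prod_gauss q
    (fun j => if j == i then (P j)^`() + P j * q^`() else P j)).
Proof.
apply: is_partialP => x.
pose c := \prod_(j < n | j != i) gauss_poly q (P j) (x ord0 j).
have E a : prod_gauss q P (a *: rV_basis R i + x) = c * gauss_poly q (P i) (a + x ord0 i).
  rewrite /prod_gauss (bigD1 i)//= mulrC; congr (_ * gauss_poly _ _ _).
    apply: eq_bigr => j /negbTE ji.
    by rewrite !mxE eqxx ji/= mulr0 add0r.
  by rewrite !mxE !eqxx mulr1.
under eq_fun do rewrite E.
rewrite /prod_gauss (bigD1 i)//= eqxx mulrC.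
rewrite (eq_bigr (fun j => gauss_poly q (P j) (x ord0 j))); last first.
  by move=> j /negbTE ->.
have s : is_derive (0 : R) 1 (fun a : R => a + x ord0 i) 1.
  rewrite -[X in is_derive _ _ _ X]addr0; apply: is_deriveD.
have g := is_derive_gauss_poly q (P i) (0 + x ord0 i).
have := @is_deriveZ _ _ _ (gauss_poly q (P i) \o (fun a : R => a + x ord0 i)) c 0 1 _
  (@is_derive1_comp R (gauss_poly q (P i)) (fun a => a + x ord0 i) 0 _ 1 g s).
by rewrite mulr1 add0r.
Qed.

(** With r = 1 + |a|, the inequality (|a| - 1)^2 >= 0 gives a^2 >= r^2/2 - 1, so exp(-c a^2) <=
    exp(c) exp(-y) where y = c r^2/2. The exponential series bounds exp(-y) y^{m+1} by (m+1)!, which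
    controls every power of r up to m. *)
Lemma gauss_poly_bound (R : realType) (c : R) (p : {poly R}) (k : nat) : 0 < c ->
  exists C, 0 <= C /\ forall a, (1 + `|a|) ^+ k * `|gauss_poly (- c *: 'X^2) p a| <= C.
Proof.
move=> c0; pose m := (k + size p)%N.
pose S : R := \sum_(i < size p) `|p`_i|.
have S0 : 0 <= S by exact: sumr_ge0.
pose F : R := (m.+1)`!%:R * (2 / c) ^+ m.+1.
have F0 : 0 <= F by rewrite mulr_ge0// exprn_ge0// divr_ge0// ltW.
exists (S * (expR c * F)); split; first by rewrite mulr_ge0// mulr_ge0 ?expR_ge0.
move=> a; set r := 1 + `|a|.
have r1 : 1 <= r by rewrite lerDl.
have r0 : 0 < r by exact: lt_le_trans r1.
have pS : `|p.[a]| <= S * r ^+ size p.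
  rewrite horner_coef (le_trans (ler_norm_sum _ _ _))// mulr_suml ler_sum// => i _.
  rewrite normrM ler_wpM2l// normrX (@le_trans _ _ (r ^+ i))//.
    by rewrite lerXn2r ?nnegrE ?(ltW r0)// lerDr.
  by rewrite ler_weXn2l// ltnW.
have eF : r ^+ m * expR (- c * a ^+ 2) <= expR c * F.
  pose y := c * r ^+ 2 / 2.
  have y0 : 0 < y by rewrite divr_gt0// mulr_gt0// exprn_gt0.
  have ey : expR (- c * a ^+ 2) <= expR c * expR (- y).
    rewrite -expRD ler_expR /y /r sqrrD expr1n mul1r -(real_normK (num_real a)).
    have := sqr_ge0 (`|a| - 1); rewrite sqrrB expr1n mulr1.
    by move: (`|a| ^+ 2) (`|a|) => u v; rewrite mulr2n; nra.
  have yF : expR (- y) * y ^+ m.+1 <= (m.+1)`!%:R.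
    rewrite expRN mulrC ler_pdivrMr ?expR_gt0// mulrC -ler_pdivrMr ?ltr0n ?fact_gt0//.
    by apply: le_trans (expR_ge1Dxn m (ltW y0)); rewrite lerDr.
  apply: (@le_trans _ _ (r ^+ m * (expR c * expR (- y)))).
    by rewrite ler_wpM2l// exprn_ge0// ltW.
  rewrite mulrCA ler_wpM2l ?expR_ge0//.
  apply: (@le_trans _ _ ((r ^+ 2) ^+ m.+1 * expR (- y))).
    rewrite ler_wpM2r ?expR_ge0// -exprM ler_weXn2l//.
    by rewrite mulnS mul2n -addnn addnA leq_addl.
  have -> : r ^+ 2 = 2 / c * y by rewrite /y; field; rewrite gt_eqF.
  rewrite exprMn /F [leRHS]mulrC -mulrA ler_wpM2l//.
    by rewrite exprn_ge0// divr_ge0// ltW.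
  by rewrite mulrC.
rewrite /gauss_poly normrM hornerZ hornerXn (ger0_norm (expR_ge0 _)).
apply: (@le_trans _ _ (S * (r ^+ m * expR (- c * a ^+ 2)))); last by rewrite ler_wpM2l.
rewrite mulrA [leRHS]mulrA ler_wpM2r ?expR_ge0// /m exprD mulrCA ler_wpM2l//.
by rewrite exprn_ge0// ltW.
Qed.

(** The Euclidean norm is at most the sum of the absolute coordinates. The weight is thereby
    majorized by a product of one-variable weights, matching [prod_gauss]. *)
Lemma one_enorm_le_prod (R : realType) (n : nat) (x : 'rV[R]_n) :
  1 + enorm x <= \prod_(i < n) (1 + `|x ord0 i|).
Proof.
suff : 1 + \sum_(i < n) `|x ord0 i| <= \prod_(i < n) (1 + `|x ord0 i|).
  apply: le_trans; rewrite lerD2l.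
  have s0 : 0 <= \sum_(i < n) `|x ord0 i| by exact: sumr_ge0.
  rewrite -(@ler_pXn2r _ 2)// ?nnegrE ?enorm_ge0// sqr_enorm expr2 mulr_suml.
  apply: ler_sum => i _; rewrite -(ger0_norm (sqr_ge0 _)) normrX expr2 ler_wpM2l//.
  by rewrite (bigD1 i)//= lerDl sumr_ge0.
apply: (@proj2 (0 <= \sum_(i < n) `|x ord0 i|)).
apply: (big_rec2 (fun y z => 0 <= y /\ 1 + y <= z)) => [|i y z _ [z0 yz]].
  by rewrite addr0.
split; first by rewrite addr_ge0.
have := normr_ge0 (x ord0 i); nra.
Qed.

Lemma schwartz_prod_gauss (R : realType) (n : nat) (c : R) (P : 'I_n -> {poly R}) :
  0 < c -> schwartz (prod_gauss (- c *: 'X^2) P).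
Proof.
move=> c0; pose q : {poly R} := - c *: 'X^2.
pose D i (Q : 'I_n -> {poly R}) j := if j == i then (Q j)^`() + Q j * q^`() else Q j.
pose fam (s : seq 'I_n) := foldr D P s.
have [sm ps] : smooth (prod_gauss q P) /\
    forall s, partials s (prod_gauss q P) = prod_gauss q (fam s).
  apply: (@smoothI _ _ (fun s => prod_gauss q (fam s))) => s.
    exact: continuous_prod_gauss.
  by move=> i; exact: is_partial_prod_gauss.
apply/schwartzP; split => // k.
have /choice[C HC] : forall s : seq 'I_n, exists C, forall x,
    (1 + enorm x) ^+ k * `|prod_gauss q (fam s) x| <= C.
  move=> s; have /choice[C HC] : forall i, exists C, 0 <= C /\
      forall a, (1 + `|a|) ^+ k * `|gauss_poly q (fam s i) a| <= C.
    by move=> i; exact: gauss_poly_bound.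
  exists (\prod_(i < n) C i) => x.
  apply: (@le_trans _ _ (\prod_(i < n) ((1 + `|x ord0 i|) ^+ k *
      `|gauss_poly q (fam s i) (x ord0 i)|))).
    rewrite big_split/= -normr_prod prodrXl ler_wpM2r//.
    rewrite lerXn2r ?nnegrE ?addr_ge0 ?enorm_ge0 ?prodr_ge0//.
    exact: one_enorm_le_prod.
  apply: ler_prod => i _; have [C0 HCi] := HC i.
  by rewrite HCi andbT mulr_ge0// exprn_ge0// addr_ge0.
have C0 s : 0 <= C s.
  by apply: le_trans (HC s 0); rewrite mulr_ge0// one_enorm_pow_ge0.
(* There are finitely many derivatives of order at most k; the sum of their nonnegative bounds
   serves for all of them. *)
exists (\sum_(m < k.+1) \sum_(t : m.-tuple 'I_n) C t) => s x sk.
rewrite ps (le_trans (HC s x))//.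
have sk' : (size s < k.+1)%N by [].
rewrite (bigD1 (Ordinal sk'))//= (bigD1 (in_tuple s))//= -addrA lerDl.
by rewrite addr_ge0 ?sumr_ge0// => m _; rewrite sumr_ge0.
Qed.

(** The trailing [+ 0] gives the shape a * g + h expected by [schwartz_lin]. *)
Lemma heat_kernel_prod_gauss (R : realType) (n : nat) (t : R) :
  @heat_kernel R n t = fun x => (4 * pi * t) `^ (- (n%:R / 2)) *
    prod_gauss (- (4 * t)^-1 *: 'X^2) (fun=> 1) x + 0.
Proof.
apply/funext => x; rewrite addr0 /heat_kernel; congr (_ * _).
rewrite sqr_enorm mulr_suml -sumrN expR_sum; apply: eq_bigr => i _.
by rewrite /gauss_poly hornerC mul1r hornerZ hornerXn mulrC mulNr.
Qed.

Lemma schwartz_heat_kernel (R : realType) (n : nat) (t : R) : 0 < t ->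
  schwartz (@heat_kernel R n t).
Proof.
move=> t0; rewrite heat_kernel_prod_gauss; apply: schwartz_lin.
  by apply: schwartz_prod_gauss; rewrite invr_gt0 mulr_gt0.
exact: schwartz0.
Qed.

Lemma convolution_heat_kernel (R : realType) (n : nat) (f : tempered_distribution R n)
    (t : R) (x : 'rV[R]_n) :
  convolution f (heat_kernel t) x = f (translate x (heat_kernel t)).
Proof.
by congr (f _); apply/funext => y; rewrite /translate heat_kernel_sym.
Qed.

Lemma conv_sym (R : realType) (n : nat) (psi w : 'rV[R]_n -> R) :
  schwartz psi -> schwartz w -> conv psi w = conv w psi.
Proof.
move=> spsi sw; apply/funext => y; rewrite /conv /Rintegral; congr fine.
have m := measurable_translate_mul y (schwartz_measurable sw) spsi.
rewrite -[RHS](integral_rV_reflect y m); apply: eq_integral => x _.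
by rewrite subKr mulrC.
Qed.

Lemma heat_kernel_double (R : realType) (n : nat) (t : R) (x : 'rV[R]_n) : 0 < t ->
  heat_kernel t x = 2 `^ (n%:R / 2) * expR (- (enorm x ^+ 2 / (8 * t))) *
    heat_kernel (2 * t) x.
Proof.
move=> t0; rewrite /heat_kernel.
have p0 : 0 < 4 * pi * t :> R by rewrite !mulr_gt0// pi_gt0.
have -> : 4 * pi * (2 * t) = 2 * (4 * pi * t) :> R by ring.
rewrite [X in _ = _ * (X * _)]powRM ?(ltW p0)// !powRN.
have -> : expR (- (enorm x ^+ 2 / (4 * t))) =
    expR (- (enorm x ^+ 2 / (8 * t))) * expR (- (enorm x ^+ 2 / (4 * (2 * t)))).
  by rewrite -expRD; congr expR; field; rewrite gt_eqF.
have : 2 `^ (n%:R / 2) != 0 :> R by rewrite gt_eqF// powR_gt0.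
have : (4 * pi * t) `^ (n%:R / 2) != 0 by rewrite gt_eqF// powR_gt0.
set a := 2 `^ _; set b := (4 * pi * t) `^ _; move=> b0 a0.
by field; rewrite b0.
Qed.

(* With r = enorm x / sqrt t, half of the Gaussian exponent absorbs every power *)
(* of 1 + r; the other half is the heat kernel at time 2t.                      *)
Lemma heat_kernel_moment (R : realType) (n k : nat) : exists (K : R), 0 <= K /\
  forall (t : R) (x : 'rV[R]_n), 0 < t <= 1 ->
    (1 + enorm x) ^+ k * (\sum_(i < n) `|x ord0 i|) * heat_kernel t x <=
    K * Num.sqrt t * heat_kernel (2 * t) x.
Proof.
have c0 : 0 < 8^-1 :> R by rewrite invr_gt0.
have [M [M0 HM]] := gauss_poly_bound 1 k.+1 c0.
exists (n%:R * M * 2 `^ (n%:R / 2)); split; first by rewrite !mulr_ge0 ?powR_ge0.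
move=> t x /andP[t0 t1].
have s0 : 0 < Num.sqrt t by rewrite sqrtr_gt0.
have s1 : Num.sqrt t <= 1 by rewrite -sqrtr1 ler_sqrt.
rewrite (heat_kernel_double x t0) [in leLHS]mulrA ler_wpM2r ?heat_kernel_ge0//.
have [r [r0 er]] : exists r, 0 <= r /\ enorm x = Num.sqrt t * r.
  exists (enorm x / Num.sqrt t); rewrite divr_ge0 ?enorm_ge0 ?ltW//.
  by rewrite mulrC divfK// gt_eqF.
have xr : enorm x <= r by rewrite er ler_piMl.
have := HM r; rewrite ger0_norm// /gauss_poly hornerC mul1r hornerZ hornerXn.
rewrite (ger0_norm (expR_ge0 _)).
have -> : - 8^-1 * r ^+ 2 = - (enorm x ^+ 2 / (8 * t)).
  rewrite er exprMn sqr_sqrtr ?ltW//; field.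
  by rewrite gt_eqF.
set e := expR _ => hM.
have sx : \sum_(i < n) `|x ord0 i| <= n%:R * enorm x.
  apply: (@le_trans _ _ (\sum_(i < n) enorm x)).
    by apply: ler_sum => i _; exact: coord_le_enorm.
  by rewrite sumr_const card_ord mulr_natl.
have e0 : 0 <= e by exact: expR_ge0.
apply: (@le_trans _ _ ((1 + r) ^+ k * (n%:R * (Num.sqrt t * (1 + r))) *
    (2 `^ (n%:R / 2) * e))).
  rewrite ler_wpM2r ?mulr_ge0 ?powR_ge0//.
  rewrite ler_pM ?one_enorm_pow_ge0 ?sumr_ge0//.
    by rewrite lerXn2r ?nnegrE ?addr_ge0 ?enorm_ge0// lerD2l.
  by rewrite (le_trans sx)// ler_wpM2l// er ler_wpM2l ?(ltW s0)// lerDr.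
have -> : (1 + r) ^+ k * (n%:R * (Num.sqrt t * (1 + r))) * (2 `^ (n%:R / 2) * e) =
   n%:R * 2 `^ (n%:R / 2) * Num.sqrt t * ((1 + r) ^+ k.+1 * e).
  by rewrite exprSr; ring.
have -> : n%:R * M * 2 `^ (n%:R / 2) * Num.sqrt t = n%:R * 2 `^ (n%:R / 2) * Num.sqrt t * M.
  by ring.
by rewrite ler_wpM2l// !mulr_ge0 ?powR_ge0// ltW.
Qed.

Lemma integral_heat_kernel0 (R : realType) (n : nat) (t : R) : 0 < t ->
  (\int[@lebesgue_rV R n]_x (heat_kernel t x)%:E = 1)%E.
Proof.
move=> t0; rewrite -(integral_heat_kernel (0 : 'rV[R]_n) t0).
by apply: eq_integral => x _; rewrite subr0.
Qed.

(** The pairing of f * Phi_t with phi is the Phi_t-average over x of f applied to the translate of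
    phi by x. As Phi_t has mass 1, the error is the average of a difference that vanishes at x = 0
    and is Lipschitz with polynomial weight; the weighted first moment of Phi_t is O(sqrt t). *)
Lemma td_heat_limit (R : realType) (n : nat) (f : tempered_distribution R n)
    (phi : 'rV[R]_n -> R) : schwartz phi ->
  exists K : R, 0 <= K /\ forall t, 0 < t <= 1 ->
    `|\int[@lebesgue_rV R n]_x (convolution f (heat_kernel t) x * phi x) - f phi|
    <= K * Num.sqrt t.
Proof.
move=> sphi; have [C [k [C0 [HC _]]]] := td_translate_lip f sphi.
have [K [K0 HK]] := heat_kernel_moment R n k.
exists (C * K); split; first by rewrite mulr_ge0.
move=> t /andP[t0 t1].
have sh := @schwartz_heat_kernel R n t t0.
(* Both integrals are f evaluated at the convolution of phi with the heat kernel, by [td_conv] in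
   either order. *)
have -> : \int[@lebesgue_rV R n]_x (convolution f (heat_kernel t) x * phi x) =
    \int[@lebesgue_rV R n]_x (f (translate x phi) * heat_kernel t x).
  rewrite -(td_conv f sphi sh) (conv_sym sphi sh) (td_conv f sh sphi).
  by apply: eq_Rintegral => x _; rewrite convolution_heat_kernel.
have int s : 0 < s -> (@lebesgue_rV R n).-integrable setT (EFin \o heat_kernel s).
  move=> s0; apply/integrableP; split.
    by apply/measurable_EFinP; exact: measurable_heat_kernel.
  under eq_integral do rewrite /= ger0_norm ?heat_kernel_ge0//.
  by rewrite integral_heat_kernel0// ltry.
have int1 s : 0 < s -> \int[@lebesgue_rV R n]_x heat_kernel s x = 1.
  by move=> s0; rewrite /Rintegral integral_heat_kernel0.
have -> : f phi = \int[@lebesgue_rV R n]_x (f phi * heat_kernel t x).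
  by rewrite RintegralZl ?int1 ?mulr1//; exact: int.
have i1 := td_translate_mul_integrable f sphi sh.
have i2 : (@lebesgue_rV R n).-integrable setT (EFin \o (fun x => f phi * heat_kernel t x)).
  exact: (integrableZl measurableT (f phi) (int _ t0)).
have t20 : 0 < 2 * t by rewrite mulr_gt0.
(* The factor 1 is written as the mass of the heat kernel at time 2t, so that the bound of
   [heat_kernel_moment] can be integrated pointwise. *)
rewrite -RintegralB// -[X in _ <= X]mulr1 -(int1 _ t20) -RintegralZl//; last exact: int.
apply: le_norm_Rintegral.
- by apply/measurable_EFinP; exact: measurable_int (integrableB measurableT i1 i2).
- exact: (integrableZl measurableT _ (int _ t20)).
move=> x; rewrite -mulrBl normrM (ger0_norm (heat_kernel_ge0 _ _)).
have h0 : phi = translate 0 phi by apply/funext => y; rewrite /translate subr0.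
rewrite {2}h0; apply: (@le_trans _ _ (C * ((1 + enorm x) ^+ k *
    \sum_(i < n) `|x ord0 i|) * heat_kernel t x)).
  rewrite ler_wpM2r ?heat_kernel_ge0//; have := HC x 0.
  under eq_bigr do rewrite mxE subr0.
  by apply => i; rewrite mxE normr0.
rewrite -!mulrA ler_wpM2l// mulrA [leRHS]mulrA; apply: HK.
by rewrite t0.
Qed.

(** * Representation by an L^p function *)

Lemma LnormE d (T : measurableType d) (R : realType) (mu : {measure set T -> \bar R})
    (p : R) (h : T -> R) :
  ('N[mu]_p%:E[EFin \o h] = pow_integral mu p h `^ p^-1)%E.
Proof.
by rewrite unlock.
Qed.

Lemma pow_integral_Lnorm d (T : measurableType d) (R : realType)
    (mu : {measure set T -> \bar R}) (p : R) (h : T -> R) : 0 < p ->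
  ('N[mu]_p%:E[EFin \o h] `^ p = pow_integral mu p h)%E.
Proof.
move=> p0; rewrite LnormE -poweRrM mulVf ?gt_eqF// poweRe1//.
exact: pow_integral_ge0.
Qed.

Lemma LpP (R : realType) (n : nat) (p : R) (h : 'rV[R]_n -> R) : 0 < p ->
  Lp p h <-> measurable_fun setT h /\ (pow_integral (@lebesgue_rV R n) p h < +oo)%E.
Proof.
move=> p0; rewrite -(pow_integral_Lnorm _ h p0); split.
  move=> /andP[mh Nh]; split; first by move: mh; rewrite inE.
  by apply: poweR_lty; move: Nh; rewrite inE.
move=> [mh Nh]; apply/andP; split; rewrite inE//=.
by rewrite /finite_norm (lty_poweRy _ Nh)// gt_eqF.
Qed.

Lemma pow_integral_mid_lty d (T : measurableType d) (R : realType)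
    (mu : {measure set T -> \bar R}) (p : R) (a b : T -> R) : 0 < p ->
  measurable_fun setT a -> measurable_fun setT b ->
  (pow_integral mu p a < +oo)%E -> (pow_integral mu p b < +oo)%E ->
  (pow_integral mu p (fun x => (a x + b x) / 2)%R < +oo)%E.
Proof.
move=> p0 ma mb pa pb.
apply: (@le_lt_trans _ _ (pow_integral mu p a + pow_integral mu p b)%E); last first.
  by rewrite lte_add_pinfty.
have m1 (h : T -> R) : measurable_fun setT h ->
    measurable_fun setT (fun x => (`|h x| `^ p)%:E).
  by move=> mh; apply/measurable_EFinP/measurable_norm_powR.
rewrite /pow_integral -ge0_integralD//; [|exact: m1|exact: m1].
apply: ge0_le_integral => //.
- by apply: m1; apply: measurable_funM => //; exact: measurable_funD.
- by apply: emeasurable_funD; exact: m1.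
move=> x _; rewrite -EFinD lee_fin.
have h : `|(a x + b x) / 2| <= Num.max `|a x| `|b x|.
  rewrite normf_div (ger0_norm (ler0n _ 2)) ler_pdivrMr//.
  apply: (le_trans (ler_normD _ _)); rewrite mulr_natr mulr2n.
  by rewrite lerD// le_max lexx ?orbT.
apply: (@le_trans _ _ (Num.max `|a x| `|b x| `^ p)).
  by rewrite ge0_ler_powR ?nnegrE ?(ltW p0)// le_max normr_ge0.
by rewrite maxEle; case: ifPn => _; rewrite ?lerDl ?lerDr powR_ge0.
Qed.

Lemma conjugate_exponentP (R : realType) (p : R) : 1 < p ->
  p^-1 + (conjugate_exponent p)^-1 = 1 /\ 1 < conjugate_exponent p.
Proof.
move=> p1; have p0 : 0 < p by lra.
rewrite /conjugate_exponent invrK; split; first by ring.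
have ip : p^-1 < 1 by rewrite invf_lt1.
have ip0 : 0 < p^-1 by rewrite invr_gt0.
by rewrite -[ltLHS]invr1 ltf_pV2 ?posrE; lra.
Qed.

Lemma hoelder_integrable d (T : measurableType d) (R : realType)
    (mu : {measure set T -> \bar R}) (p q : R) (a b : T -> R) :
  0 < p -> 0 < q -> p^-1 + q^-1 = 1 ->
  measurable_fun setT a -> measurable_fun setT b ->
  (pow_integral mu p a < +oo)%E -> (pow_integral mu q b < +oo)%E ->
  mu.-integrable setT (EFin \o (fun x => a x * b x)) /\
  (`|\int[mu]_x (a x * b x)|%:E <=
    'N[mu]_p%:E[EFin \o a] * 'N[mu]_q%:E[EFin \o b])%E.
Proof.
move=> p0 q0 pq ma mb pa qb.
have H := hoelder mu ma mb p0 q0 pq; rewrite Lnorm1 in H.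
have fin : ('N[mu]_p%:E[EFin \o a] * 'N[mu]_q%:E[EFin \o b] < +oo)%E.
  by rewrite !LnormE lte_mul_pinfty ?poweR_ge0 ?ge0_fin_numE ?poweR_ge0 ?poweR_lty.
have iab : mu.-integrable setT (EFin \o (fun x => a x * b x)).
  apply/integrableP; split; last exact: le_lt_trans H fin.
  by apply/measurable_EFinP; exact: measurable_funM.
split => //; rewrite EFin_normr_Rintegral//; apply: le_trans H.
by apply: le_abse_integral => //; exact: measurable_int iab.
Qed.

(** A bounded integrable function is in L^q: |phi|^q <= B^{q-1} |phi|. *)
Lemma schwartz_pow_integral_lty (R : realType) (n : nat) (q : R) (phi : 'rV[R]_n -> R) :
  1 < q -> schwartz phi -> (pow_integral (@lebesgue_rV R n) q phi < +oo)%E.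
Proof.
move=> q1 sphi; have /schwartzP[_ /(_ 0%N)[B HB]] := sphi.
have B0 := seminorm_le_ge0 HB.
have bphi x : `|phi x| <= B by exact: (@seminorm_le_bound _ _ 0 _ _ [::] x HB).
have i1 := integrableZl measurableT (B `^ (q - 1)) (schwartz_integrable sphi).
have mphi := schwartz_measurable sphi.
apply: (@le_lt_trans _ _ (\int[@lebesgue_rV R n]_x (B `^ (q - 1) * `|phi x|)%:E)%E).
  apply: ge0_le_integral => //.
  - exact/measurable_EFinP/measurable_norm_powR.
  - exact: measurable_int i1.
  move=> x _; rewrite lee_fin -mulr_powRB1//; last lra.
  rewrite mulrC ler_wpM2r//.
  by rewrite ge0_ler_powR ?nnegrE//; lra.
exact: (integrable_lty measurableT i1).
Qed.

(** The minimizing limit h is an L^p limit of elements of C m for each m. Such an element pairs with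
    phi to within the error of the g k with k >= m, and Hoelder's inequality transfers the pairing
    to h. *)
Lemma td_weak_limit (R : realType) (n : nat) (p M : R) (f : tempered_distribution R n)
    (g : nat -> 'rV[R]_n -> R) : 1 < p ->
  (forall k, measurable_fun setT (g k)) ->
  (forall k, (pow_integral (@lebesgue_rV R n) p (g k) <= (M + k.+1%:R^-1)%:E)%E) ->
  (forall phi (e : R), schwartz phi -> 0 < e -> exists m, forall k, (m <= k)%N ->
    `|\int[@lebesgue_rV R n]_x (g k x * phi x) - f phi| <= e) ->
  exists h, [/\ measurable_fun setT h,
    (pow_integral (@lebesgue_rV R n) p h <= M%:E)%E & represents h f].
Proof.
move=> p1 mg gM gf; have p0 : 0 < p by lra.
pose q := conjugate_exponent p.
have [pq q1] := conjugate_exponentP p1; rewrite -/q in pq q1.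
have q0 : 0 < q by lra.
pose D (a phi : 'rV[R]_n -> R) : R := `|\int[@lebesgue_rV R n]_x (a x * phi x) - f phi|.
(* C m stands in for the weak closure of the convex hull of {g k | k >= m}.     *)
pose C m : set ('rV[R]_n -> R) := [set a | [/\ measurable_fun setT a,
  (pow_integral (@lebesgue_rV R n) p a < +oo)%E & forall phi e, schwartz phi ->
    (forall k, (m <= k)%N -> D (g k) phi <= e) -> D a phi <= e]].
have int a phi : measurable_fun setT a -> schwartz phi ->
    (pow_integral (@lebesgue_rV R n) p a < +oo)%E ->
    (@lebesgue_rV R n).-integrable setT (EFin \o (fun x => a x * phi x)).
  move=> ma sphi pa; have mphi := schwartz_measurable sphi.
  have sq := schwartz_pow_integral_lty q1 sphi.
  by have [] := hoelder_integrable p0 q0 pq ma mphi pa sq.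
have mid m a b : C m a -> C m b -> C m (fun x => (a x + b x) / 2).
  move=> [ma pa Ha] [mb pb Hb].
  have mab : measurable_fun setT (fun x => (a x + b x) / 2).
    by apply: measurable_funM => //; exact: measurable_funD.
  have pab : (pow_integral (@lebesgue_rV R n) p (fun x => (a x + b x) / 2)%R < +oo)%E.
    exact: pow_integral_mid_lty.
  split => // phi e sphi He.
  have i1 := int _ _ ma sphi pa; have i2 := int _ _ mb sphi pb.
  have := Ha _ _ sphi He; have := Hb _ _ sphi He; rewrite /D.
  have -> : \int[@lebesgue_rV R n]_x ((a x + b x) / 2 * phi x) =
      2^-1 * (\int[@lebesgue_rV R n]_x (a x * phi x) +
        \int[@lebesgue_rV R n]_x (b x * phi x)).
    rewrite -RintegralD// -RintegralZl//.
      by apply: eq_Rintegral => x _; ring.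
    exact: (integrableD measurableT i1 i2).
  by rewrite !ler_norml; lra.
(* The explicit terms prove that C decreases, since a bound for all k >= m covers all k >= m + 1,
   and that g m belongs to C m. *)
have [h [mh hM hC]] := @Lp_minimizing_limit _ _ _ (@lebesgue_rV R n) p M C p1
  (fun m a Ca => let: And3 ma _ _ := Ca in ma)
  (fun m a Ca => let: And3 ma pa Ha := Ca in
     And3 ma pa (fun phi e sphi He => Ha phi e sphi (fun k mk => He k (ltnW mk))))
  mid
  (fun m => ex_intro2 _ _ (g m) (And3 (mg m) (le_lt_trans (gM m) (ltry _))
     (fun phi e sphi He => He m (leqnn m))) (gM m)).
exists h; split => // phi sphi.
have ph : (pow_integral (@lebesgue_rV R n) p h < +oo)%E by exact: le_lt_trans hM (ltry _).
have ih := int _ _ mh sphi ph.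
rewrite -(EFin_Rintegral ih); congr EFin; apply/esym/eqP.
rewrite -subr_eq0 -normr_le0; apply/ler_addgt0Pr => e e0; rewrite add0r.
have e20 : 0 < e / 2 by rewrite divr_gt0.
have [m Hm] := gf phi _ sphi e20.
have sq := schwartz_pow_integral_lty q1 sphi.
pose Nq := fine ('N[@lebesgue_rV R n]_q%:E[EFin \o phi])%E.
have NqE : ('N[@lebesgue_rV R n]_q%:E[EFin \o phi] = Nq%:E)%E.
  by rewrite fineK// ge0_fin_numE ?Lnorm_ge0// LnormE poweR_lty.
have Nq0 : 0 <= Nq by rewrite fine_ge0// Lnorm_ge0.
(* An L^p distance d times the L^q norm Nq is at most e/2; the added 1 covers Nq = 0. *)
pose d := e / 2 / (Nq + 1).
have d0 : 0 < d by rewrite divr_gt0// ltr_wpDl.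
have [a [ma pa Ha] hda] := hC m _ (powR_gt0 p d0).
have mha : measurable_fun setT (fun x => h x - a x) by exact: measurable_funB.
have pha := le_lt_trans hda (ltry _).
have [iha Hha] := hoelder_integrable p0 q0 pq mha (schwartz_measurable sphi) pha sq.
have ia := int _ _ ma sphi pa.
have h1 : `|\int[@lebesgue_rV R n]_x (h x * phi x) -
    \int[@lebesgue_rV R n]_x (a x * phi x)| <= e / 2.
  rewrite -RintegralB//.
  have -> : \int[@lebesgue_rV R n]_x (h x * phi x - a x * phi x) =
      \int[@lebesgue_rV R n]_x ((h x - a x) * phi x).
    by apply: eq_Rintegral => x _; rewrite mulrBl.
  rewrite -lee_fin; apply: (le_trans Hha); rewrite NqE.
  apply: (@le_trans _ _ (d%:E * Nq%:E)%E).
    rewrite lee_wpmul2r ?lee_fin// LnormE.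
    have -> : (d%:E = (d `^ p)%:E `^ p^-1)%E.
      by rewrite poweR_EFin -powRrM mulfV ?gt_eqF// powRr1// ltW.
    by rewrite gt0_ler_poweR ?invr_ge0 ?(ltW p0)// in_itv/= ?andbT ?leey
      ?pow_integral_ge0 ?lee_fin ?powR_ge0.
  rewrite -EFinM lee_fin /d -(mulrA (e / 2)) ler_piMr ?(ltW e20)//.
  by rewrite mulrC ler_pdivrMr ?mul1r ?lerDl// ltr_wpDl.
have h2 := Ha _ _ sphi Hm; rewrite /D in h2.
by move: h1 h2; rewrite !ler_norml; lra.
Qed.

(** * The energy of the heat regularization *)

(* Holds without measurability because the integral of a nonnegative function   *)
(* is a supremum over simple functions below it; it makes the measurability of  *)
(* t |-> ||f * Phi_t||_p unnecessary.                                           *)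
Lemma ge0_le_integral_nonmeasurable d (T : measurableType d) (R : realType)
    (mu : {measure set T -> \bar R}) (D : set T) (f g : T -> \bar R) :
  (forall x, D x -> (0 <= f x)%E) -> (forall x, D x -> (f x <= g x)%E) ->
  (\int[mu]_(x in D) f x <= \int[mu]_(x in D) g x)%E.
Proof.
move=> f0 fg.
have g0 x : D x -> (0 <= g x)%E by move=> Dx; exact: le_trans (f0 x Dx) (fg x Dx).
rewrite !ge0_integralE//; apply: le_ereal_sup => _ [h hf <-]; exists h => // x.
apply: (le_trans (hf x)); rewrite !patchE; case: ifPn => // xD.
by apply: fg; exact: set_mem.
Qed.

Lemma integral_powR_itv_cc (R : realType) (a x y : R) : 0 < a -> 0 < x -> x < y ->
  (\int[@lebesgue_measure R]_(t in `[x, y]) (t `^ (a - 1))%:E =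
    ((y `^ a - x `^ a) / a)%:E)%E.
Proof.
move=> a0 x0 xy.
have dF (t : R) : 0 < t -> is_derive t 1 (fun t => t `^ a / a) (t `^ (a - 1)).
  move=> t0; have := @is_deriveZ _ _ _ (@powR R ^~ a) a^-1 t 1 _ (@is_derive1_powR R a t t0).
  rewrite [_ *: _](_ : _ = t `^ (a - 1)); last first.
    by rewrite /GRing.scale/= mulrA mulVf ?mul1r// gt_eqF.
  by rewrite [_ \*: _](_ : _ = (fun t => t `^ a / a))//; apply/funext => u /=; rewrite mulrC.
have cpow (b t : R) : 0 < t -> {for t, continuous (fun t : R => t `^ b)}.
  move=> t0; apply/differentiable_continuous/derivable1_diffP/derivable_powR.
  by rewrite in_itv/= andbT.
have cF (t : R) : 0 < t -> {for t, continuous (fun t : R => t `^ a / a)}.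
  by move=> t0; apply/differentiable_continuous/derivable1_diffP; have [] := dF t t0.
rewrite (@continuous_FTC2 _ _ (fun t => t `^ a / a))//.
- by rewrite -EFinB mulrBl.
- apply: continuous_in_subspaceT => t; rewrite inE/= in_itv/= => /andP[xt _].
  by apply: cpow; exact: lt_le_trans xt.
- split.
  + move=> t; rewrite in_itv/= => /andP[xt _].
    by have [] := dF t (lt_trans x0 xt).
  + by apply: cvg_at_right_filter; exact: cF.
  + by apply: cvg_at_left_filter; apply: cF; exact: lt_trans xy.
- move=> t; rewrite in_itv/= => /andP[xt _].
  by rewrite derive1E; have [_ ->] := dF t (lt_trans x0 xt).
Qed.

Lemma integral_powR_itv (R : realType) (a y : R) : 0 < a -> 0 < y ->
  (\int[@lebesgue_measure R]_(t in `]0%R, y[) (t `^ (a - 1))%:E = (y `^ a / a)%:E)%E.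
Proof.
move=> a0 y0.
have mp (D : set (measurableTypeR R)) :
    measurable_fun D (fun t : measurableTypeR R => (t `^ (a - 1))%:E).
  apply/measurable_EFinP; apply: measurable_funTS; exact: measurable_powR.
rewrite -(@integral_itv_bndoo _ _ _ _ false false)//; last exact: mp.
(* The singularity at 0 is approached by monotone convergence over [z k, y]; the shift by 2 keeps z
   k strictly below y. *)
pose z k : R := y / k.+2%:R.
have z0 k : 0 < z k by rewrite divr_gt0.
have zy k : z k < y by rewrite ltr_pdivrMr ?ltr0n// ltr_pMr// ltr1n.
have -> : `]0, y]%classic = \bigcup_k `[z k, y]%classic.
  apply/seteqP; split => [t|t [k _]] /=; rewrite !in_itv/= => /andP[h1 h2].
    exists (Num.truncn (y / t)) => //=; rewrite in_itv/= h2 andbT.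
    rewrite ler_pdivrMr ?ltr0n// mulrC -ler_pdivrMr//.
    apply: (le_trans (ltW (truncnS_gt _))).
    by rewrite ler_nat.
  by rewrite h2 andbT (lt_le_trans (z0 k)).
have := @ge0_nondecreasing_set_cvg_integral _ (measurableTypeR R) R
  (fun k => `[z k, y]%classic) (fun t => (t `^ (a - 1))%:E) (@lebesgue_measure R).
have zd : {homo (fun k => `[z k, y]%classic) : n m / (n <= m)%N >-> (n <= m)%O}.
  move=> k l kl; apply/subsetPset => t /=; rewrite !in_itv/= => /andP[h ->].
  rewrite andbT; apply: le_trans h; rewrite ler_pM2l//.
  by rewrite lef_pV2 ?posrE ?ltr0n// ler_nat.
move=> /(_ zd (fun k => measurable_itv _) (fun k => mp _)).
move=> /(_ (fun k t _ => powR_ge0 _ _)) h.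
apply: (cvg_unique _ h) => //=.
under eq_fun do rewrite integral_powR_itv_cc//.
apply: cvg_EFin; first exact: nearW.
rewrite [X in _ --> X](_ : _ = (y `^ a - 0) / a); last by rewrite subr0.
apply: cvgMl; apply: cvgB; first exact: cvg_cst.
have c0 := @norm_powR_continuous R a a0 0.
rewrite /continuous_at normr0 powR0 ?gt_eqF// in c0.
have zc : z @ \oo --> (0 : R).
  rewrite [X in _ --> X](_ : _ = y * 0); last by rewrite mulr0.
  by apply: cvgMr; rewrite (cvg_shiftS (@harmonic R)); exact: cvg_harmonic.
have := cvg_comp _ _ zc c0; apply: cvg_trans; apply: near_eq_cvg.
by apply: nearW => k /=; rewrite ger0_norm// ltW.
Qed.

Lemma represents_convolution (R : realType) (n : nat) (f : tempered_distribution R n)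
    (g : 'rV[R]_n -> R) (t : R) (x : 'rV[R]_n) : represents g f -> 0 < t ->
  (convolution f (heat_kernel t) x)%:E =
    (\int[@lebesgue_rV R n]_y (g y * heat_kernel t (y - x)%R)%:E)%E.
Proof.
move=> gf t0; rewrite convolution_heat_kernel gf//.
by apply: schwartz_translate; exact: schwartz_heat_kernel.
Qed.

Lemma measurable_convolution_heat (R : realType) (n : nat)
    (f : tempered_distribution R n) (t : R) : 0 < t ->
  measurable_fun setT (convolution f (heat_kernel t)).
Proof.
move=> t0; have := measurable_td_translate f (@schwartz_heat_kernel R n t t0).
by under eq_fun do rewrite -convolution_heat_kernel.
Qed.

(** Jensen's inequality for the probability density given by the heat kernel centred at x. *)
Lemma convolution_pow_le (R : realType) (n : nat) (p : R) (f : tempered_distribution R n)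
    (g : 'rV[R]_n -> R) (t : R) (x : 'rV[R]_n) : 1 < p -> measurable_fun setT g ->
  represents g f -> 0 < t ->
  ((`|convolution f (heat_kernel t) x| `^ p)%:E <=
    \int[@lebesgue_rV R n]_y (`|g y| `^ p * heat_kernel t (y - x)%R)%:E)%E.
Proof.
move=> p1 mg gf t0; have p0 : 0 < p by lra.
pose q := conjugate_exponent p.
have [pq q1] := conjugate_exponentP p1; rewrite -/q in pq q1.
have q0 : 0 < q by lra.
pose K (y : 'rV[R]_n) := heat_kernel t (y - x).
have K0 y : 0 <= K y by exact: heat_kernel_ge0.
have mK : measurable_fun setT K.
  by apply: schwartz_measurable; apply: schwartz_translate; exact: schwartz_heat_kernel.
have mKr r : measurable_fun setT (fun y => K y `^ r).
  exact: (measurableT_comp (measurable_powR r)).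
pose a y := g y * K y `^ p^-1.
pose b y := K y `^ q^-1.
have ab y : a y * b y = g y * K y.
  by rewrite /a /b -mulrA -powRD ?pq ?oner_eq0// powRr1.
have ma : measurable_fun setT a by apply: measurable_funM => //; exact: mKr.
(* Hoelder for g K = (g K^{1/p}) K^{1/q}, the kernel K having mass 1. *)
have H := hoelder (@lebesgue_rV R n) ma (mKr q^-1) p0 q0 pq.
have Nb : ('N[@lebesgue_rV R n]_q%:E[EFin \o b] = 1)%E.
  rewrite LnormE [X in (X `^ _)%E](_ : _ = 1%E) ?poweR1r//.
  rewrite -(integral_heat_kernel x t0); apply: eq_integral => y _.
  by rewrite ger0_norm ?powR_ge0// /b -powRrM mulVf ?gt_eqF// powRr1.
have Na : (pow_integral (@lebesgue_rV R n) p a =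
    \int[@lebesgue_rV R n]_y (`|g y| `^ p * heat_kernel t (y - x)%R)%:E)%E.
  apply: eq_integral => y _; rewrite /a normrM powRM// (ger0_norm (powR_ge0 _ _)).
  by rewrite -powRrM mulVf ?gt_eqF// powRr1.
rewrite -Na -(pow_integral_Lnorm _ _ p0) -poweR_EFin.
rewrite gt0_ler_poweR ?(ltW p0)//.
- by rewrite in_itv/= leey lee_fin normr_ge0.
- by rewrite in_itv/= leey Lnorm_ge0.
rewrite Nb mule1 Lnorm1 in H; apply: le_trans H.
rewrite -abse_EFin (represents_convolution x gf t0).
have e : (\int[@lebesgue_rV R n]_y (g y * heat_kernel t (y - x)%R)%:E =
    \int[@lebesgue_rV R n]_y (a y * b y)%:E)%E by apply: eq_integral => y _; rewrite ab.
rewrite e; apply: le_abse_integral => //; apply/measurable_EFinP; apply: measurable_funM => //.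
exact: mKr.
Qed.

(** Integrate the pointwise bound over x and exchange the integrals by Tonelli; the kernel has mass
    1 in x too, by symmetry. *)
Lemma pow_integral_convolution_le (R : realType) (n : nat) (p : R)
    (f : tempered_distribution R n) (g : 'rV[R]_n -> R) (t : R) :
  1 < p -> measurable_fun setT g -> represents g f -> 0 < t ->
  (pow_integral (@lebesgue_rV R n) p (convolution f (heat_kernel t)) <=
   pow_integral (@lebesgue_rV R n) p g)%E.
Proof.
move=> p1 mg gf t0.
pose k (z : 'rV[R]_n * 'rV[R]_n) := (`|g z.2| `^ p * heat_kernel t (z.2 - z.1)%R)%:E.
have msub : measurable_fun setT (fun z : 'rV[R]_n * 'rV[R]_n => z.2 - z.1).
  apply: measurable_fun_coordP => i; under eq_fun do rewrite !mxE.
  apply: measurable_funB.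
    exact: (measurableT_comp (measurable_coord i) measurable_snd).
  exact: (measurableT_comp (measurable_coord i) measurable_fst).
have mk : measurable_fun setT k.
  apply/measurable_EFinP; apply: measurable_funM.
    exact: (measurableT_comp (measurable_norm_powR p mg) measurable_snd).
  exact: (measurableT_comp (@measurable_heat_kernel R n t) msub).
have k0 z : (0 <= k z)%E by rewrite lee_fin mulr_ge0 ?powR_ge0 ?heat_kernel_ge0.
apply: (@le_trans _ _ (\int[@lebesgue_rV R n]_x \int[@lebesgue_rV R n]_y k (x, y))%E).
  apply: ge0_le_integral_nonmeasurable => [x _|x _].
    by rewrite lee_fin powR_ge0.
  exact: convolution_pow_le.
rewrite (fubini_tonelli k mk k0); apply: ge0_le_integral_nonmeasurable => [y _|y _].
  by apply: integral_ge0 => x _; exact: k0.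
rewrite /k/=; under eq_integral do rewrite EFinM.
rewrite ge0_integralZl_EFin ?powR_ge0//.
- under eq_integral do rewrite heat_kernel_sym.
  by rewrite integral_heat_kernel// mule1.
- by move=> x _; rewrite lee_fin heat_kernel_ge0.
- apply/measurable_EFinP; apply: (measurableT_comp (@measurable_heat_kernel R n t)).
  exact: measurable_subl_rV.
Qed.

(** The functional is integration against g. Hoelder bounds it by the L^q norm, which is at most the
    Sobolev norm because the Gagliardo term is nonnegative. *)
Lemma represents_neg_sobolev (R : realType) (n : nat) (p alpha : R)
    (f : tempered_distribution R n) (g : 'rV[R]_n -> R) : 1 < p -> Lp p g ->
  represents g f -> neg_sobolev alpha p f.
Proof.
move=> p1 Lg gf; have p0 : 0 < p by lra.
have [mg pg] := (LpP g p0).1 Lg.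
have [pq q1] := conjugate_exponentP p1.
rewrite /neg_sobolev; set q := conjugate_exponent p in pq q1 *.
have q0 : 0 < q by lra.
have int h : Lp q h -> (@lebesgue_rV R n).-integrable setT (EFin \o (fun x => g x * h x)) /\
    (`|\int[@lebesgue_rV R n]_x (g x * h x)|%:E <=
    'N[@lebesgue_rV R n]_p%:E[EFin \o g] * 'N[@lebesgue_rV R n]_q%:E[EFin \o h])%E.
  by move=> /(LpP h q0)[mh ph]; exact: hoelder_integrable.
exists (fun h => \int[@lebesgue_rV R n]_x (g x * h x)); split.
- move=> c h k [Lh _] [Lk _]; have [ih _] := int h Lh; have [ik _] := int k Lk.
  rewrite -RintegralZl// -RintegralD//; last exact: (integrableZl measurableT c ih).
  by apply: eq_Rintegral => x _; ring.
- have Ng : ('N[@lebesgue_rV R n]_p%:E[EFin \o g] \is a fin_num)%E.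
    by rewrite ge0_fin_numE ?Lnorm_ge0// LnormE poweR_lty.
  exists (fine ('N[@lebesgue_rV R n]_p%:E[EFin \o g])%E) => h [Lh _].
  have [_ H] := int h Lh; rewrite fineK//; apply: (le_trans H).
  rewrite lee_wpmul2l ?Lnorm_ge0// /sobolev_norm pow_integral_Lnorm// LnormE.
  have G0 : (0 <= gagliardo alpha q h)%E.
    apply: integral_ge0 => y _; apply: integral_ge0 => x _.
    by rewrite lee_fin divr_ge0 ?powR_ge0.
  have qi : 0 <= q^-1 by rewrite invr_ge0 ltW.
  rewrite gt0_ler_poweR//.
  + by rewrite in_itv/= leey pow_integral_ge0.
  + by rewrite in_itv/= leey adde_ge0// pow_integral_ge0.
  + by rewrite leeDl.
- by move=> phi sphi; rewrite /Rintegral -gf.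
Qed.

(** * Bounds for alpha times the p-th power of the norm *)

Definition heat_energy (R : realType) (n : nat) (p : R) (f : tempered_distribution R n)
  (t : R) : \bar R := pow_integral (@lebesgue_rV R n) p (convolution f (heat_kernel t)).

Lemma ge0_subset_integral_nonmeasurable d (T : measurableType d) (R : realType)
    (mu : {measure set T -> \bar R}) (D E : set T) (f g : T -> \bar R) :
  D `<=` E -> (forall x, D x -> (0 <= f x <= g x)%E) -> (forall x, E x -> (0 <= g x)%E) ->
  (\int[mu]_(x in D) f x <= \int[mu]_(x in E) g x)%E.
Proof.
move=> DE fg g0; rewrite integral_mkcond [leRHS]integral_mkcond.
apply: ge0_le_integral_nonmeasurable => x _; rewrite !patchE.
  by case: ifPn => // /set_mem /fg /andP[].
case: ifPn => [/set_mem Dx|_].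
  by rewrite mem_set; [have /andP[] := fg x Dx|exact: DE].
by case: ifPn => // /set_mem /g0.
Qed.

Lemma neg_sobolev_norm_powE (R : realType) (n : nat) (p alpha : R)
    (f : tempered_distribution R n) : 0 < p -> neg_sobolev alpha p f ->
  (neg_sobolev_norm alpha p f `^ p = \int[@lebesgue_measure R]_(t in `]0%R, 1%R[)
    ((t `^ (alpha * p / 2 - 1))%:E * heat_energy p f t))%E.
Proof.
move=> p0 nf; rewrite /neg_sobolev_norm asboolT//.
rewrite -poweRrM mulVf ?gt_eqF// poweRe1; last first.
  apply: integral_ge0 => t /=; rewrite in_itv/= => /andP[t0 _].
  by rewrite mule_ge0 ?poweR_ge0// lee_fin invr_ge0 ltW.
apply: eq_integral => t; rewrite inE/= in_itv/= => /andP[t0 _].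
rewrite poweRM ?Lnorm_ge0 ?lee_fin ?powR_ge0// pow_integral_Lnorm//.
rewrite muleAC poweR_EFin -EFinM -/(heat_energy p f t); congr (_%:E * _)%E.
rewrite -powRrM -[t^-1](powR_inv1 (ltW t0)) -powRD; last by rewrite (gt_eqF t0) implybT.
by congr (_ `^ _); ring.
Qed.

(** With a = alpha p/2, the weight t^{a-1} has integral eta^a / a over ]0, eta[, and alpha / a =
    2/p. The bound eta^a >= 1 + a ln eta makes the loss from restricting to ]0, eta[ linear in
    alpha. *)
Lemma neg_sobolev_norm_pow_ge (R : realType) (n : nat) (p alpha c eta : R)
    (f : tempered_distribution R n) : 0 < p -> 0 < alpha -> 0 <= c -> 0 < eta <= 1 ->
  (forall t, 0 < t < eta -> (c%:E <= heat_energy p f t)%E) ->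
  ((2 / p * c * (1 + alpha * p / 2 * ln eta))%:E <=
    alpha%:E * neg_sobolev_norm alpha p f `^ p)%E.
Proof.
move=> p0 al0 c0 /andP[eta0 eta1] Hc.
(* Outside the space the norm is [+oo], and the claim holds because alpha > 0. *)
have [nf|nf] := pselect (neg_sobolev alpha p f); last first.
  rewrite /neg_sobolev_norm asboolF// poweRE gt_eqF// eqxx gt0_muley ?lte_fin//.
  by rewrite leey.
rewrite neg_sobolev_norm_powE//; set a := alpha * p / 2.
have a0 : 0 < a by rewrite divr_gt0// mulr_gt0.
have F0 (t : R) : (0 <= heat_energy p f t)%E by exact: pow_integral_ge0.
apply: (@le_trans _ _ (alpha%:E * (c * (eta `^ a / a))%:E)%E).
  rewrite -EFinM lee_fin.
  have e : alpha * (c * (eta `^ a / a)) = 2 / p * c * eta `^ a.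
    by rewrite /a; field; rewrite !gt_eqF.
  rewrite e ler_wpM2l ?mulr_ge0 ?invr_ge0 ?(ltW p0)//.
  by rewrite /powR gt_eqF// expR_ge1Dx.
rewrite lee_pmul2l ?lte_fin//.
rewrite EFinM -integral_powR_itv// -ge0_integralZl_EFin//.
- apply: ge0_subset_integral_nonmeasurable => /=.
  + by move=> t /=; rewrite !in_itv/= => /andP[-> h]; exact: lt_le_trans eta1.
  + move=> t; rewrite in_itv/= => /andP[t0 te]; rewrite mule_ge0 ?lee_fin ?powR_ge0//=.
    rewrite muleC; apply: lee_wpmul2l; first by rewrite lee_fin powR_ge0.
    by apply: Hc; rewrite t0.
  + by move=> t _; rewrite mule_ge0 ?lee_fin ?powR_ge0.
- by move=> t _; rewrite lee_fin powR_ge0.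
- apply/measurable_EFinP; apply: measurable_funTS; exact: measurable_powR.
Qed.

Lemma neg_sobolev_norm_pow_le (R : realType) (n : nat) (p alpha M : R)
    (f : tempered_distribution R n) : 0 < p -> 0 < alpha -> 0 <= M ->
  neg_sobolev alpha p f -> (forall t, 0 < t < 1 -> (heat_energy p f t <= M%:E)%E) ->
  (alpha%:E * neg_sobolev_norm alpha p f `^ p <= (2 / p * M)%:E)%E.
Proof.
move=> p0 al0 M0 nf HM; rewrite neg_sobolev_norm_powE//; set a := alpha * p / 2.
have a0 : 0 < a by rewrite divr_gt0// mulr_gt0.
have F0 (t : R) : (0 <= heat_energy p f t)%E by exact: pow_integral_ge0.
have -> : 2 / p * M = alpha * (M * (1 `^ a / a)).
  by rewrite powR1 /a; field; rewrite !gt_eqF.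
rewrite EFinM lee_pmul2l ?lte_fin//.
rewrite EFinM -integral_powR_itv// -ge0_integralZl_EFin//.
- apply: ge0_le_integral_nonmeasurable => t /=; rewrite in_itv/= => /andP[t0 t1].
    by rewrite mule_ge0 ?lee_fin ?powR_ge0.
  rewrite [leRHS]muleC; apply: lee_wpmul2l; first by rewrite lee_fin powR_ge0.
  by apply: HM; rewrite t0.
- by move=> t _; rewrite lee_fin powR_ge0.
- apply/measurable_EFinP; apply: measurable_funTS; exact: measurable_powR.
Qed.

(** * From the finite lower limit to the representative and the limit *)

Lemma limf_einf_frequently_lt (R : realType) (u : R -> \bar R) :
  (limf_einf u 0^'+ < +oo)%E -> exists K : R, 0 < K /\
    forall d : R, 0 < d -> exists a : R, 0 < a < d /\ (u a < K%:E)%E.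
Proof.
rewrite limf_einfE => H.
have [K [K0 HK]] : exists K : R, 0 < K /\
    (ereal_sup [set ereal_inf [set u x | x in V] | V in 0^'+] < K%:E)%E.
  move: H; case: (ereal_sup _) => [r _|//|_].
    exists (`|r| + 1); split; first by rewrite ltr_wpDl.
    by rewrite lte_fin; have := ler_norm r; lra.
  by exists 1; rewrite ltNyr.
exists K; split => // d d0.
pose V : set R := [set x | 0 < x < d].
have VF : (0 : R)^'+ V.
  by near=> x; apply/andP; split; near: x; [exact: nbhs_right_gt|exact: nbhs_right_lt].
have := le_lt_trans (ereal_sup_ubound (ex_intro2 _ _ V VF erefl)) HK.
by move=> /ereal_inf_lt[_ [a Va <-] uK]; exists a.
Unshelve. all: by end_near. Qed.

(** Suppose F exceeds p K on all of ]0, eta[. The lower bound is then 2K (1 + (alpha p/2) ln eta),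
    which is above K for small alpha, whereas the lower limit gives arbitrarily small alpha with a
    value below K. *)
Lemma heat_energy_frequently_bounded (R : realType) (n : nat) (p : R)
    (f : tempered_distribution R n) : 0 < p ->
  (limf_einf (fun alpha : R => alpha%:E * neg_sobolev_norm alpha p f `^ p) 0^'+ < +oo)%E ->
  exists c : R, 0 <= c /\ forall eta, 0 < eta ->
    exists t, 0 < t < eta /\ (heat_energy p f t <= c%:E)%E.
Proof.
move=> p0 /limf_einf_frequently_lt[K [K0 HK]].
exists (p * K); split; first by rewrite mulr_ge0// ltW.
move=> eta0 eta00; pose eta := Num.min eta0 1.
have eta_gt0 : 0 < eta by rewrite lt_min eta00 ltr01.
have eta1 : eta <= 1 by rewrite ge_min lexx orbT.
apply: contrapT => hN.
have Hc t : 0 < t < eta -> ((p * K)%:E <= heat_energy p f t)%E.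
  move=> /andP[t0 te]; rewrite leNgt; apply/negP => lt; apply: hN; exists t; split.
    by rewrite t0 (lt_le_trans te)// ge_min lexx.
  exact: ltW.
(* For a < 1/(p L) the loss - a p ln eta is less than 1, so the lower bound remains above K; the 1
   in L makes it positive even when eta = 1. *)
pose L := 1 - ln eta.
have L0 : 0 < L by rewrite /L; have := ln_le0 eta1; lra.
have [a [/andP[a0 aL] aK]] := HK (p * L)^-1 ltac:(by rewrite invr_gt0 mulr_gt0).
have := neg_sobolev_norm_pow_ge p0 a0 (ltW (mulr_gt0 p0 K0)) (introT andP (conj eta_gt0 eta1)) Hc.
move=> /le_lt_trans => /(_ _ aK); rewrite lte_fin.
have -> : 2 / p * (p * K) * (1 + a * p / 2 * ln eta) = K * (2 - (a * (p * L) - a * p)).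
  by rewrite /L; field; rewrite gt_eqF.
rewrite gtr_pMr//.
have : a * (p * L) < 1 by rewrite -ltr_pdivlMr ?mulr_gt0// div1r.
have : 0 < a * p by rewrite mulr_gt0.
lra.
Qed.

(** M is the infimum of the levels that F reaches or undercuts at arbitrarily small times. Its
    minimality is used twice: Young's inequality makes the energy of the weak limit g one of these
    levels, so it cannot be below M; and a d < M is not such a level, so F exceeds d near 0. *)
Lemma heat_energy_representative (R : realType) (n : nat) (p c : R)
    (f : tempered_distribution R n) : 1 < p -> 0 <= c ->
  (forall eta : R, 0 < eta -> exists t : R, 0 < t < eta /\ (heat_energy p f t <= c%:E)%E) ->
  exists (g : 'rV[R]_n -> R) (M : R), [/\ 0 <= M, measurable_fun setT g, represents g f,
    pow_integral (@lebesgue_rV R n) p g = M%:E & forall d : R, d < M ->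
    exists eta : R, 0 < eta /\ forall t : R, 0 < t < eta -> (d%:E <= heat_energy p f t)%E].
Proof.
move=> p1 c0 Hc.
pose S : set R := [set d | 0 <= d /\ forall eta : R, 0 < eta ->
  exists t : R, 0 < t < eta /\ (heat_energy p f t <= d%:E)%E].
have S0 : lbound S 0 by move=> d [].
have Sinf : has_inf S by split; [exists c|exists 0].
pose M := inf S.
have M0 : 0 <= M by apply: lb_le_inf => //; exists c.
have SM d : S d -> M <= d by move=> Sd; apply: ge_inf => //; exists 0.
have [t Ht] : {t : nat -> R & forall k, 0 < t k < k.+1%:R^-1 /\
    (heat_energy p f (t k) <= (M + k.+1%:R^-1)%:E)%E}.
  apply: (@choice _ _ (fun (k : nat) (s : R) => 0 < s < k.+1%:R^-1 /\
    (heat_energy p f s <= (M + k.+1%:R^-1)%:E)%E)) => k.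
  have k0 : 0 < k.+1%:R^-1 :> R by rewrite invr_gt0.
  have [d [_ Sd] dM] := inf_adherent k0 Sinf.
  have [s [sk Fs]] := Sd _ k0; exists s; split => //.
  by apply: (le_trans Fs); rewrite lee_fin ltW.
have t0 k : 0 < t k by have [/andP[]] := Ht k.
have [g [mg gM gf]] : exists h, [/\ measurable_fun setT h,
    (pow_integral (@lebesgue_rV R n) p h <= M%:E)%E & represents h f].
  apply: (@td_weak_limit R n p M f (fun k => convolution f (heat_kernel (t k)))) => //.
  - by move=> k; exact: measurable_convolution_heat.
  - by move=> k; have [] := Ht k.
  - move=> phi e sphi e0; have [K [K0 HK]] := td_heat_limit f sphi.
    have K1 : 0 < K + 1 by rewrite ltr_wpDl.
    (* From this index on, t k < 1/(k+1) <= (e/(K+1))^2, so the error K sqrt(t k) is at most e. *)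
    exists (Num.truncn (((K + 1) / e) ^+ 2)) => k mk.
    have [/andP[_ tk] _] := Ht k.
    have tk1 : t k <= 1.
      by apply: (le_trans (ltW tk)); rewrite invf_le1// ler1n.
    apply: (le_trans (HK (t k) (introT andP (conj (t0 k) tk1)))).
    apply: (@le_trans _ _ ((K + 1) * Num.sqrt (t k))).
      by rewrite ler_wpM2r ?sqrtr_ge0// lerDl.
    rewrite mulrC -ler_pdivlMr//.
    have e1 : 0 < e / (K + 1) by rewrite divr_gt0.
    rewrite -(ger0_norm (ltW e1)) -sqrtr_sqr ler_sqrt ?exprn_ge0 ?(ltW e1)//.
    apply: (le_trans (ltW tk)).
    rewrite -[leRHS]invrK lef_pV2 ?posrE ?invr_gt0 ?exprn_gt0//.
    rewrite -exprVn invf_div; apply: (le_trans (ltW (truncnS_gt _))).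
    by rewrite ler_nat ltnS.
exists g, M; split => //.
  have g0 := pow_integral_ge0 (@lebesgue_rV R n) p g.
  have Fg s : 0 < s -> (heat_energy p f s <= pow_integral (@lebesgue_rV R n) p g)%E.
    by move=> s0; exact: pow_integral_convolution_le.
  move: g0 gM Fg; case: (pow_integral _ _ _) => [r r0 rM Fr|//|//].
  apply/eqP; rewrite eq_le rM/= lee_fin; apply: SM; split; first by rewrite -lee_fin.
  move=> eta eta0; exists (eta / 2); split; first by apply/andP; split; lra.
  by apply: Fr; lra.
move=> d dM; have [d0|d0] := leP 0 d; last first.
  exists 1; split => // s _; apply: le_trans (pow_integral_ge0 _ _ _).
  by rewrite lee_fin ltW.
apply: contrapT => hN; have : ~ S d by move=> /SM; rewrite leNgt dM.
apply; split => // eta eta0; apply: contrapT => hN2; apply: hN; exists eta; split => // s hs.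
by rewrite leNgt; apply/negP => lt; apply: hN2; exists s; split=> //; exact: ltW.
Qed.

(** The upper bound (2/p) M holds for every alpha > 0. The lower bound with c slightly below M loses
    only a term linear in alpha. *)
Lemma neg_sobolev_norm_limit (R : realType) (n : nat) (p M : R)
    (f : tempered_distribution R n) : 0 < p -> 0 <= M ->
  (forall alpha, neg_sobolev alpha p f) ->
  (forall t : R, 0 < t -> (heat_energy p f t <= M%:E)%E) ->
  (forall d : R, d < M -> exists eta : R, 0 < eta /\ forall t : R, 0 < t < eta ->
    (d%:E <= heat_energy p f t)%E) ->
  (alpha%:E * neg_sobolev_norm alpha p f `^ p)%E @[alpha --> (0 : R)^'+] -->
    (2 / p * M)%:E.
Proof.
move=> p0 M0 nf upper lower.
have up a : 0 < a -> (a%:E * neg_sobolev_norm a p f `^ p <= (2 / p * M)%:E)%E.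
  by move=> a0; apply: neg_sobolev_norm_pow_le => // t /andP[t0 _]; exact: upper.
have ge0 a : 0 < a -> (0 <= a%:E * neg_sobolev_norm a p f `^ p)%E.
  by move=> a0; rewrite mule_ge0 ?poweR_ge0// lee_fin ltW.
have fin a : 0 < a -> (a%:E * neg_sobolev_norm a p f `^ p)%E \is a fin_num.
  by move=> a0; rewrite ge0_fin_numE ?ge0//; apply: (le_lt_trans (up a a0)); rewrite ltry.
have fin0 : \forall a \near (0 : R)^'+, 
    (a%:E * neg_sobolev_norm a p f `^ p)%E \is a fin_num.
  by near=> a; apply: fin; near: a; exact: nbhs_right_gt.
apply/fine_cvgP; split => //.
apply/cvgrPdist_le => e e0.
have pe0 : 0 < p * e by exact: mulr_gt0.
(* The gap p e/4 becomes e/2 after multiplication by 2/p. If M is itself that small, c = 0 serves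
   and keeps c nonnegative. *)
have [c [c0 cM [eta1 [eta10 Heta1]]]] : exists c : R, [/\ 0 <= c, M - c <= p * e / 4 &
    exists eta : R, 0 < eta /\ forall t : R, 0 < t < eta -> (c%:E <= heat_energy p f t)%E].
  have [Me|Me] := leP M (p * e / 4).
    exists 0; split => //; first by rewrite subr0.
    by exists 1; split => // t _; exact: pow_integral_ge0.
  by exists (M - p * e / 4); split; [lra|lra|apply: lower; lra].
pose eta := Num.min eta1 1.
have eta_01 : 0 < eta <= 1 by rewrite lt_min eta10 ltr01 ge_min lexx orbT.
have Heta t : 0 < t < eta -> (c%:E <= heat_energy p f t)%E.
  move=> /andP[t0 te]; apply: Heta1; rewrite t0 (lt_le_trans te)//.
  by rewrite ge_min lexx.
(* The loss in the lower bound is a c (- ln eta) = a D - a c, hence below e/2 once a (D + 1) < e/2;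
   the added 1 keeps the divisor positive. *)
pose D := c * (1 - ln eta).
have D0 : 0 <= D by rewrite mulr_ge0//; have /andP[_ /ln_le0] := eta_01; lra.
near=> a.
have a0 : 0 < a by near: a; exact: nbhs_right_gt.
have aD : a * (D + 1) < e / 2.
  rewrite -ltr_pdivlMr; last lra.
  by near: a; apply: nbhs_right_lt; rewrite !divr_gt0//; lra.
have := up a a0; have := neg_sobolev_norm_pow_ge p0 a0 c0 eta_01 Heta.
rewrite -{1 2}(fineK (fin a a0)) !lee_fin => lo hi /=.
rewrite ger0_norm ?subr_ge0// lerBlDr -lerBlDl; apply: le_trans lo.
have -> : 2 / p * c * (1 + a * p / 2 * ln eta) = 2 / p * c + a * c - a * D.
  by rewrite /D; field; rewrite gt_eqF.
have : 2 / p * M - 2 / p * c <= e / 2.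
  rewrite -mulrBr; apply: (@le_trans _ _ (2 / p * (p * e / 4))).
    by rewrite ler_pM2l// divr_gt0.
  by rewrite le_eqVlt; apply/orP; left; apply/eqP; field; rewrite gt_eqF.
have : 0 <= a * c by rewrite mulr_ge0// ltW.
lra.
Unshelve. all: by end_near. Qed.

Theorem theorem2p1 (R : realType) (n : nat) (p : R)
    (f : tempered_distribution R n) (hn : (0 < n)%N) (hp : 1 < p)
    (hf : exists alpha : R, 0 < alpha < 1 /\ neg_sobolev alpha p f)
    (hliminf : (limf_einf (fun alpha : R =>
      alpha%:E * neg_sobolev_norm alpha p f `^ p) 0^'+ < +oo)%E) :
  exists g : 'rV[R]_n -> R,
    [/\ Lp p g,
        represents g f
      & (alpha%:E * neg_sobolev_norm alpha p f `^ p)%E @[alpha --> 0^'+] -->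
        ((2 / p)%:E * 'N[@lebesgue_rV R n]_p%:E[EFin \o g] `^ p)%E].
Proof.
have p0 : 0 < p by lra.
have [c [c0 Hc]] := heat_energy_frequently_bounded p0 hliminf.
have [g [M [M0 mg gf gM lower]]] := heat_energy_representative hp c0 Hc.
have Lg : Lp p g by apply/(LpP g p0); rewrite gM ltry.
exists g; split => //.
rewrite pow_integral_Lnorm// gM -EFinM; apply: neg_sobolev_norm_limit => //.
  by move=> alpha; exact: represents_neg_sobolev Lg gf.
by move=> t t0; rewrite -gM; exact: pow_integral_convolution_le.
Qed.
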